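(* For every composition $\mu$, $\widetilde{E}_\mu$ is a $\mathscr{Y}$-weight vector with weight $\widetilde{\alpha}_\mu$, i.e. $\mathscr{Y}_r\widetilde{E}_\mu=\widetilde{\alpha}_\mu(r)\widetilde{E}_\mu$ for all $r\in\mathbb{N}$.
   Context: Let $\mathbb{F}=\mathbb{Q}(q,t)$ with the $t$-adic topology. A composition is a finite tuple of non-negative integers, $\mu*0^m$ appends $m$ zeros. On $\mathscr{P}^+_N=\mathbb{F}[x_1,\ldots,x_N]$: $T_if=s_if+(1-t)x_i\frac{f-s_if}{x_i-x_{i+1}}$, $\omega_Nf=f(q^{-1}x_N,x_1,\ldots,x_{N-1})$, $Y^{(N)}_1=\omega_N^{-1}T_{N-1}^{-1}\cdots T_1^{-1}$, $Y^{(N)}_{i+1}=t^{-1}T_iY^{(N)}_iT_i$. For $\nu\in\mathbb{Z}^N_{\ge0}$, $E_\nu$ is the non-symmetric Macdonald polynomial (the unique $x^\nu+$(Bruhat-lower terms) simultaneous eigenvector of $Y^{(N)}_1,\ldots,Y^{(N)}_N$); write $Y^{(n+m)}_iE_{\mu*0^m}=\alpha^{(m)}_\mu(i)E_{\mu*0^m}$. $\Lambda$ is the ring of symmetric functions over $\mathbb{F}$; $\mathscr{P}(k)^+=\mathbb{F}[x_1,\ldots,x_k]\otimes\Lambda[x_{k+1}+x_{k+2}+\cdots]$ (plethystic notation), $\mathscr{P}^+_{as}=\bigcup_k\mathscr{P}(k)^+$. Convergence of sequences $f_k\in\mathscr{P}^+_k$ is in the sense of Ion–Wu (decompose $f_k=h_k+\sum_{i\le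 N}a^{(i)}_kg^{(i)}_k$ with $h_k,g^{(i)}_k$ converging in the inverse limit $\mathscr{P}^+_\infty$ of the $\mathscr{P}^+_k$ under $x_{k+1}\mapsto0$, limits $g^{(i)}\in\mathscr{P}^+_{as}$, and scalars $a^{(i)}_k\in\mathbb{F}$ converging $t$-adically in $\mathbb{F}$). $\widetilde{E}_\mu:=\lim_mE_{\mu*0^m}\in\mathscr{P}(\ell(\mu))^+$, which exists. Limit Cherednik operators: $\pi_n:\mathscr{P}^+_{as}\to\mathscr{P}^+_n$ sets $x_j=0$ for $j>n$; $\rho$ is the linear map on $\mathscr{P}^+_{as}$ with $\rho(x_1^{a_1}\cdots x_n^{a_n}F[x_m+x_{m+1}+\cdots])=\mathbb{1}(a_1>0)\,x_1^{a_1}\cdots x_n^{a_n}F[x_m+\cdots]$. Define $\mathscr{Y}_1f=\lim_n t^n\rho(Y^{(n)}_1\pi_nf)$ (this limit exists in $\mathscr{P}^+_{as}$), let $T_i$ act on $\mathscr{P}^+_{as}$ by the Demazure–Lusztig formula, and set $\mathscr{Y}_{i+1}=t^{-1}T_i\mathscr{Y}_iT_i$ for $i\ge1$. A $\mathscr{Y}$-weight vector with weight $\alpha:\mathbb{N}\to\mathbb{F}$ is a nonzero $f$ with $\mathscr{Y}_if=\alpha(i)f$ for all $i\in\mathbb{N}$. For a composition $\mu$ of length $n$, $\widetilde{\alpha}_\mu(i):=\lim_m t^{n+m}\alpha^{(m)}_\mu(i)$ ($t$-adic limit, which exists); $\widetilde{\alpha}_\mu(i)=0$ for $i>n$, and for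 $i\le n$, $\widetilde{\alpha}_\mu(i)=0$ iff $\mu_i=0$. *)

(* Defs.v *)
From HB Require Import structures.
From mathcomp Require Import all_boot all_order all_algebra all_fingroup fraction.
From mathcomp Require Import mpoly.
From Stdlib Require Import ClassicalEpsilon Relations.

Set Implicit Arguments.
Unset Strict Implicit.
Unset Printing Implicit Defensive.

Import GRing.Theory.
Local Open Scope ring_scope.

(* The base field F = Q(q,t) = Frac((Q[q])[t]); the outer variable is t. *)
Definition Fld : fieldType := {fraction {poly {poly rat}}}.
Definition tofr (x : {poly {poly rat}}) : Fld := @FracField.tofrac _ x.
Local Notation "x %:F" := (tofr x).
Definition tt_ : Fld := ('X : {poly {poly rat}})%:F.
Definition qq_ : Fld := ((('X : {poly rat})%:P) : {poly {poly rat}})%:F.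

Definition choose_ {T : Type} (d : T) (P : T -> Prop) : T :=
  epsilon (inhabits d) P.

(* t-adic topology: x lies in t^N * O, O = {a/b : b(t=0) <> 0} the valuation
   ring of the t-adic valuation. *)
Definition tsmall (N : nat) (x : Fld) : Prop :=
  exists a b : {poly {poly rat}}, b`_0 != 0 /\ x = tt_ ^+ N * (a%:F / b%:F).
Definition tconv (a : nat -> Fld) (l : Fld) : Prop :=
  forall N : nat, exists K : nat, forall k, (K <= k)%N -> tsmall N (a k - l).

(* Finitely many variables: P_N^+ = F[x_1,...,x_N] = {mpoly Fld[N]}.
   Variables are numbered from 1 as in the paper: xv N j = x_j
   (and x_j := 0 when j = 0 or j > N). *)
Definition xv (N j : nat) : {mpoly Fld[N]} :=
  if (0 < j)%N then (if insub j.-1 is Some i then 'X_i else 0) else 0.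

Definition substv (n k : nat) (g : nat -> {mpoly Fld[k]}) (f : {mpoly Fld[n]})
  : {mpoly Fld[k]} := f \mPo [tuple g (nat_of_ord i).+1 | i < n].

Definition si (N i : nat) (f : {mpoly Fld[N]}) : {mpoly Fld[N]} :=
  substv (fun j => if j == i then xv N i.+1 else if j == i.+1 then xv N i
                   else xv N j) f.

Definition ddiff (N i : nat) (f : {mpoly Fld[N]}) : {mpoly Fld[N]} :=
  choose_ 0 (fun g => g * (xv N i - xv N i.+1) = f - si i f).

Definition Top (N i : nat) (f : {mpoly Fld[N]}) : {mpoly Fld[N]} :=
  if (0 < i < N)%N then si i f + (1 - tt_) *: (xv N i * ddiff i f) else f.

Definition Tinv (N i : nat) (f : {mpoly Fld[N]}) : {mpoly Fld[N]} :=
  choose_ 0 (fun g => Top i g = f).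

Definition omega (N : nat) (f : {mpoly Fld[N]}) : {mpoly Fld[N]} :=
  substv (fun j => if j == 1%N then qq_^-1 *: xv N N else xv N j.-1) f.

Definition omegainv (N : nat) (f : {mpoly Fld[N]}) : {mpoly Fld[N]} :=
  choose_ 0 (fun g => omega g = f).

Definition Y1 (N : nat) (f : {mpoly Fld[N]}) : {mpoly Fld[N]} :=
  omegainv (foldl (fun g i => Tinv i g) f (iota 1 N.-1)).

Fixpoint Yop (N i : nat) (f : {mpoly Fld[N]}) {struct i} : {mpoly Fld[N]} :=
  match i with
  | 0 => f
  | j.+1 => match j with
            | 0 => Y1 f
            | _ => tt_^-1 *: Top j (Yop j (Top j f))
            end
  end.

Definition mseq (N : nat) (m : 'X_{1..N}) : seq nat := [seq m i | i <- enum 'I_N].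

Definition dominant (N : nat) (m : 'X_{1..N}) : seq nat := sort geq (mseq m).

Definition dom_lt (a b : seq nat) : Prop :=
  a <> b /\ sumn a = sumn b /\ forall k, (sumn (take k a) <= sumn (take k b))%N.

Definition bstep (N : nat) (lam mu : 'X_{1..N}) : Prop :=
  exists i j : 'I_N, (i < j)%N /\ (lam j < lam i)%N /\
    mu = [multinom lam (perm.tperm i j k) | k < N].

Definition bru_lt (N : nat) (lam mu : 'X_{1..N}) : Prop :=
  dom_lt (dominant lam) (dominant mu) \/
  (dominant lam = dominant mu /\ lam <> mu /\ clos_refl_trans _ (@bstep N) lam mu).

Definition is_Emac (N : nat) (nu : 'X_{1..N}) (E : {mpoly Fld[N]}) : Prop :=
  (forall i, (1 <= i <= N)%N -> exists a : Fld, Yop i E = a *: E) /\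
  E@_nu = 1 /\
  (forall lam : 'X_{1..N}, E@_lam != 0 -> lam = nu \/ bru_lt lam nu).

Definition Emac (N : nat) (nu : 'X_{1..N}) : {mpoly Fld[N]} :=
  choose_ 0 (is_Emac nu).

Definition mu0 (mu : seq nat) (m : nat) : 'X_{1..(size mu + m)} :=
  [multinom nth 0%N mu i | i < size mu + m].

Definition alpha_m (mu : seq nat) (m i : nat) : Fld :=
  choose_ 0 (fun a => Yop i (Emac (mu0 mu m)) = a *: Emac (mu0 mu m)).

Definition alpha_tilde (mu : seq nat) (i : nat) : Fld :=
  choose_ 0 (tconv (fun m => tt_ ^+ (size mu + m) * alpha_m mu m i)).

(* Infinitely many variables.  An element of the inverse limit P_infty^+
   of the P_k^+ under x_{k+1} |-> 0 (graded inverse limit) is a compatible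
   family of bounded degree of its images pi_k f in P_k^+. *)
Definition Pseq := forall k : nat, {mpoly Fld[k]}.

(* P_n^+ -> P_k^+ : x_j |-> x_j (j <= k), x_j |-> 0 (j > k) *)
Definition restr (n k : nat) (g : {mpoly Fld[n]}) : {mpoly Fld[k]} :=
  substv (fun j => xv k j) g.

Definition inPinf (f : Pseq) : Prop :=
  (forall k, restr k (f k.+1) = f k) /\
  exists d : nat, forall k, (msize (f k) <= d)%N.

(* P(n)^+ = F[x_1..x_n] (x) Lambda[x_{n+1} + x_{n+2} + ...] inside P_infty^+:
   the elements symmetric in the variables x_{n+1}, x_{n+2}, ... *)
Definition inPk (n : nat) (f : Pseq) : Prop :=
  inPinf f /\
  forall k (s : perm.perm_of 'I_k),
    (forall i : 'I_k, (i < n)%N -> s i = i) -> msym s (f k) = f k.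

Definition inPas (f : Pseq) : Prop := exists n, inPk n f.

Definition Pzero : Pseq := fun k => 0.
Definition Pscale (c : Fld) (f : Pseq) : Pseq := fun k => c *: f k.

Definition inv_conv (hs : forall k, {mpoly Fld[k]}) (h : Pseq) : Prop :=
  inPinf h /\
  forall n, exists K, forall k, (K <= k)%N -> restr n (hs k) = h n.

Definition IWconv (fs : forall k, {mpoly Fld[k]}) (f : Pseq) : Prop :=
  exists (N : nat) (hs : forall k, {mpoly Fld[k]}) (h : Pseq)
         (a : nat -> nat -> Fld) (gs : nat -> forall k, {mpoly Fld[k]})
         (al : nat -> Fld) (g : nat -> Pseq),
    (forall k, fs k = hs k + \sum_(i < N) a i k *: gs i k) /\
    inv_conv hs h /\
    (forall i, (i < N)%N ->
       [/\ inv_conv (gs i) (g i), inPas (g i) & tconv (a i) (al i)]) /\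
    f = (fun k => h k + \sum_(i < N) al i *: g i k).

Definition IWlim (fs : forall k, {mpoly Fld[k]}) : Pseq :=
  choose_ Pzero (fun f => inPas f /\ IWconv fs f).

(* E~_mu = lim_m E_{mu*0^m}  (E_{mu*0^m} sits in P_{n+m}^+) *)
Definition Etilde (mu : seq nat) : Pseq :=
  IWlim (fun k => restr k (Emac (mu0 mu (k - size mu)))).

(* rho: keep the part with a_1 > 0, i.e. f - f|_{x_1 = 0} *)
Definition x1zero (k : nat) (g : {mpoly Fld[k]}) : {mpoly Fld[k]} :=
  substv (fun j => if j == 1%N then 0 else xv k j) g.
Definition rho (f : Pseq) : Pseq := fun k => f k - x1zero (f k).

Definition Ycal1 (f : Pseq) : Pseq :=
  IWlim (fun n => tt_ ^+ n *: (Yop 1 (f n) - x1zero (Yop 1 (f n)))).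

(* T_i on P_as^+ by the Demazure-Lusztig formula, computed in P_K^+ for
   K = max(k, i+1) and projected to P_k^+ *)
Definition Tinf (i : nat) (f : Pseq) : Pseq :=
  fun k => restr k (Top i (f (maxn k i.+1))).

Fixpoint Ycal (i : nat) (f : Pseq) {struct i} : Pseq :=
  match i with
  | 0 => f
  | j.+1 => match j with
            | 0 => Ycal1 f
            | _ => Pscale tt_^-1 (Tinf j (Ycal j (Tinf j f)))
            end
  end.

Definition Yweight_vector (f : Pseq) (alpha : nat -> Fld) : Prop :=
  f <> Pzero /\ forall i : nat, (1 <= i)%N -> Ycal i f = Pscale (alpha i) f.

(* Main.v *)
(** Each Y_i is triangular on monomials for the Bruhat order, with eigenvalues that
    determine the exponent, and the Y_i commute. So E_nu is, up to a scalar, the image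
    of x^nu under a product of factors Y_i - c taken over any list of pairs (i, c) that
    separates nu from the compositions below it. For nu = mu*0^m the list can be chosen
    with a size independent of m, involving only Y_1, ..., Y_n, and with
    t^(n+m)-scaled constants c that converge t-adically.

    On a stable family b (an element of P_as^+) one has exactly
    t^N Y_1 b_N = S_N + t^N R_N with S and R stable and S divisible by x_1. Hence
    Ycal_1 b = S, and finite combinations of stable families with t-adically convergent
    coefficients are preserved by the t^N Y_i, which pass to the limit Ycal_i. The
    sequence E_(mu*0^m) is such a combination, and passing to the limit in
    t^N Y_i E = t^N alpha(i) E gives the weight equation. *)

Require Import Defs.
From mathcomp Require Import all_boot all_order all_algebra all_fingroup fraction.
From mathcomp Require Import mpoly ring zify generic_quotient.
From Stdlib Require Import ClassicalEpsilon FunctionalExtensionality Relations.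

Set Implicit Arguments.
Unset Strict Implicit.
Unset Printing Implicit Defensive.

Import GRing.Theory.
Local Open Scope ring_scope.

(** * Substitutions in polynomials *)

(** Divided differences, inverses, E_nu, its eigenvalues and all limits are specified by choice, so
    the existence of each of them is part of the work. Two obstacles shape the argument. First, Y_1
    does not commute with setting the last variable to 0, and the parts of an Ion-Wu convergent
    sequence are controlled only after restriction to finitely many variables; so continuity of t^N
    Y_1 is proved only on combinations of stable families, where it follows by linearity from the
    case of a single family. Second, the normalising denominator of E_(mu*0^m) is a product of
    differences of scaled eigenvalues and must not tend to 0. A zero entry has scaled eigenvalue
    t^(N-r), which tends to 0, so two zero entries cannot be told apart in the limit. The separating
    list therefore compares only a zero entry with a positive one, or two distinct powers of q, and
    all these differences survive in the limit. *)

Lemma choose_spec (T : Type) (d : T) (P : T -> Prop) : (exists x, P x) -> P (choose_ d P).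
Proof. by move=> h; rewrite /choose_; apply: epsilon_spec. Qed.

Lemma tt_neq0 : tt_ != 0.
Proof.
by rewrite /tt_ /tofr tofrac_eq0 polyX_eq0.
Qed.

Lemma qq_neq0 : qq_ != 0.
Proof. by rewrite /qq_ /tofr tofrac_eq0 polyC_eq0 polyX_eq0. Qed.

(* [sv] is [substv] behind an opaque proof, so that unification never unfolds it. *)
Fact subst_sig : {s : forall n k, (nat -> {mpoly Fld[k]}) -> {mpoly Fld[n]} -> {mpoly Fld[k]}
  | s = substv}.
Proof. by exists substv. Qed.

Definition sv n k (g : nat -> {mpoly Fld[k]}) (f : {mpoly Fld[n]}) := sval subst_sig n k g f.

Lemma substvE n k (g : nat -> {mpoly Fld[k]}) (f : {mpoly Fld[n]}) : substv g f = sv g f.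
Proof. by rewrite /sv (svalP subst_sig). Qed.

Lemma svE n k (g : nat -> {mpoly Fld[k]}) (f : {mpoly Fld[n]}) :
  sv g f = f \mPo [tuple g (nat_of_ord i).+1 | i < n].
Proof. by rewrite -substvE. Qed.

Section Substv.
Variables (n k : nat) (g : nat -> {mpoly Fld[k]}).
Implicit Types f h : {mpoly Fld[n]}.

Lemma svD f h : sv g (f + h) = sv g f + sv g h.
Proof. rewrite !svE; exact: comp_mpolyD. Qed.
Lemma svB f h : sv g (f - h) = sv g f - sv g h.
Proof. rewrite !svE; exact: comp_mpolyB. Qed.
Lemma sv0 : sv g (0 : {mpoly Fld[n]}) = 0.
Proof. rewrite !svE; exact: comp_mpoly0. Qed.
Lemma sv1 : sv g (1 : {mpoly Fld[n]}) = 1.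
Proof. rewrite !svE; exact: comp_mpoly1. Qed.
Lemma svZ c f : sv g (c *: f) = c *: sv g f.
Proof. rewrite !svE; exact: comp_mpolyZ. Qed.
Lemma svM f h : sv g (f * h) = sv g f * sv g h.
Proof. rewrite !svE; exact: rmorphM. Qed.
Lemma svX f m : sv g (f ^+ m) = sv g f ^+ m.
Proof. rewrite !svE; exact: rmorphXn. Qed.

Lemma svC c : sv g (c%:MP_[n]) = c%:MP.
Proof. rewrite !svE; exact: comp_mpolyC. Qed.

Lemma sv_X (i : 'I_n) : sv g ('X_i) = g i.+1.
Proof. by rewrite svE comp_mpolyXU -tnth_nth tnth_mktuple. Qed.

End Substv.

Lemma xv_ord N (i : 'I_N) : xv N i.+1 = 'X_i.
Proof. by rewrite /xv /= insubT //= => h; congr 'X_(_); apply: val_inj. Qed.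

Lemma xv0 N j : (j == 0%N) || (N < j)%N -> xv N j = 0.
Proof.
case: j => [|j] //= h; rewrite /xv /= insubF //; lia.
Qed.

Lemma sv_xv n k (g : nat -> {mpoly Fld[k]}) j :
  (0 < j <= n)%N -> sv g (xv n j) = g j.
Proof.
case: j => [|j] //= h; have e : j = Ordinal h by [].
by rewrite [in LHS]e xv_ord sv_X.
Qed.

Lemma mpoly_ind n (P : {mpoly Fld[n]} -> Prop) :
  (forall c, P c%:MP) -> (forall i, P 'X_i) ->
  (forall f h, P f -> P h -> P (f + h)) ->
  (forall f h, P f -> P h -> P (f * h)) -> forall f, P f.
Proof.
move=> hC hX hD hM f.
have P1 : P 1 by rewrite -mpolyC1.
have hXn i m : P ('X_i ^+ m) by elim: m => [|m ih]; rewrite ?expr0 ?exprS //; apply: hM.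
have hm m : P 'X_[m].
  rewrite mpolyXE_id; elim/big_ind: _ => //; exact: hM.
apply: mpolyind f => [|c m p _ _ ih]; first by have := hC 0; rewrite mpolyC0.
apply: hD => //; rewrite -mul_mpolyC; exact: (hM _ _ (hC c) (hm m)).
Qed.

Lemma sv_comp n k l (g : nat -> {mpoly Fld[k]}) (h : nat -> {mpoly Fld[l]})
    (f : {mpoly Fld[n]}) :
  sv h (sv g f) = sv (fun j => sv h (g j)) f.
Proof.
elim/mpoly_ind: f => [c|i|f f' e e'|f f' e e'].
- by rewrite !svC.
- by rewrite !sv_X.
- by rewrite !svD e e'.
- by rewrite !svM e e'.
Qed.

Lemma eq_sv n k (g g' : nat -> {mpoly Fld[k]}) (f : {mpoly Fld[n]}) :
  (forall j, (0 < j <= n)%N -> g j = g' j) -> sv g f = sv g' f.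
Proof.
move=> e; rewrite !svE; apply: (congr1 (fun l => comp_mpoly l f)); apply: eq_from_tnth => i.
by rewrite !tnth_mktuple e //= ltn_ord.
Qed.

Lemma sv_id n (f : {mpoly Fld[n]}) : sv (xv n) f = f.
Proof.
rewrite -[RHS]comp_mpoly_id !svE; apply: (congr1 (fun l => comp_mpoly l f)); apply: eq_from_tnth => i.
by rewrite !tnth_mktuple xv_ord.
Qed.

Lemma sv_comp_id n k (g : nat -> {mpoly Fld[k]}) (h : nat -> {mpoly Fld[n]}) f :
  (forall j, (0 < j <= n)%N -> sv h (g j) = xv n j) -> sv h (sv g f) = f.
Proof.
by move=> e; rewrite sv_comp -[RHS]sv_id; apply: eq_sv.
Qed.

Lemma xv_neq N i j : (0 < i <= N)%N -> i <> j -> xv N i != xv N j.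
Proof.
case: i => [|i] //= hi hij; have -> : i = Ordinal hi by []; rewrite xv_ord.
have [hj|hj] := boolP (0 < j <= N)%N; last first.
  rewrite (@xv0 N j); last by lia.
  by rewrite -msize_poly_eq0 msizeX.
case: j hij hj => [|j] //= hij hj; have -> : j = Ordinal hj by []; rewrite xv_ord.
have ne : (Ordinal hj == Ordinal hi) = false by apply/eqP => -[] h; apply: hij; rewrite h.
apply/eqP => /(congr1 (fun p : {mpoly Fld[N]} => p@_U_(Ordinal hi))) /eqP.
by rewrite !mcoeffXU eqxx ne oner_eq0.
Qed.

Lemma xv_neq0 N i : (0 < i <= N)%N -> xv N i != 0.
Proof. by move=> h; rewrite -(@xv0 N 0) //; apply: xv_neq => //; lia. Qed.

(** * Demazure-Lusztig operators *)

Definition linop n k (F : {mpoly Fld[n]} -> {mpoly Fld[k]}) :=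
  forall c f g, F (c *: f + g) = c *: F f + F g.

Section Linop.
Variables (n k : nat) (F : {mpoly Fld[n]} -> {mpoly Fld[k]}).
Hypothesis linF : linop F.

Lemma linopD f g : F (f + g) = F f + F g.
Proof. by have := linF 1 f g; rewrite !scale1r. Qed.
Lemma linop0 : F 0 = 0.
Proof. by apply: (@addIr _ (F 0)); rewrite -linopD !add0r. Qed.
Lemma linopZ c f : F (c *: f) = c *: F f.
Proof. by have := linF c f 0; rewrite linop0 !addr0. Qed.
Lemma linopN f : F (- f) = - F f.
Proof. by rewrite -scaleN1r linopZ scaleN1r. Qed.
Lemma linopB f g : F (f - g) = F f - F g.
Proof. by rewrite linopD linopN. Qed.
Lemma linop_sum (I : Type) (r : seq I) (P : pred I) (h : I -> {mpoly Fld[n]}) :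
  F (\sum_(i <- r | P i) h i) = \sum_(i <- r | P i) F (h i).
Proof. by apply: (big_morph F linopD linop0). Qed.
End Linop.

Lemma linop_sv n k (g : nat -> {mpoly Fld[k]}) : linop (sv g : {mpoly Fld[n]} -> _).
Proof. by move=> c f h; rewrite svD svZ. Qed.

Lemma linop_comp n k l (F : {mpoly Fld[k]} -> {mpoly Fld[l]})
    (G : {mpoly Fld[n]} -> {mpoly Fld[k]}) :
  linop F -> linop G -> linop (fun f => F (G f)).
Proof. by move=> hF hG c f g; rewrite hG hF. Qed.

Lemma linop_scale n k (F : {mpoly Fld[n]} -> {mpoly Fld[k]}) c :
  linop F -> linop (fun f => c *: F f).
Proof. by move=> hF d f g; rewrite hF scalerDr !scalerA mulrC. Qed.

Lemma linop_sub n k (F G : {mpoly Fld[n]} -> {mpoly Fld[k]}) :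
  linop F -> linop G -> linop (fun f => F f - G f).
Proof. by move=> hF hG d f g; rewrite hF hG scalerBr opprD addrACA. Qed.

Definition swapv N i j := if j == i then xv N i.+1 else if j == i.+1 then xv N i else xv N j.
Definition sw N i (f : {mpoly Fld[N]}) := sv (swapv N i) f.

Lemma siE N i (f : {mpoly Fld[N]}) : si i f = sw i f.
Proof. exact: substvE. Qed.

Lemma swK N i (f : {mpoly Fld[N]}) : (0 < i < N)%N -> sw i (sw i f) = f.
Proof.
move=> h; apply: sv_comp_id => j hj; rewrite {2}/swapv.
have [->|n1] := eqVneq j i.
  rewrite sv_xv /swapv ?eqxx; last by lia.
  by case: ifP => // ?; exfalso; lia.
have [->|n2] := eqVneq j i.+1; first by rewrite sv_xv /swapv ?eqxx //; lia.
by rewrite sv_xv // /swapv (negbTE n1) (negbTE n2).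
Qed.

Lemma sw_xv N i j : (0 < i < N)%N ->
  sw i (xv N j) = if j == i then xv N i.+1 else if j == i.+1 then xv N i else xv N j.
Proof.
move=> h; have [hj|hj] := boolP (0 < j <= N)%N; first by rewrite /sw sv_xv.
rewrite /sw (@xv0 N j) ?sv0; last by lia.
by case: eqP => [?|_]; [lia|]; case: eqP => [?|_]; [lia|].
Qed.

Section DL.
Variable N : nat.
Implicit Types f g p : {mpoly Fld[N]}.
Local Notation x := (xv N).

(** Divisibility is clear on constants and variables and passes to products by the twisted Leibniz
    rule ff' - s(ff') = (f - sf)f' + sf(f' - sf'). *)
Lemma ddiff_ex i f : (0 < i < N)%N -> exists g, g * (x i - x i.+1) = f - sw i f.
Proof.
move=> hi; elim/mpoly_ind: f => [c|j|f f' [g e] [g' e']|f f' [g e] [g' e']].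
- by exists 0; rewrite mul0r /sw svC subrr.
- rewrite -xv_ord sw_xv //; case: eqP => [->|_]; first by exists 1; rewrite mul1r.
  case: eqP => [->|_]; first by exists (-1); rewrite mulN1r opprB.
  by exists 0; rewrite mul0r subrr.
- by exists (g + g'); rewrite mulrDl e e' /sw svD opprD addrACA.
- exists (f' * g + sw i f * g').
  by rewrite mulrDl -!mulrA e e' /sw svM; ring.
Qed.

(** Opaque for the same reason as [sv]: from here on T_i is known only through [DL_char], [DL_uniq]
    and [DL_out]. *)
Fact DL_sig : {T : nat -> {mpoly Fld[N]} -> {mpoly Fld[N]} | T = @Top N}.
Proof. by exists (@Top N). Qed.
Definition DL : nat -> {mpoly Fld[N]} -> {mpoly Fld[N]} := sval DL_sig.

Lemma TopE i f : Top i f = DL i f.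
Proof. by rewrite /DL (svalP DL_sig). Qed.

Lemma DL_out i f : ~~ (0 < i < N)%N -> DL i f = f.
Proof. by move=> /negbTE h; rewrite -TopE /Top h. Qed.

Lemma xB_neq0 i : (0 < i < N)%N -> x i - x i.+1 != 0.
Proof. by move=> hi; rewrite subr_eq0; apply: xv_neq => //; lia. Qed.

Local Notation tM := ((tt_)%:MP : {mpoly Fld[N]}).

(** The division-free form of the definition. As x_i - x_(i+1) is not a zero divisor, it determines
    T_i f, and identities between the T_i become polynomial identities. *)
Lemma DL_char i f : (0 < i < N)%N ->
  (x i - x i.+1) * DL i f = (1 - tM) * x i * f + (tM * x i - x i.+1) * sw i f.
Proof.
move=> hi; have := ddiff_ex f hi; rewrite -siE => h.
have {}h := choose_spec 0 h; rewrite -/(ddiff i f) in h.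
have e : x i * ddiff i f * (x i - x i.+1) = x i * (f - si i f) by rewrite -mulrA h.
rewrite -TopE /Top hi -mul_mpolyC mpolyCB mpolyC1.
move: e; set d := ddiff i f; set s := si i f; move=> e.
have -> : (x i - x i.+1) * (s + (1 - tM) * (x i * d)) =
  (x i - x i.+1) * s + (1 - tM) * (x i * d * (x i - x i.+1)) by ring.
by rewrite e; ring.
Qed.

Lemma DL_uniq i f g : (0 < i < N)%N ->
  (x i - x i.+1) * g = (1 - tM) * x i * f + (tM * x i - x i.+1) * sw i f ->
  g = DL i f.
Proof. by move=> hi e; apply: (mulfI (xB_neq0 hi)); rewrite e DL_char. Qed.

Lemma linop_DL i : linop (DL i).
Proof.
move=> c f g; have [hi|hi] := boolP (0 < i < N)%N; last by rewrite !DL_out.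
apply/esym/DL_uniq => //; rewrite -!mul_mpolyC /sw svD svM svC.
transitivity (c%:MP * ((x i - x i.+1) * DL i f) + (x i - x i.+1) * DL i g); first by ring.
by rewrite !DL_char // /sw; ring.
Qed.

Lemma DL_mul i p f : sw i p = p -> DL i (p * f) = p * DL i f.
Proof.
move=> hp; have [hi|hi] := boolP (0 < i < N)%N; last by rewrite !DL_out.
apply/esym/DL_uniq => //; rewrite /sw svM -/(sw i p) hp.
by rewrite mulrCA DL_char // /sw; ring.
Qed.

Lemma DL_fixP i f : (0 < i < N)%N -> DL i f = f <-> sw i f = f.
Proof.
move=> hi; split => h; last first.
  by apply/esym/DL_uniq => //; rewrite h; ring.
have := DL_char f hi; rewrite h => e.
have nz : tM * x i - x i.+1 != 0.
  (* Setting x_i = 0 leaves -x_(i+1), which is not 0. *)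
  apply/eqP => /(congr1 (fun p => sv (fun j => if j == i then 0 else x j) p)).
  rewrite svB svM svC !sv_xv; [|lia|lia]; rewrite eqxx.
  have -> : (i.+1 == i) = false by lia.
  rewrite mulr0 sv0 sub0r => /eqP; rewrite oppr_eq0.
  by apply/negP/xv_neq0; lia.
apply/esym/(mulfI nz).
have -> : (tM * x i - x i.+1) * sw i f =
  (1 - tM) * x i * f + (tM * x i - x i.+1) * sw i f - (1 - tM) * x i * f by ring.
by rewrite -e; ring.
Qed.

End DL.

(** Stated for any equation of the shape of [DL_char]: the image has that shape again, so several
    reflections can be applied in succession. *)
Lemma sv_DL_eqn n k (v : nat -> {mpoly Fld[k]}) (x y g f1 f2 : {mpoly Fld[n]}) t :
  (x - y) * g = (1 - t%:MP) * x * f1 + (t%:MP * x - y) * f2 ->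
  (sv v x - sv v y) * sv v g = (1 - t%:MP) * sv v x * sv v f1 + (t%:MP * sv v x - sv v y) * sv v f2.
Proof.
move=> /(congr1 (sv v)); rewrite svM svB svD (svM v (_ * x)) (svM v _ x) (svM v _ f2).
by rewrite (svB v _ y) (svM v _ x) (svB v 1) sv1 svC.
Qed.

(** The Demazure-Lusztig formula is homogeneous of degree 0 in the pair (x_i, x_(i+1)), so a common
    factor [c] cancels. The factor is q when a pair of variables is carried through two rotations,
    and 1 in the other uses. *)
Lemma sv_DL n k (g : nat -> {mpoly Fld[k]}) i j c (f : {mpoly Fld[n]}) :
  (0 < i < n)%N -> (0 < j < k)%N -> c != 0 ->
  g i = c *: xv k j -> g i.+1 = c *: xv k j.+1 ->
  (forall l, (0 < l <= n)%N -> l <> i -> l <> i.+1 -> sw j (g l) = g l) ->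
  sv g (DL i f) = DL j (sv g f).
Proof.
move=> hi hj c0 gi gi1 gl; apply: DL_uniq => //.
have esw : sv g (sw i f) = sw j (sv g f).
  rewrite /sw !sv_comp; apply: eq_sv => l hl; rewrite /swapv.
  case: eqP => [->|ni]; first by rewrite sv_xv ?gi1 ?gi; [rewrite svZ -/(sw j _) sw_xv // eqxx|lia].
  case: eqP => [->|ni1].
    rewrite sv_xv; last by lia.
    by rewrite gi gi1 svZ -/(sw j _) sw_xv // eqxx; case: eqP => //; lia.
  by rewrite sv_xv // -[LHS]gl.
have ei : sv g (xv n i) = c *: xv k j by rewrite sv_xv ?gi //; lia.
have ei1 : sv g (xv n i.+1) = c *: xv k j.+1 by rewrite sv_xv ?gi1 //; lia.
have := sv_DL_eqn g (DL_char f hi); rewrite ei ei1.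
rewrite esw -!mul_mpolyC => e.
have cn : (c%:MP : {mpoly Fld[k]}) != 0 by rewrite mpolyC_eq0.
apply: (mulfI cn); move: e; set a := sv g _; set b := sv g f; set d := sw j b => e.
transitivity ((c%:MP * xv k j - c%:MP * xv k j.+1) * a); first by ring.
by rewrite e; ring.
Qed.

Lemma sw_l N i : (0 < i < N)%N -> sw i (xv N i) = xv N i.+1.
Proof. by move=> hi; rewrite sw_xv // eqxx. Qed.

Lemma sw_r N i : (0 < i < N)%N -> sw i (xv N i.+1) = xv N i.
Proof. by move=> hi; rewrite sw_xv // eqxx; case: eqP => // ?; lia. Qed.

Lemma sw_o N i j : (0 < i < N)%N -> j <> i -> j <> i.+1 -> sw i (xv N j) = xv N j.
Proof. by move=> hi ? ?; rewrite sw_xv //; do 2 (case: eqP => // _). Qed.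

(** The Hecke relation (T_i - 1)(T_i + t) = 0, from which the inverse [DLi] is read off. *)
Lemma DL_quad N i (f : {mpoly Fld[N]}) : (0 < i < N)%N ->
  DL i (DL i f) = (1 - tt_) *: DL i f + tt_ *: f.
Proof.
move=> hi; apply/esym/DL_uniq => //.
have e1 := DL_char f hi.
have := sv_DL_eqn (swapv N i) e1; rewrite -!/(sw i _).
rewrite (sw_l hi) (sw_r hi) (swK f hi).
rewrite -!mul_mpolyC mpolyCB mpolyC1.
have := xB_neq0 hi; move: e1.
set x := xv N i; set y := xv N i.+1; set g := DL i f; set h := sw i g; set s := sw i f.
set t := (_)%:MP => e1 nz e2.
apply: (mulfI nz).
transitivity ((1 - t) * (x - y) * ((x - y) * g) + t * (x - y) * (x - y) * f); first by ring.
have -> : (x - y) * ((1 - t) * x * g + (t * x - y) * h) =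
 (1 - t) * x * ((x - y) * g) - (t * x - y) * ((y - x) * h) by ring.
by rewrite e1 e2; ring.
Qed.

Definition DLi N i (f : {mpoly Fld[N]}) :=
  if (0 < i < N)%N then tt_^-1 *: (DL i f - (1 - tt_) *: f) else f.

Lemma DLK N i (f : {mpoly Fld[N]}) : DLi i (DL i f) = f.
Proof.
rewrite /DLi; case: ifP => hi; last by rewrite DL_out ?hi.
by rewrite DL_quad // addrAC subrr add0r scalerA mulVf ?scale1r ?tt_neq0.
Qed.

Lemma DLiK N i (f : {mpoly Fld[N]}) : DL i (DLi i f) = f.
Proof.
rewrite /DLi; case: ifP => hi; last by rewrite DL_out ?hi.
rewrite (linopZ (@linop_DL _ i)) (linopB (@linop_DL _ i)) (linopZ (@linop_DL _ i)) DL_quad //.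
by rewrite addrAC subrr add0r scalerA mulVf ?scale1r ?tt_neq0.
Qed.

Lemma linop_DLi N i : linop (@DLi N i).
Proof.
move=> c f g; rewrite /DLi; case: ifP => // _.
have h : linop (fun f : {mpoly Fld[N]} => DL i f - (1 - tt_) *: f).
  by apply: linop_sub; [exact: linop_DL | apply: linop_scale].
exact: (linop_scale _ h).
Qed.

Lemma DL_inj N i : injective (@DL N i).
Proof. exact: can_inj (@DLK N i). Qed.

Lemma TinvE N i (f : {mpoly Fld[N]}) : Tinv i f = DLi i f.
Proof.
apply: (@DL_inj _ i); rewrite DLiK -TopE.
have h : exists g, Top i g = f by exists (DLi i f); rewrite TopE DLiK.
exact: (choose_spec 0 h).
Qed.

Lemma DLi_fix N i (f : {mpoly Fld[N]}) : DL i f = f -> DLi i f = f.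
Proof. by move=> h; apply: (@DL_inj _ i); rewrite DLiK h. Qed.

Lemma DLi_comm N k i j (F : {mpoly Fld[N]} -> {mpoly Fld[k]}) :
  (forall f, F (DL i f) = DL j (F f)) -> forall f, F (DLi i f) = DLi j (F f).
Proof. by move=> h f; apply: (@DL_inj _ j); rewrite -h !DLiK. Qed.

(** * Distant commutation and the braid relation *)

Lemma sv_1B n k (v : nat -> {mpoly Fld[k]}) t :
  sv v (1 - t%:MP : {mpoly Fld[n]}) = 1 - t%:MP.
Proof. by rewrite svB sv1 svC. Qed.

Lemma DL_far N i j (f : {mpoly Fld[N]}) : (i.+1 < j)%N || (j.+1 < i)%N ->
  DL i (DL j f) = DL j (DL i f).
Proof.
move=> hij; have [hi|hi] := boolP (0 < i < N)%N; last by rewrite !(DL_out _ hi).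
have [hj|hj] := boolP (0 < j < N)%N; last by rewrite !(DL_out _ hj).
apply/esym/DL_uniq => //.
have e1 : sw j (xv N i) = xv N i by rewrite sw_o //; lia.
have e2 : sw j (xv N i.+1) = xv N i.+1 by rewrite sw_o //; lia.
have R : forall p h, sw j p = p -> DL j (p * h) = p * DL j h by move=> *; apply: DL_mul.
(* The factor x_i - x_(i+1) is invariant under s_j, so it can be moved inside T_j and [DL_char]
   applied there. *)
rewrite -R; last by rewrite /sw svB -!/(sw j _) e1 e2.
rewrite DL_char // (linopD (@linop_DL _ j)) !R.
- congr (_ + _ * _); apply/esym; rewrite /sw; apply: (@sv_DL _ _ _ j j 1) => //; first exact: oner_neq0.
  + by rewrite scale1r /swapv; do 2 (case: eqP => [?|_]; first lia).
  + by rewrite scale1r /swapv; do 2 (case: eqP => [?|_]; first lia).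
  + by move=> l hl n1 n2; rewrite /swapv; do 2?[case: eqP => ?]; rewrite sw_xv //; do ?[case: eqP => ?] => //; lia.
- by rewrite /sw (svM _ _ (xv N i)) sv_1B -!/(sw j _) e1.
- rewrite /sw (svB _ _ (xv N i.+1)) (svM _ _ (xv N i)) svC -!/(sw j _).
  by rewrite e1 e2.
Qed.

(** The braid relation as an identity of rational functions: [fa], [fb], [fab], [fba], [fw] stand
    for the images of [f] under the other elements of S_3. Each remaining unknown is the left side
    of a [DL_char] equation, possibly reflected, and can be solved for in turn. *)
Lemma braid_field (K : fieldType) (t x y z f fa fb fab fba fw g g1 g2 g12 h h1 k
    g' g1' g2' g21' h' h2' k' : K) :
  x - y != 0 -> y - z != 0 -> x - z != 0 ->
  (x - y) * g = (1 - t) * x * f + (t * x - y) * fa ->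
  (x - z) * g2 = (1 - t) * x * fb + (t * x - z) * fba ->
  (y - z) * h = (1 - t) * y * g + (t * y - z) * g2 ->
  (y - x) * g1 = (1 - t) * y * fa + (t * y - x) * f ->
  (y - z) * g12 = (1 - t) * y * fab + (t * y - z) * fw ->
  (x - z) * h1 = (1 - t) * x * g1 + (t * x - z) * g12 ->
  (x - y) * k = (1 - t) * x * h + (t * x - y) * h1 ->
  (y - z) * g' = (1 - t) * y * f + (t * y - z) * fb ->
  (x - z) * g1' = (1 - t) * x * fa + (t * x - z) * fab ->
  (x - y) * h' = (1 - t) * x * g' + (t * x - y) * g1' ->
  (z - y) * g2' = (1 - t) * z * fb + (t * z - y) * f ->
  (x - y) * g21' = (1 - t) * x * fba + (t * x - y) * fw ->
  (x - z) * h2' = (1 - t) * x * g2' + (t * x - z) * g21' ->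
  (y - z) * k' = (1 - t) * y * h' + (t * y - z) * h2' ->
  k = k'.
Proof.
move=> n1 n2 n3.
have n1' : y - x != 0 by rewrite -opprB oppr_eq0.
have n2' : z - y != 0 by rewrite -opprB oppr_eq0.
have S (d a b : K) : d != 0 -> d * a = b -> a = b / d.
  by move=> nd <-; rewrite mulrC mulKf.
move=> /(S _ _ _ n1) -> /(S _ _ _ n3) -> /(S _ _ _ n2) -> /(S _ _ _ n1') -> /(S _ _ _ n2) ->.
move=> /(S _ _ _ n3) -> /(S _ _ _ n1) -> /(S _ _ _ n2) -> /(S _ _ _ n3) -> /(S _ _ _ n1) ->.
move=> /(S _ _ _ n2') -> /(S _ _ _ n1) -> /(S _ _ _ n3) -> /(S _ _ _ n2) ->.
by field; rewrite n1 n2 n3 n1' n2'.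
Qed.

Lemma braid_idom (R : idomainType) (t x y z f fa fb fab fba fw g g1 g2 g12 h h1 k
    g' g1' g2' g21' h' h2' k' : R) :
  x - y != 0 -> y - z != 0 -> x - z != 0 ->
  (x - y) * g = (1 - t) * x * f + (t * x - y) * fa ->
  (x - z) * g2 = (1 - t) * x * fb + (t * x - z) * fba ->
  (y - z) * h = (1 - t) * y * g + (t * y - z) * g2 ->
  (y - x) * g1 = (1 - t) * y * fa + (t * y - x) * f ->
  (y - z) * g12 = (1 - t) * y * fab + (t * y - z) * fw ->
  (x - z) * h1 = (1 - t) * x * g1 + (t * x - z) * g12 ->
  (x - y) * k = (1 - t) * x * h + (t * x - y) * h1 ->
  (y - z) * g' = (1 - t) * y * f + (t * y - z) * fb ->
  (x - z) * g1' = (1 - t) * x * fa + (t * x - z) * fab ->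
  (x - y) * h' = (1 - t) * x * g' + (t * x - y) * g1' ->
  (z - y) * g2' = (1 - t) * z * fb + (t * z - y) * f ->
  (x - y) * g21' = (1 - t) * x * fba + (t * x - y) * fw ->
  (x - z) * h2' = (1 - t) * x * g2' + (t * x - z) * g21' ->
  (y - z) * k' = (1 - t) * y * h' + (t * y - z) * h2' ->
  k = k'.
Proof.
move=> n1 n2 n3 e1 e2 e3 e4 e5 e6 e7 e8 e9 e10 e11 e12 e13 e14.
pose F := @FracField.tofrac R.
have inj : injective F by move=> a b /eqP; rewrite tofrac_eq => /eqP.
have F1 : F 1 = 1 by exact: rmorph1.
have FM a b : F (a * b) = F a * F b by exact: rmorphM.
have FB a b : F (a - b) = F a - F b by exact: rmorphB.
have FD a b : F (a + b) = F a + F b by exact: rmorphD.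
have nz a b : a - b != 0 -> F a - F b != 0 by rewrite -FB tofrac_eq0.
have E a b c t' a' c' d' : (a - b) * c = (1 - t') * a' * c' + (t' * a' - b) * d' ->
   (F a - F b) * F c = (1 - F t') * F a' * F c' + (F t' * F a' - F b) * F d'.
  by move=> /(congr1 F); rewrite FD !FM !FB !FM F1.
apply: inj.
apply: (@braid_field _ (F t) (F x) (F y) (F z) (F f) (F fa) (F fb) (F fab) (F fba) (F fw)
  (F g) (F g1) (F g2) (F g12) (F h) (F h1) (F k) (F g') (F g1') (F g2') (F g21') (F h') (F h2'));
  by [exact: nz | exact: E].
Qed.

Lemma sw_braid N i (f : {mpoly Fld[N]}) : (0 < i)%N -> (i.+1 < N)%N ->
  sw i (sw i.+1 (sw i f)) = sw i.+1 (sw i (sw i.+1 f)).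
Proof.
move=> i0 iN; have hi : (0 < i < N)%N by lia.
have hi1 : (0 < i.+1 < N)%N by lia.
elim/mpoly_ind: f => [c|j|f f' e e'|f f' e e'].
- by rewrite /sw !svC.
- rewrite -xv_ord; move: (nat_of_ord j).+1 => {}j.
  have [->|n0] := eqVneq j i.
    rewrite sw_l // sw_l // (@sw_o _ i i.+2) //; try lia.
    by rewrite (@sw_o _ i.+1 i) //; [rewrite sw_l // sw_l | lia..].
  have [->|n1] := eqVneq j i.+1.
    rewrite sw_r // sw_l // (@sw_o _ i i.+2) //; try lia.
    by rewrite (@sw_o _ i.+1 i) //; [rewrite sw_l // sw_r | lia..].
  have [->|n2] := eqVneq j i.+2.
    by rewrite (@sw_o _ i i.+2) // ?(@sw_r _ i.+1) // ?sw_r // ?(@sw_o _ i.+1 i) //; lia.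
  by rewrite !sw_o //; apply/eqP.
- by rewrite /sw !svD -!/(sw _ _) e e'.
- by rewrite /sw !svM -!/(sw _ _) e e'.
Qed.

Lemma DL_braid N i (f : {mpoly Fld[N]}) : (0 < i)%N -> (i.+1 < N)%N ->
  DL i (DL i.+1 (DL i f)) = DL i.+1 (DL i (DL i.+1 f)).
Proof.
move=> i0 iN; have hi : (0 < i < N)%N by lia.
have hi1 : (0 < i.+1 < N)%N by lia.
pose a := @sw N i; pose b := @sw N i.+1.
have sb p : a (b (a p)) = b (a (b p)) by exact: sw_braid.
have aK p : a (a p) = p by apply: swK.
have bK p : b (b p) = p by apply: swK.
set x := xv N i; set y := xv N i.+1; set z := xv N i.+2.
have ax : a x = y by apply: sw_l.
have ay : a y = x by apply: sw_r.
have az : a z = z by apply: sw_o => //; lia.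
have bx : b x = x by apply: sw_o => //; lia.
have by_ : b y = z by apply: sw_l.
have bz : b z = y by apply: sw_r.
have E1 p := DL_char p hi; have E2 p := DL_char p hi1.
rewrite -/x -/y -/a in E1; rewrite -/y -/z -/b in E2.
apply: (@braid_idom _ (tt_)%:MP x y z f (a f) (b f) (a (b f)) (b (a f)) (a (b (a f)))
  (DL i f) (a (DL i f)) (b (DL i f)) (a (b (DL i f))) (DL i.+1 (DL i f)) (a (DL i.+1 (DL i f))) _
  (DL i.+1 f) (a (DL i.+1 f)) (b (DL i.+1 f)) (b (a (DL i.+1 f))) (DL i (DL i.+1 f)) (b (DL i (DL i.+1 f))) _);
  try exact: E1; try exact: E2.
- exact: xB_neq0.
- exact: xB_neq0.
- by rewrite subr_eq0; apply: xv_neq; lia.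
- by have := sv_DL_eqn (swapv N i.+1) (E1 f); rewrite -!/(sw _ _) -/b bx by_.
- by have := sv_DL_eqn (swapv N i) (E1 f); rewrite -!/(sw _ _) -/a ax ay aK.
- have := sv_DL_eqn (swapv N i.+1) (E1 f); rewrite -!/(sw _ _) -/b bx by_ => h.
  by have := sv_DL_eqn (swapv N i) h; rewrite -!/(sw _ _) -/a ax az.
- by have := sv_DL_eqn (swapv N i) (E2 (DL i f)); rewrite -!/(sw _ _) -/a ay az.
- by have := sv_DL_eqn (swapv N i) (E2 f); rewrite -!/(sw _ _) -/a ay az.
- by have := sv_DL_eqn (swapv N i.+1) (E2 f); rewrite -!/(sw _ _) -/b by_ bz bK.
- have := sv_DL_eqn (swapv N i) (E2 f); rewrite -!/(sw _ _) -/a ay az => h.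
  by have := sv_DL_eqn (swapv N i.+1) h; rewrite -!/(sw _ _) -/b bx bz -sb.
- by have := sv_DL_eqn (swapv N i.+1) (E1 (DL i.+1 f)); rewrite -!/(sw _ _) -/b bx by_.
Qed.

(** * Cherednik operators *)

Definition omv N (f : {mpoly Fld[N]}) :=
  sv (fun j => if j == N then qq_ *: xv N 1 else xv N j.+1) f.

Lemma linop_omv N : linop (@omv N).
Proof. exact: linop_sv. Qed.

Lemma omegainvE N (f : {mpoly Fld[N]}) : omegainv f = omv f.
Proof.
have K1 g : omega (omv g) = g.
  rewrite /omega substvE; apply: sv_comp_id => j hj; case: eqP => [->|nj].
    by rewrite svZ sv_xv /=; [rewrite scalerA mulfV ?scale1r ?qq_neq0|lia].
  rewrite sv_xv; last by lia.
  by case: eqP => // ?; lia.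
have K2 g : omv (omega g) = g.
  rewrite /omega substvE; apply: sv_comp_id => j hj; case: eqP => [->|nj].
    by rewrite svZ sv_xv ?eqxx; [rewrite scalerA mulVf ?scale1r ?qq_neq0|lia].
  rewrite sv_xv; last by lia.
  by case: eqP => [?|_]; [lia|rewrite prednK //; lia].
have h : exists g, omega g = f by exists (omv f).
by rewrite -{2}(choose_spec 0 h) K2.
Qed.

Lemma omv_DL N i (f : {mpoly Fld[N]}) : (0 < i)%N -> (i.+1 < N)%N ->
  omv (DL i f) = DL i.+1 (omv f).
Proof.
move=> i0 iN; apply: (@sv_DL _ _ _ _ _ 1); rewrite ?oner_neq0 ?scale1r //; try lia.
- by case: eqP => // ?; lia.
- by case: eqP => // ?; lia.
- move=> l hl n1 n2; case: eqP => _; rewrite /sw ?svZ -/(sw _ _) sw_o //; lia.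
Qed.

(** A single rotation sends (x_(N-1), x_N) to (x_N, q x_1), which is not a multiple of a consecutive
    pair; the second one gives (q x_1, q x_2). *)
Lemma omv2_DL N (f : {mpoly Fld[N]}) : (1 < N)%N ->
  omv (omv (DL N.-1 f)) = DL 1 (omv (omv f)).
Proof.
move=> hN; rewrite /omv !sv_comp.
have e (g : nat -> {mpoly Fld[N]}) j b (c d : {mpoly Fld[N]}) :
  sv g (if j == b then c else d) = if j == b then sv g c else sv g d by case: eqP.
apply: (@sv_DL _ _ _ _ _ qq_); rewrite ?qq_neq0 //; try lia.
- rewrite (_ : (N.-1 == N) = false); last by lia.
  by rewrite prednK ?sv_xv ?eqxx //; lia.
- rewrite prednK ?eqxx; last by lia.
  rewrite svZ sv_xv; last by lia.
  by rewrite (_ : (1%N == N) = false) //; lia.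
- move=> l hl n1 n2; rewrite (_ : (l == N) = false); last by lia.
  rewrite sv_xv; last by lia.
  by rewrite (_ : (l.+1 == N) = false) ?sw_o //; lia.
Qed.

Definition Tinv_chain N (l : seq nat) (f : {mpoly Fld[N]}) := foldl (fun g i => DLi i g) f l.

Lemma Tinv_chain_cat N l l' (f : {mpoly Fld[N]}) : Tinv_chain (l ++ l') f = Tinv_chain l' (Tinv_chain l f).
Proof. exact: foldl_cat. Qed.

Lemma linop_dch N l : linop (@Tinv_chain N l).
Proof. by elim: l => //= i l ih c f g; rewrite /Tinv_chain /= linop_DLi; apply: ih. Qed.

Lemma Tinv_chain_map N k l s (F : {mpoly Fld[N]} -> {mpoly Fld[k]}) f :
  (forall i, i \in l -> forall g, F (DLi i g) = DLi (s i) (F g)) ->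
  F (Tinv_chain l f) = Tinv_chain [seq s i | i <- l] (F f).
Proof.
elim: l f => //= i l ih f h; rewrite /Tinv_chain /= -h ?mem_head // -/(Tinv_chain _ _) -/(Tinv_chain l _) ih //.
by move=> j hj g; apply: h; rewrite in_cons hj orbT.
Qed.

Lemma Tinv_chain_comm N k l (F : {mpoly Fld[N]} -> {mpoly Fld[k]}) f :
  (forall i, i \in l -> forall g, F (DLi i g) = DLi i (F g)) -> F (Tinv_chain l f) = Tinv_chain l (F f).
Proof. by move=> h; rewrite (@Tinv_chain_map _ _ _ id) // map_id. Qed.

(** * Commutativity of the Cherednik operators *)

Lemma DLi_far N i j (f : {mpoly Fld[N]}) : (i.+1 < j)%N || (j.+1 < i)%N ->
  DL i (DLi j f) = DLi j (DL i f).
Proof. by move=> h; apply: DLi_comm => g; apply: DL_far. Qed.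

Lemma DLi_far2 N i j (f : {mpoly Fld[N]}) : (i.+1 < j)%N || (j.+1 < i)%N ->
  DLi i (DLi j f) = DLi j (DLi i f).
Proof. by move=> h; apply: DLi_comm => g; rewrite DLi_far // orbC. Qed.

Lemma DLi_braid N i (f : {mpoly Fld[N]}) : (0 < i)%N -> (i.+1 < N)%N ->
  DLi i.+1 (DLi i (DL i.+1 f)) = DL i (DLi i.+1 (DLi i f)).
Proof.
move=> i0 iN; apply: (@DL_inj _ i.+1); apply: (@DL_inj _ i).
by rewrite !DLiK DL_braid // !DLiK.
Qed.

Lemma DLi_braid' N i (f : {mpoly Fld[N]}) : (0 < i)%N -> (i.+1 < N)%N ->
  DLi i (DLi i.+1 (DL i f)) = DL i.+1 (DLi i (DLi i.+1 f)).
Proof.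
move=> i0 iN; apply: (@DL_inj _ i); apply: (@DL_inj _ i.+1).
by rewrite !DLiK -DL_braid // !DLiK.
Qed.

Fixpoint YL N (i : nat) (f : {mpoly Fld[N]}) {struct i} : {mpoly Fld[N]} :=
  match i with
  | 0 => f
  | j.+1 => match j with
            | 0 => omv (Tinv_chain (iota 1 N.-1) f)
            | _ => tt_^-1 *: DL j (YL j (DL j f))
            end
  end.

Lemma YopE N i (f : {mpoly Fld[N]}) : Yop i f = YL i f.
Proof.
elim: i f => // -[|i] ih f.
  rewrite /= /Y1 omegainvE /Tinv_chain; congr omv.
  by elim: (iota _ _) f => //= j l ih' f; rewrite TinvE ih'.
by rewrite -[LHS]/(tt_^-1 *: Top i.+1 (Yop i.+1 (Top i.+1 f))) !TopE ih.
Qed.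

Lemma YL1 N (f : {mpoly Fld[N]}) : YL 1 f = omv (Tinv_chain (iota 1 N.-1) f).
Proof. by []. Qed.

Lemma YLS N i (f : {mpoly Fld[N]}) : (0 < i)%N -> YL i.+1 f = tt_^-1 *: DL i (YL i (DL i f)).
Proof. by case: i. Qed.

Lemma linop_YL N i : linop (@YL N i).
Proof.
elim: i => // -[|i] ih c f g.
  by rewrite !YL1 linop_dch linop_omv.
by rewrite !(@YLS _ i.+1) // linop_DL ih linop_DL scalerDr !scalerA mulrC.
Qed.

(** Passing T_j through T_j^-1 T_(j-1)^-1 turns it into T_(j-1) by the braid relation, and the
    rotation turns that back into T_j. *)
Lemma DL_YL1 N j (f : {mpoly Fld[N]}) : (1 < j)%N -> DL j (YL 1 f) = YL 1 (DL j f).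
Proof.
move=> hj; have [jN|jN] := boolP (j < N)%N; last by rewrite !DL_out //; lia.
case: j hj jN => [|[|j]] // _ jN.
rewrite !YL1 -omv_DL //; congr omv.
have -> : iota 1 N.-1 = iota 1 j ++ [:: j.+1; j.+2] ++ iota j.+3 (N.-1 - j.+2).
  have eN : N.-1 = (j + (2 + (N.-1 - j.+2)))%N by lia.
  by rewrite [in LHS]eN iotaD (iotaD _ 2) add1n addn2.
rewrite !Tinv_chain_cat -[in RHS](@Tinv_chain_comm _ _ _ (DL j.+2)); last first.
  by move=> i; rewrite mem_iota => hi g; rewrite DLi_far //; lia.
rewrite (@Tinv_chain_comm _ _ (iota j.+3 _)); last first.
  by move=> i; rewrite mem_iota => hi g; rewrite DLi_far //; lia.
by rewrite [in LHS]/Tinv_chain /= -/(Tinv_chain _ _) [in RHS]/Tinv_chain /= -!/(Tinv_chain _ _) DLi_braid.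
Qed.

(** Two consecutive chains carry T_1 to the far end; with m = N - 2 it arrives as T_(N-1), ready for
    [omv2_DL]. *)
Lemma dch2_DL1 N m (f : {mpoly Fld[N]}) : (m.+1 < N)%N ->
  Tinv_chain (iota 1 m) (Tinv_chain (iota 2 m) (DL 1 f)) = DL m.+1 (Tinv_chain (iota 1 m) (Tinv_chain (iota 2 m) f)).
Proof.
elim: m => // m ih hm.
have E g : Tinv_chain (iota 1 m.+1) (Tinv_chain (iota 2 m.+1) g) =
   DLi m.+1 (DLi m.+2 (Tinv_chain (iota 1 m) (Tinv_chain (iota 2 m) g))).
  have i1 : iota 1 m.+1 = iota 1 m ++ [:: m.+1] by rewrite -[in LHS](addn1 m) iotaD add1n.
  have i2 : iota 2 m.+1 = iota 2 m ++ [:: m.+2] by rewrite -[in LHS](addn1 m) iotaD add2n.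
  rewrite i1 i2 !Tinv_chain_cat -[Tinv_chain [:: m.+2] _]/(DLi m.+2 _) -[Tinv_chain [:: m.+1] _]/(DLi m.+1 _).
  rewrite (@Tinv_chain_comm _ _ (iota 1 m) (DLi m.+2)) // => i; rewrite mem_iota => hi h.
  by rewrite DLi_far2 //; lia.
rewrite !E ih; last by lia.
by rewrite DLi_braid'.
Qed.

(** Write Y_1 = V T_1^-1, so that Y_2 = t^-1 T_1 V. Then Y_1 Y_2 = t^-1 V^2 and Y_2 Y_1 = t^-1 T_1
    V^2 T_1^-1, and the claim reduces to T_1 commuting with V^2. *)
Lemma YL12_comm N (f : {mpoly Fld[N]}) : (1 < N)%N -> YL 1 (YL 2 f) = YL 2 (YL 1 f).
Proof.
move=> hN; pose V (g : {mpoly Fld[N]}) := omv (Tinv_chain (iota 2 (N - 2)) g).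
have V1 g : YL 1 g = V (DLi 1 g).
  by rewrite YL1 (_ : iota 1 N.-1 = 1%N :: iota 2 (N - 2)) //; case: (N) hN => [|[|n]] //=; rewrite subSS subSS subn0.
have VV g : V (V g) = omv (omv (Tinv_chain (iota 1 (N - 2)) (Tinv_chain (iota 2 (N - 2)) g))).
  rewrite /V; congr omv; rewrite (@Tinv_chain_map _ _ (iota 1 (N - 2)) succn) -?(iotaDl 1) //.
  move=> i; rewrite mem_iota => hi h; apply: DLi_comm => h'; apply: omv_DL; lia.
have VVD g : V (V (DL 1 g)) = DL 1 (V (V g)).
  rewrite !VV dch2_DL1; last by lia.
  by rewrite (_ : (N - 2).+1 = N.-1) ?omv2_DL //; lia.
rewrite !(@YLS _ 1) // (linopZ (@linop_YL _ 1)) !V1 !DLK; congr (_ *: _).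
by rewrite -VVD DLiK.
Qed.

Lemma DL_YL_gt N i j (f : {mpoly Fld[N]}) : (0 < i)%N -> (i < j)%N ->
  DL j (YL i f) = YL i (DL j f).
Proof.
elim: i f => // -[|i] ih f _ hij; first exact: DL_YL1.
have hj : (j.+1 < i.+1)%N || (i.+2 < j)%N by rewrite hij orbT.
rewrite !(@YLS _ i.+1 _ isT) (linopZ (@linop_DL _ _)) (DL_far _ hj).
by rewrite (ih (DL i.+1 f) isT (ltnW hij)) (DL_far f hj).
Qed.

Lemma DL_YL_lt N i j (f : {mpoly Fld[N]}) : (0 < i)%N -> (i.+1 < j)%N -> (j <= N)%N ->
  DL i (YL j f) = YL j (DL i f).
Proof.
move=> i0; elim: j f => // j ih f hij hj; rewrite !(@YLS _ j); [|lia|lia].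
rewrite (linopZ (@linop_DL _ _)); congr (_ *: _).
have [e|ne] := eqVneq j i.+1; last first.
  by rewrite DL_far ?ih ?(@DL_far _ i) //; lia.
(* Here Y_(i+2) = t^-2 T_(i+1) T_i Y_i T_i T_(i+1). The braid relation turns T_i into T_(i+1), which
   commutes with Y_i, and then back into T_i. *)
rewrite e !(@YLS _ i) // !(linopZ (@linop_DL _ _)); congr (_ *: _).
have iN : (i.+1 < N)%N by lia.
by rewrite (@DL_braid _ i (YL _ _)) // DL_YL_gt // (@DL_braid _ i f).
Qed.

Lemma YL_comm_lt N i j (f : {mpoly Fld[N]}) : (0 < i)%N -> (i < j)%N -> (j <= N)%N ->
  YL i (YL j f) = YL j (YL i f).
Proof.
elim: i f => // -[|i] ih f _.
  elim: j {ih} f => // -[|[|j]] // ih f _ jN; first by apply: YL12_comm.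
  by rewrite !(@YLS _ j.+2) // (linopZ (@linop_YL _ _)) -DL_YL1 // ih ?DL_YL1 //; lia.
move=> hij jN; rewrite !(@YLS _ i.+1) // (linopZ (@linop_YL _ _)) -(@DL_YL_lt _ i.+1 j) //.
rewrite -(ih (DL i.+1 f)); [|by [] |by lia|by []].
by rewrite (@DL_YL_lt _ i.+1 j).
Qed.

Lemma YL_comm N i j (f : {mpoly Fld[N]}) : (0 < i <= N)%N -> (0 < j <= N)%N ->
  YL i (YL j f) = YL j (YL i f).
Proof.
move=> hi hj; have [h|h|->] // := ltngtP i j; first by apply: YL_comm_lt; lia.
by apply/esym/YL_comm_lt; lia.
Qed.

(** * Dominance and Bruhat orders *)

Lemma rev_leq_total : ssrbool.total (T := nat) geq.
Proof. by move=> x y; exact: leq_total. Qed.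

Lemma rev_leq_trans : ssrbool.transitive (T := nat) geq.
Proof. exact: rev_trans leq_trans. Qed.

Lemma rev_leq_anti : ssrbool.antisymmetric (T := nat) geq.
Proof. by move=> x y; rewrite andbC; exact: anti_leq. Qed.

Section Order.
Variable N : nat.
Implicit Types l m k nu : 'X_{1..N}.

Lemma mseq_sum (F : nat -> nat) l : (\sum_(x <- mseq l) F x = \sum_i F (l i))%N.
Proof. by rewrite /mseq big_map big_enum. Qed.

Lemma perm_dominant l : perm_eq (dominant l) (mseq l).
Proof. by rewrite /dominant perm_sort. Qed.

Lemma dominant_sum (F : nat -> nat) l : (\sum_(x <- dominant l) F x = \sum_i F (l i))%N.
Proof. by rewrite (perm_big _ (perm_dominant l)) mseq_sum. Qed.

Lemma sumn_dominant l : sumn (dominant l) = mdeg l.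
Proof. by rewrite sumnE dominant_sum mdegE. Qed.

Lemma size_dominant l : size (dominant l) = N.
Proof. by rewrite size_sort size_map size_enum_ord. Qed.

(* The sum of the [n] largest entries is the minimum over [c] of
   [n * c + \sum (x - c)], with truncated subtraction; spreading two entries apart
   increases every such expression by convexity. *)
Lemma sumn_take_le (s : seq nat) c n :
  (sumn (take n s) <= n * c + \sum_(x <- s) (x - c))%N.
Proof.
elim: n s => [|n ih] [|x s] //=; rewrite big_cons.
by have := ih s; rewrite mulSn; lia.
Qed.

Lemma sumn_take_eq (s : seq nat) n : sorted geq s -> (0 < n)%N ->
  let c := nth 0%N s n.-1 in
  (sumn (take n s) = n * c + \sum_(x <- s) (x - c))%N.
Proof.
case: n => // n + _ /=; elim: n s => [|n ih] [|x s] // hs /=; rewrite ?big_nil ?muln0 //.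
- rewrite take0 big_cons /= big_seq big1 ?mul1n; first by lia.
  move=> y ys; have := order_path_min _ hs => /(_ (rev_trans leq_trans)) /allP /(_ y ys) /=; lia.
- rewrite big_cons.
  have := ih s (path_sorted hs); rewrite /= => ->.
  have : (nth 0%N s n <= x)%N.
    have [sn|sn] := leqP (size s) n; first by rewrite nth_default.
    have := order_path_min _ hs => /(_ (rev_trans leq_trans)) /allP; apply; exact: mem_nth.
  by rewrite (mulSn n.+1); lia.
Qed.

Lemma dominant_sorted l : sorted geq (dominant l).
Proof. by apply: sort_sorted => x y; exact: leq_total. Qed.

Lemma dom_lt_spread l m (p q : 'I_N) : p != q ->
  (forall i, i != p -> i != q -> m i = l i) -> (m p + m q = l p + l q)%N ->
  (minn (l p) (l q) < m p < maxn (l p) (l q))%N ->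
  dom_lt (dominant m) (dominant l).
Proof.
move=> npq eo es hm.
have D (F : nat -> nat) k : (\sum_i F (k i) = F (k p) + (F (k q) + \sum_(i | (i != p) && (i != q)) F (k i)))%N.
  by rewrite (bigD1 p) //= (bigD1 q) //= eq_sym.
have eO (F : nat -> nat) :
    (\sum_(i | (i != p) && (i != q)) F (m i) = \sum_(i | (i != p) && (i != q)) F (l i))%N.
  by apply: eq_bigr => i /andP[h1 h2]; rewrite eo.
split; [|split].
(* Strict convexity of the square: the sum of squares drops strictly, so the two multisets of
   entries differ. *)
- move=> e; pose F x := (x ^ 2)%N.
  have := dominant_sum F m; rewrite e dominant_sum (D F m) (D F l) (eO F) /F.
  by move=> h; have : (l p ^ 2 + l q ^ 2 = m p ^ 2 + m q ^ 2)%N; [lia | nia].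
- by rewrite !sumn_dominant !mdegE (D id l) (D id m) (eO id); lia.
- case=> [|n]; first by rewrite !take0.
  (* The threshold [c] attains the minimum for [l], and for [m] the same threshold gives an upper
     bound. *)
  have := sumn_take_eq (dominant_sorted l) (ltn0Sn n); set c := nth _ _ _ => /= ->.
  apply: leq_trans (sumn_take_le _ c _) _; rewrite leq_add2l.
  pose F x := (x - c)%N; rewrite !(dominant_sum F) (D F l) (D F m) (eO F) /F; lia.
Qed.

Definition pact (w : {perm 'I_N}) l : 'X_{1..N} := [multinom l (w i) | i < N].

Lemma pactE w l i : pact w l i = l (w i).
Proof. exact: mnmE. Qed.

Lemma pact1 l : pact 1 l = l.
Proof. by apply/mnmP => i; rewrite pactE perm1. Qed.

Lemma pactM v w l : pact (v * w) l = pact v (pact w l).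
Proof. by apply/mnmP => i; rewrite !pactE permM. Qed.

Lemma pactVK w : cancel (pact w^-1) (pact w).
Proof. by move=> l; rewrite -pactM mulgV pact1. Qed.

Lemma dominant_pact w l : dominant (pact w l) = dominant l.
Proof.
apply/(perm_sortP (rev_leq_total) (rev_leq_trans) (rev_leq_anti)).
rewrite /mseq (eq_map (g := l \o w)); last by move=> i; rewrite pactE.
rewrite map_comp; apply: perm_map; apply: uniq_perm.
- by rewrite map_inj_uniq ?enum_uniq //; exact: perm_inj.
- exact: enum_uniq.
- move=> i; rewrite mem_enum; apply/mapP; exists (w^-1 i)%g; first by rewrite mem_enum.
  by rewrite permKV.
Qed.

Lemma dom_lt_trans (a b c : seq nat) : sorted geq a -> sorted geq b -> sorted geq c ->
  size a = size b -> size b = size c ->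
  dom_lt a b -> dom_lt b c -> dom_lt a c.
Proof.
move=> sa sb sc h1 h2 [nab [eab lab]] [nbc [ebc lbc]]; split; [|split].
- move=> e; apply: nbc; rewrite -e.
  have E (n : nat) : sumn (take n a) = sumn (take n b).
    by apply/eqP; rewrite eqn_leq lab /= e lbc.
  apply/esym; apply: (@eq_from_nth _ 0%N) => // i hi.
  have := E i.+1; rewrite (take_nth 0%N hi) (take_nth 0%N (s := b)) -?h1 //.
  by rewrite !sumn_rcons E; lia.
- by rewrite eab ebc.
- by move=> k; apply: leq_trans (lab k) (lbc k).
Qed.

(** A Bruhat step moves the larger of two entries to the right and so increases this weight
    strictly, which excludes cycles. *)
Definition wgt l := (\sum_(i < N) i * l i)%N.

Lemma pactJ_tperm (i j : 'I_N) l : [multinom l (perm.tperm i j k) | k < N] = pact (perm.tperm i j) l.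
Proof. by []. Qed.

Lemma bstep_wgt l m : bstep l m -> (wgt l < wgt m)%N.
Proof.
move=> [i [j [hij [hl ->]]]]; rewrite /wgt.
have nij : i != j by apply/eqP => e; rewrite e ltnn in hij.
rewrite (bigD1 i) //= (bigD1 j) 1?eq_sym //= [X in (_ < X)%N](bigD1 i) //=.
rewrite [X in (_ < _ + X)%N](bigD1 j) 1?eq_sym //= !mnmE perm.tpermL perm.tpermR.
rewrite [X in (_ < _ + (_ + X))%N](eq_bigr (fun k : 'I_N => (k * l k)%N)); last first.
  by move=> k /andP[h1 h2]; rewrite mnmE perm.tpermD // eq_sym.
by nia.
Qed.

Lemma bsteps_wgt l m : clos_refl_trans _ (@bstep N) l m -> l = m \/ (wgt l < wgt m)%N.
Proof.
elim=> [x y /bstep_wgt|x|x y z _ h1 _ h2]; [by right|by left|].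
case: h1 => [->//|h1]; case: h2 => [<-|h2]; first by right.
by right; apply: ltn_trans h1 h2.
Qed.

Lemma bru_lt_trans l m k : bru_lt l m -> bru_lt m k -> bru_lt l k.
Proof.
move=> [h1|[e1 [n1 h1]]] [h2|[e2 [n2 h2]]].
- by left; apply: dom_lt_trans h1 h2; rewrite ?size_dominant //; exact: dominant_sorted.
- by left; rewrite -e2.
- by left; rewrite e1.
- right; split; first by rewrite e1.
  split; last by apply: rt_trans h1 h2.
  move=> e; case: (bsteps_wgt h1) => // w1; case: (bsteps_wgt h2) => // w2.
  by move: (ltn_trans w1 w2); rewrite e ltnn.
Qed.

Lemma bru_lt_irr l : ~ bru_lt l l.
Proof. by move=> [[]|[_ []]]. Qed.

Lemma bru_lt_mdeg l m : bru_lt l m -> mdeg l = mdeg m.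
Proof.
by rewrite -!sumn_dominant => -[[_ []]|[->]].
Qed.

Lemma bru_lt_swap (i j : 'I_N) l : (i < j)%N -> (l i < l j)%N ->
  bru_lt (pact (perm.tperm i j) l) l.
Proof.
move=> hij hl; right; split; first exact: dominant_pact.
split.
  move=> /(congr1 (fun m : 'X_{1..N} => m i)); rewrite pactE perm.tpermL => e.
  by rewrite e ltnn in hl.
apply: rt_step; exists i, j; split=> //; split; first by rewrite !pactE perm.tpermL perm.tpermR.
by rewrite pactJ_tperm -pactM perm.tperm2 pact1.
Qed.

End Order.

(** * Triangularity of the Cherednik operators *)

Lemma sv_monom n k (g : nat -> {mpoly Fld[k]}) (m : 'X_{1..n}) :
  sv g 'X_[m] = \prod_(i < n) g i.+1 ^+ m i.
Proof. by rewrite svE comp_mpolyX; apply: eq_bigr => i _; rewrite tnth_mktuple. Qed.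

Section Step.
Variables (N : nat) (o1 o2 : 'I_N).
Hypothesis ho : o2 = o1.+1 :> nat.
(** Variables are numbered from 1 and ordinals from 0, so T_j with j = [o2] acts on the variables at
    positions [o1] and [o2]. *)
Let j : nat := o2.
Implicit Types l m nu : 'X_{1..N}.

Let hj : (0 < j < N)%N.
Proof. by rewrite /j ltn_ord andbT ho. Qed.

Let neo : o1 != o2.
Proof. by apply/eqP => e; have := ho; rewrite e; lia. Qed.

Let x1 : xv N j = 'X_o1.
Proof. by rewrite /j ho xv_ord. Qed.
Let x2 : xv N j.+1 = 'X_o2.
Proof. by rewrite /j xv_ord. Qed.

Definition upd l u v : 'X_{1..N} := [multinom if k == o1 then u else if k == o2 then v else l k | k < N].

Lemma upd1 l u v : upd l u v o1 = u. Proof. by rewrite mnmE eqxx. Qed.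
Lemma upd2 l u v : upd l u v o2 = v. Proof. by rewrite mnmE eq_sym (negbTE neo) eqxx. Qed.
Lemma updo l u v k : k != o1 -> k != o2 -> upd l u v k = l k.
Proof. by move=> /negbTE h1 /negbTE h2; rewrite mnmE h1 h2. Qed.

Lemma upd_id l : upd l (l o1) (l o2) = l.
Proof. by apply/mnmP => k; rewrite mnmE; case: eqP => [->|_] //; case: eqP => [->|]. Qed.

Lemma upd_swap l : upd l (l o2) (l o1) = pact (perm.tperm o1 o2) l.
Proof.
apply/mnmP => k; rewrite mnmE pactE.
by case: perm.tpermP => [->|->|/eqP/negbTE-> /eqP/negbTE->//]; rewrite ?eqxx // eq_sym (negbTE neo).
Qed.

Lemma X_upd l u v : 'X_[upd l u v] = 'X_[upd l 0 0] * ('X_o1 ^+ u * 'X_o2 ^+ v) :> {mpoly Fld[N]}.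
Proof.
rewrite !mpolyXn -!mpolyXD; congr 'X_[_]; apply/mnmP => k.
rewrite mnmDE !mnmE !mulmnE !mnm1E eq_sym (eq_sym o2).
have [->|n1] := eqVneq k o1; first by rewrite (negbTE neo) mul1n mul0n; lia.
by have [_|n2] := eqVneq k o2; rewrite !(mul1n, mul0n); lia.
Qed.

Lemma DL_upd l u v :
  DL j ('X_[upd l u v] : {mpoly Fld[N]}) = 'X_[upd l 0 0] * DL j ('X_o1 ^+ u * 'X_o2 ^+ v).
Proof.
rewrite X_upd DL_mul // /sw sv_monom [RHS]mpolyXE_id; apply: eq_bigr => i _.
have [->|n1] := eqVneq i o1; first by rewrite upd1 !expr0.
have [->|n2] := eqVneq i o2; first by rewrite upd2 !expr0.
rewrite updo // /swapv -xv_ord.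
case: eqP => [e|_]; first by case/eqP: n1; apply: val_inj; move: e; rewrite /j ho => -[].
by case: eqP => [e|_] //; case/eqP: n2; apply: val_inj; move: e; rewrite /j => -[].
Qed.

(** The symmetric factor ('X_o1 'X_o2)^a comes out of T_j; on the remaining pure power the divided
    difference is a geometric sum. *)
Lemma DL_gt (a m : nat) : DL j ('X_o1 ^+ (a + m) * 'X_o2 ^+ a) =
  'X_o1 ^+ a * 'X_o2 ^+ (a + m) +
   (1 - tt_) *: \sum_(k < m) 'X_o1 ^+ (a + m - k) * 'X_o2 ^+ (a + k) :> {mpoly Fld[N]}.
Proof.
have -> : 'X_o1 ^+ (a + m) * 'X_o2 ^+ a = ('X_o1 * 'X_o2) ^+ a * 'X_o1 ^+ m :> {mpoly Fld[N]}.
  by rewrite exprMn exprD; ring.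
have s1 : sw j ('X_o1 : {mpoly Fld[N]}) = 'X_o2 by rewrite -x1 sw_l.
have s2 : sw j ('X_o2 : {mpoly Fld[N]}) = 'X_o1 by rewrite -x2 sw_r.
rewrite DL_mul; last by rewrite /sw svX svM -!/(sw _ _) s1 s2 mulrC.
have -> : DL j ('X_o1 ^+ m : {mpoly Fld[N]}) =
   'X_o2 ^+ m + (1 - tt_) *: ('X_o1 * \sum_(k < m) 'X_o1 ^+ (m.-1 - k) * 'X_o2 ^+ k).
  apply/esym/DL_uniq => //; rewrite x1 x2 /sw svX -/(sw _ _) s1 -mul_mpolyC mpolyCB mpolyC1.
  have := subrXX ('X_o1 : {mpoly Fld[N]}) 'X_o2 m; set S := \sum_(k < m) _ => e.
  transitivity (('X_o1 - 'X_o2) * 'X_o2 ^+ m + (1 - (tt_)%:MP) * 'X_o1 * (('X_o1 - 'X_o2) * S)).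
    by ring.
  by rewrite -e; ring.
rewrite mulrDr; congr (_ + _); first by rewrite exprMn exprD; ring.
rewrite -scalerAr; congr (_ *: _); rewrite mulr_sumr mulr_sumr.
apply: eq_bigr => k _.
rewrite exprMn; have -> : (a + m - k = a + (1 + (m.-1 - k)))%N by have := ltn_ord k; lia.
by rewrite !exprD expr1; ring.
Qed.

(** The monomials strictly between the two extreme exponents: those that drop in dominance order. *)
Definition midsum (a m : nat) : {mpoly Fld[N]} :=
  \sum_(1 <= k < m) 'X_o1 ^+ (a + m - k) * 'X_o2 ^+ (a + k).

Lemma DL_gt_mid (a m : nat) : (0 < m)%N -> DL j ('X_o1 ^+ (a + m) * 'X_o2 ^+ a) =
  'X_o1 ^+ a * 'X_o2 ^+ (a + m) + (1 - tt_) *: ('X_o1 ^+ (a + m) * 'X_o2 ^+ a)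
  + (1 - tt_) *: midsum a m.
Proof.
move=> m0; rewrite DL_gt -addrA -scalerDr; congr (_ + _ *: _).
rewrite -(big_mkord xpredT (fun k => 'X_o1 ^+ (a + m - k) * 'X_o2 ^+ (a + k))).
by rewrite big_ltn // subn0 addn0.
Qed.

(** The sum of the two extreme monomials is symmetric, hence fixed by T_j, so this case is the
    complement of [DL_gt_mid]. *)
Lemma DL_lt_mid (a m : nat) : (0 < m)%N -> DL j ('X_o1 ^+ a * 'X_o2 ^+ (a + m)) =
  tt_ *: ('X_o1 ^+ (a + m) * 'X_o2 ^+ a) - (1 - tt_) *: midsum a m.
Proof.
move=> m0; have := DL_gt_mid a m0.
set p := 'X_o1 ^+ (a + m) * _; set p' := 'X_o1 ^+ a * _ => e.
have s1 : sw j ('X_o1 : {mpoly Fld[N]}) = 'X_o2 by rewrite -x1 sw_l.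
have s2 : sw j ('X_o2 : {mpoly Fld[N]}) = 'X_o1 by rewrite -x2 sw_r.
have sp : sw j p = p' by rewrite /p /sw svM !svX -!/(sw _ _) s1 s2 mulrC.
have sp' : sw j p' = p by rewrite /p' /sw svM !svX -!/(sw _ _) s1 s2 mulrC.
have : DL j (p + p') = p + p'.
  by apply: (proj2 (DL_fixP _ hj)); rewrite /sw svD -!/(sw _ _) sp sp' addrC.
rewrite (linopD (@linop_DL _ _)) e => /(congr1 (fun q => q - (p' + (1 - tt_) *: p + (1 - tt_) *: midsum a m))).
rewrite addrAC subrr add0r => ->; rewrite -!mul_mpolyC mpolyCB mpolyC1.
by move: (midsum a m) => S; ring.
Qed.

End Step.

Section Low.
Variables (N : nat).
Implicit Types (l m nu : 'X_{1..N}) (w : {perm 'I_N}) (f g : {mpoly Fld[N]}).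

(* [w] records how the factors of Y_i applied so far have permuted the entries of
   an exponent. Following it makes each single T_j or T_j^-1 triangular, although
   T_j alone is not triangular for the Bruhat order. *)
Definition low w nu f := forall l, f@_l != 0 -> exists2 k, bru_lt k nu & l = pact w k.

Lemma low0 w nu : low w nu 0.
Proof. by move=> l; rewrite mcoeff0 eqxx. Qed.

Lemma lowD w nu f g : low w nu f -> low w nu g -> low w nu (f + g).
Proof.
move=> hf hg l; rewrite mcoeffD => h.
have [e|n] := eqVneq (f@_l) 0; last exact: hf.
by apply: hg; rewrite e add0r in h.
Qed.

Lemma lowZ w nu c f : low w nu f -> low w nu (c *: f).
Proof. by move=> hf l; rewrite mcoeffZ mulf_eq0 negb_or => /andP[_]; exact: hf. Qed.

Lemma lowN w nu f : low w nu f -> low w nu (- f).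
Proof. by move=> hf; rewrite -scaleN1r; apply: lowZ. Qed.

Lemma low_sum w nu (I : eqType) (r : seq I) (F : I -> {mpoly Fld[N]}) :
  (forall i, i \in r -> low w nu (F i)) -> low w nu (\sum_(i <- r) F i).
Proof.
move=> h; rewrite big_seq; apply: (big_ind (low w nu)); [exact: low0 | exact: lowD | exact: h].
Qed.

Lemma lowX w nu k : bru_lt k nu -> low w nu 'X_[pact w k].
Proof.
move=> h l; rewrite mcoeffX; case: (pact w k =P l) => [<- _|_]; first by exists k.
by rewrite eqxx.
Qed.

Lemma low_trans w nu nu' f : bru_lt nu nu' -> low w nu f -> low w nu' f.
Proof. by move=> h hf l /hf[k hk ->]; exists k => //; apply: bru_lt_trans h. Qed.

Lemma low_linop w w' nu nu' (F : {mpoly Fld[N]} -> {mpoly Fld[N]}) : linop F ->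
  (forall k, bru_lt k nu -> low w' nu' (F 'X_[pact w k])) ->
  forall f, low w nu f -> low w' nu' (F f).
Proof.
move=> hF h f hf; rewrite (mpolyE f) (linop_sum hF); apply: low_sum => l.
rewrite mcoeff_msupp => /hf[k hk ->]; rewrite (linopZ hF); apply: lowZ; exact: h.
Qed.

Definition tri w nu c f := exists2 g, low w nu g & f = c *: 'X_[pact w nu] + g.

Lemma tri_low w nu nu' c f : bru_lt nu nu' -> tri w nu c f -> low w nu' f.
Proof.
move=> h [g hg ->]; apply: lowD; first by apply: lowZ; apply: lowX.
exact: low_trans h hg.
Qed.

Lemma tri_linop w w' (F : {mpoly Fld[N]} -> {mpoly Fld[N]}) (a : 'X_{1..N} -> Fld) : linop F ->
  (forall k, tri w' k (a k) (F 'X_[pact w k])) ->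
  forall nu c f, tri w nu c f -> tri w' nu (c * a nu) (F f).
Proof.
move=> hF h nu c f [g hg ->]; have [g' hg' e] := h nu.
exists (c *: g' + F g).
  apply: lowD; first exact: lowZ.
  by apply: (low_linop hF _ hg) => k hk; apply: tri_low (h k).
by rewrite (linopD hF) (linopZ hF) e scalerDr scalerA addrA.
Qed.

Section Step.
Variables (o1 o2 : 'I_N).
Hypothesis ho : o2 = o1.+1 :> nat.

Let neo : o1 != o2.
Proof. by apply/eqP => e; have := ho; rewrite e; lia. Qed.

(** The permutation [v] is arbitrary because dominance compares sorted exponents only. *)
Lemma low_midsum w v nu (a m : nat) : let l := pact w nu in
  minn (l o1) (l o2) = a -> maxn (l o1) (l o2) = (a + m)%N ->
  low v nu ('X_[upd o1 o2 l 0 0] * midsum o1 o2 a m).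
Proof.
move=> l ea em; rewrite mulr_sumr; apply: low_sum => k; rewrite mem_index_iota => hk.
rewrite -X_upd //; set l' := upd _ _ _ _ _.
rewrite -(pactVK v l'); apply: lowX; left; rewrite dominant_pact -(dominant_pact w nu) -/l.
have e1 : l' o1 = (a + m - k)%N by exact: upd1.
have e2 : l' o2 = (a + k)%N by exact: upd2.
apply: (@dom_lt_spread _ _ _ o1 o2) => //; rewrite ?e1 ?e2; try lia.
by move=> i h1 h2; apply: updo.
Qed.

Definition st w := (perm.tperm o1 o2 * w)%g.

Lemma pact_st w nu : pact (st w) nu = upd o1 o2 (pact w nu) (nu (w o2)) (nu (w o1)).
Proof. by rewrite pactM -!pactE upd_swap. Qed.

Lemma pact_st_swap w nu : pact (st w) (pact (perm.tperm (w o1) (w o2)) nu) = pact w nu.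
Proof.
rewrite -pactM; congr pact.
by rewrite /st -perm.tpermJ /conjg !mulgA mulgK -mulgA mulgA perm.tperm2 mul1g.
Qed.

(** Besides the middle terms, T_j may leave the original monomial behind. Read through [st w], that
    monomial is nu with its entries at [w o2] and [w o1] exchanged. It occurs only if the smaller
    entry is at [w o2], and the hypothesis on [w] puts this position on the left, so the exchange
    goes down in Bruhat order. *)
Lemma DL_step w nu : (w o2 < w o1)%N ->
  tri (st w) nu (if (nu (w o1) < nu (w o2))%N then tt_ else 1) (DL o2 'X_[pact w nu]).
Proof.
move=> hw; set l := pact w nu.
have e1 : l o1 = nu (w o1) by exact: pactE.
have e2 : l o2 = nu (w o2) by exact: pactE.
rewrite -[in DL _ _](upd_id o1 o2 l) DL_upd // /tri pact_st -e1 -e2 -/l.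
case: (ltngtP (l o1) (l o2)) => h.
- have -> : l o2 = (l o1 + (l o2 - l o1))%N by lia.
  rewrite DL_lt_mid //; last by lia.
  rewrite mulrBr -!scalerAr -X_upd //; eexists; last by [].
  by apply: lowN; apply: lowZ; apply: low_midsum; rewrite -/l; lia.
- have eo : l o1 = (l o2 + (l o1 - l o2))%N by lia.
  have := DL_gt_mid ho (l o2) (m := l o1 - l o2); rewrite -eo => ->; last by lia.
  rewrite !mulrDr -!scalerAr -!X_upd // upd_id scale1r -addrA; eexists; last by [].
  apply: lowD; apply: lowZ; last by apply: low_midsum; rewrite -/l; lia.
  rewrite /l -pact_st_swap; apply: lowX.
  by rewrite perm.tpermC; apply: bru_lt_swap; rewrite // -e1 -e2.
- have := DL_gt ho (l o1) 0; rewrite addn0 big_ord0 scaler0 addr0 -h => ->.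
  by rewrite -X_upd //; exists 0; [exact: low0 | rewrite scale1r addr0].
Qed.

(** For T_j^-1 the original monomial is left behind in the opposite case, which is why the
    hypothesis on [w] is reversed. *)
Lemma DLi_step w nu : (w o1 < w o2)%N ->
  tri (st w) nu (if (nu (w o2) < nu (w o1))%N then tt_^-1 else 1) (DLi o2 'X_[pact w nu]).
Proof.
move=> hw; set l := pact w nu.
have hj : (0 < o2 < N)%N by rewrite ltn_ord ho.
have e1 : l o1 = nu (w o1) by exact: pactE.
have e2 : l o2 = nu (w o2) by exact: pactE.
rewrite /DLi hj -[in DL _ _](upd_id o1 o2 l) DL_upd // /tri pact_st -e1 -e2 -/l.
case: (ltngtP (l o2) (l o1)) => h.
- have eo : l o1 = (l o2 + (l o1 - l o2))%N by lia.
  have := DL_gt_mid ho (l o2) (m := l o1 - l o2); rewrite -eo => ->; last by lia.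
  rewrite !mulrDr -!scalerAr -!X_upd // upd_id addrAC addrK scalerDr; eexists; last by [].
  by do 2 apply: lowZ; apply: low_midsum; rewrite -/l; lia.
- have eo : l o2 = (l o1 + (l o2 - l o1))%N by lia.
  have := DL_lt_mid ho (l o1) (m := l o2 - l o1); rewrite -eo => ->; last by lia.
  rewrite mulrBr -!scalerAr -!X_upd // -addrA scalerDr scalerA mulVf ?tt_neq0 //.
  eexists; last by [].
  apply: lowZ; apply: lowD; apply: lowN; apply: lowZ.
    by apply: low_midsum; rewrite -/l; lia.
  by rewrite /l -pact_st_swap; apply: lowX; apply: bru_lt_swap; rewrite // -e1 -e2.
- have el : upd o1 o2 l (l o1) (l o1) = l by have := upd_id o1 o2 l; rewrite h.
  have := DL_gt ho (l o1) 0; rewrite addn0 big_ord0 scaler0 addr0 h => ->.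
  rewrite -X_upd // el; exists 0; first exact: low0.
  rewrite scale1r addr0.
  rewrite -{1}['X_[_]]scale1r -scalerBl opprB addrC subrK scalerA mulVf ?tt_neq0 //.
  by rewrite scale1r.
Qed.
End Step.
End Low.

Lemma eig_scalar (K : fieldType) (t q : K) (N i a b : nat) : t != 0 -> (0 < i <= N)%N ->
  t ^+ N * t ^- i.-1 * (t ^- (N - i) * t ^+ a * q * t ^+ b) = q * t ^+ (1 + a + b).
Proof.
move=> t0 hi; rewrite !exprD expr1.
have -> : t ^+ N = t * t ^+ i.-1 * t ^+ (N - i).
  by rewrite -exprS prednK -?exprD; [congr (_ ^+ _); lia | lia].
have h1 : t ^+ i.-1 != 0 by rewrite expf_neq0.
have h2 : t ^+ (N - i) != 0 by rewrite expf_neq0.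
by field; rewrite h1 h2.
Qed.

Lemma expr_step (K : fieldType) (t : K) n a (b : bool) : t != 0 ->
  t ^- n * t ^+ a * (if ~~ b then t^-1 else 1) = t ^- n.+1 * t ^+ (a + b).
Proof.
move=> t0; rewrite exprD exprS invfM.
have tn0 : t ^+ n != 0 by rewrite expf_neq0.
by case: b; rewrite /= ?expr0 ?expr1; field; rewrite ?t0 ?tn0.
Qed.

Section Triangular.
Variable N : nat.
Implicit Types (l m nu : 'X_{1..N}) (w : {perm 'I_N}) (f g : {mpoly Fld[N]}).

Definition rotp : {perm 'I_N} := perm.perm (@ord_pred_inj N).

Lemma rotpE (k : 'I_N) : rotp k = (if nat_of_ord k == 0 then N.-1 else k.-1) :> nat.
Proof.
rewrite permE /=; have := ltn_ord k; case: (nat_of_ord k) => [|n] hn /=.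
  by rewrite add0n modn_small //; lia.
by rewrite modnDr modn_small //; lia.
Qed.

Lemma omv_X l : (0 < N)%N ->
  omv 'X_[l] = qq_ ^+ nth 0%N l N.-1 *: 'X_[pact rotp l].
Proof.
move=> N0; rewrite /omv sv_monom (reindex_inj (@perm_inj _ rotp)) /= mpolyXE_id.
have i0 : 'I_N by exists 0%N.
have hi0 : nat_of_ord (Ordinal N0) = 0%N by [].
rewrite (bigD1 (Ordinal N0)) //= [in RHS](bigD1 (Ordinal N0)) //= rotpE hi0 /=.
rewrite prednK // eqxx (xv_ord (Ordinal N0)) exprZn -scalerAl pactE.
have -> : l (rotp (Ordinal N0)) = nth 0%N l N.-1 by rewrite (mnm_nth 0%N) rotpE.
congr (_ *: (_ * _)); apply: eq_bigr => k hk; rewrite rotpE pactE.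
have k0 : (0 < k)%N by rewrite lt0n; apply: contra hk => /eqP e; apply/eqP/val_inj.
rewrite (_ : (nat_of_ord k == 0) = false); last by lia.
rewrite prednK // (_ : (nat_of_ord k == N) = false) ?xv_ord //.
by have := ltn_ord k; lia.
Qed.

Definition T_chain (l : seq nat) f := foldl (fun g i => DL i g) f l : {mpoly Fld[N]}.

Lemma T_chain_rcons (l : seq nat) i f : T_chain (rcons l i) f = DL i (T_chain l f).
Proof. by rewrite /T_chain foldl_rcons. Qed.

Lemma iota_rcons a n : iota a n.+1 = rcons (iota a n) (a + n)%N.
Proof. by rewrite -cats1 -addn1 iotaD. Qed.

(** In Y_(i+1) = t^-1 T_i Y_i T_i the inner T_i cancels against T_i^-1, the first factor applied in
    Y_i. What remains moves one single entry once around the cycle. *)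
Lemma YL_chain i f : (0 < i <= N)%N ->
  YL i f = tt_ ^- i.-1 *: T_chain (iota 1 i.-1) (omv (Tinv_chain (iota i (N - i)) f)).
Proof.
elim: i f => // -[|i] ih f hi; first by rewrite YL1 invr1 scale1r subn1.
rewrite YLS // ih /=; last by lia.
rewrite (linopZ (@linop_DL _ _)) scalerA -exprVn -exprS exprVn -T_chain_rcons -(add1n i) -iota_rcons.
congr (_ *: T_chain _ (omv _)).
have -> : (N - i.+1 = (N - i.+2).+1)%N by lia.
by rewrite /Tinv_chain /= DLK.
Qed.

Definition mexp nu k := nth 0%N nu k.

Lemma mexpE nu (k : 'I_N) : nu k = mexp nu k. Proof. exact: mnm_nth. Qed.

(* Positions reached when Y_i moves the entry [p] to the end through T_j^-1's and,
   after the rotation, back from the front through T_j's. *)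
Definition down_pos (p e k : nat) := if (k < p)%N then k else if (k < e)%N then k.+1 else
  if k == e then p else k.
Definition up_pos (p m k : nat) := if (k < m)%N then k else if k == m then p else
  if (k <= p)%N then k.-1 else k.

(** The carried entry comes from position i - 1, to the left of every entry it passes, so [DLi_step]
    applies each time. Passing a strictly smaller entry costs t^-1; writing this as t^-n times a
    count of the others keeps the exponents natural. *)
Lemma Tinv_chain_tri i n : (0 < i)%N -> (i + n <= N)%N ->
  exists2 w : {perm 'I_N}, (forall k, w k = down_pos i.-1 (i.-1 + n) k :> nat) &
  forall nu, tri w nu (tt_ ^- n * tt_ ^+ (\sum_(i <= k < i + n) (mexp nu i.-1 <= mexp nu k)))
    (Tinv_chain (iota i n) 'X_[nu]).
Proof.
move=> i0; elim: n => [|n ih] hn.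
  exists 1%g => [k|nu]; first by rewrite perm1 /down_pos addn0; case: ltnP => //; case: eqP.
  rewrite addn0 big_geq // mulr1 invr1 /Tinv_chain /=.
  by exists 0; [exact: low0 | rewrite scale1r addr0 pact1].
have [|w hw ht] := ih; first by lia.
have h1 : (i.-1 + n < N)%N by lia.
have h2 : ((i.-1 + n).+1 < N)%N by lia.
pose o1 := Ordinal h1; pose o2 := Ordinal h2.
have ho : o2 = o1.+1 :> nat by [].
have e2 : nat_of_ord o2 = (i + n)%N by rewrite /=; lia.
have w1 : w o1 = i.-1 :> nat by rewrite hw /down_pos /= eqxx ltnn; case: ltnP => //; lia.
have w2 : w o2 = (i + n)%N :> nat.
  by rewrite hw /down_pos /= ltnNge (leq_trans _ (leqnSn _)) ?leq_addr //= ltnNge leqnSn /= gtn_eqF //; lia.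
exists (st o1 o2 w) => [k|nu].
  rewrite /st permM; case: perm.tpermP => [->|->|n1 n2]; rewrite ?w1 ?w2 /down_pos /=.
  - by case: ltnP => ?; [lia|]; case: ltnP => ?; lia.
  - case: ltnP => ?; [lia|]; case: ltnP => ?; [lia|]; case: eqP => ?; lia.
  - have k1 : nat_of_ord k <> (i.-1 + n)%N by move=> e; apply: n1; apply: val_inj.
    have k2 : nat_of_ord k <> (i.-1 + n).+1 by move=> e; apply: n2; apply: val_inj.
    rewrite hw /down_pos; case: ltnP => // ?.
    by case: ltnP => ?; case: ltnP => ?; try lia; case: eqP => ?; case: eqP => ?; lia.
have hlt : (w o1 < w o2)%N by rewrite w1 w2; lia.
have := tri_linop (@linop_DLi _ o2) (fun k => DLi_step ho k hlt) (ht nu).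
rewrite iota_rcons {2}/Tinv_chain foldl_rcons -/(Tinv_chain _ _) e2.
congr tri; rewrite !mexpE w1 w2 addnS big_nat_recr /=; last by lia.
by rewrite ltnNge; exact/expr_step/tt_neq0.
Qed.

(** Now the carried entry, originally at [p], returns from the front and passes entries originally
    to its left, which is the hypothesis of [DL_step]. *)
Lemma T_chain_tri p n w0 : (p < N)%N -> (n <= p)%N ->
  (forall k, w0 k = up_pos p 0 k :> nat) ->
  exists2 w : {perm 'I_N}, (forall k, w k = up_pos p n k :> nat) &
  forall nu c f, tri w0 nu c f ->
    tri w nu (c * tt_ ^+ (\sum_(0 <= k < n) (mexp nu p < mexp nu k))) (T_chain (iota 1 n) f).
Proof.
move=> hp; elim: n => [|n ih] hn h0.
  by exists w0; [exact: h0 | move=> nu c f hf; rewrite big_geq // expr0 mulr1].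
have [||w hw ht] := ih; first by lia.
  by [].
have h1 : (n < N)%N by lia.
have h2 : (n.+1 < N)%N by lia.
pose o1 := Ordinal h1; pose o2 := Ordinal h2.
have ho : o2 = o1.+1 :> nat by [].
have w1 : w o1 = p :> nat by rewrite hw /up_pos /= eqxx ltnn.
have w2 : w o2 = n :> nat by rewrite hw /up_pos /= ltnNge leqnSn /= gtn_eqF // hn.
exists (st o1 o2 w) => [k|nu c f hf].
  rewrite /st permM; case: perm.tpermP => [->|->|n1 n2]; rewrite ?w1 ?w2 /up_pos /=.
  - by rewrite ltnSn.
  - by rewrite ltnn eqxx.
  - have k1 : nat_of_ord k <> n by move=> e; apply: n1; apply: val_inj.
    have k2 : nat_of_ord k <> n.+1 by move=> e; apply: n2; apply: val_inj.
    rewrite hw /up_pos; case: ltnP => ?; case: ltnP => ? //; try lia.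
    by case: eqP => ?; case: eqP => ?; lia.
have hlt : (w o2 < w o1)%N by rewrite w1 w2; lia.
have := tri_linop (@linop_DL _ o2) (fun k => DL_step ho k hlt) (ht nu c f hf).
rewrite iota_rcons T_chain_rcons add1n.
congr tri; rewrite !mexpE w1 w2 big_nat_recr //= exprD mulrA; congr (_ * _).
by case: (_ < _)%N.
Qed.

(* The eigenvalue of Y_i on E_nu is q^(nu_i) t^(sexp i nu - N): multiplying by t^N
   makes the power of t a natural number that is stable under appending zeros. *)
Definition sexp i nu := (1 + \sum_(i <= k < N) (mexp nu i.-1 <= mexp nu k)
  + \sum_(0 <= k < i.-1) (mexp nu i.-1 < mexp nu k))%N.

Definition eig i nu : Fld := qq_ ^+ mexp nu i.-1 * tt_ ^+ sexp i nu.

Definition YN i f := tt_ ^+ N *: YL i f.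

Lemma linop_YN i : linop (YN i).
Proof. by apply: linop_scale; exact: linop_YL. Qed.

Lemma YN_tri i nu : (0 < i <= N)%N -> tri 1 nu (eig i nu) (YN i 'X_[nu]).
Proof.
move=> hi.
have [||w hw ht] := @Tinv_chain_tri i (N - i); [lia|lia|].
have [|||w' hw' ht'] := @T_chain_tri i.-1 i.-1 (rotp * w)%g; [lia|lia| |].
  move=> k; rewrite permM hw /down_pos rotpE /up_pos ltn0; have hk := ltn_ord k.
  have [e|ne] := eqVneq (nat_of_ord k) 0%N.
    by case: ltnP => ?; [lia|]; case: ltnP => ?; [lia|]; case: eqP => ?; lia.
  case: ltnP => ?; case: leqP => ? //; try lia.
  by case: ltnP => ?; lia.
(* The carried entry is back at its own position, so the recorded permutation is trivial and
   triangularity holds for the Bruhat order itself. *)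
have -> : 1%g = w'.
  apply/permP => k; apply: val_inj; rewrite /= perm1 hw' /up_pos.
  by case: ltnP => ? //; case: eqP => ? //; case: leqP => ? //; lia.
have hom k : tri (rotp * w) k (qq_ ^+ mexp k i.-1) (omv 'X_[pact w k]).
  rewrite omv_X; last by lia.
  rewrite -pactM; exists 0; first exact: low0.
  rewrite addr0; congr (_ ^+ _ *: _).
  have hN : (N.-1 < N)%N by lia.
  rewrite -[N.-1]/(nat_of_ord (Ordinal hN)) -mnm_nth pactE mexpE hw /down_pos /=; congr mexp.
  by case: ltnP => ?; [lia|]; case: ltnP => ?; [lia|]; case: eqP => ?; lia.
have [g hg e] := ht' nu _ _ (tri_linop (@linop_omv N) hom (ht nu)).
exists (tt_ ^+ N * tt_ ^- i.-1 *: g); first exact: lowZ.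
rewrite /YN YL_chain // e scalerA scalerDr scalerA; congr (_ *: _ + _).
rewrite /eig /sexp (_ : i + (N - i) = N)%N; last by lia.
by rewrite eig_scalar //; exact: tt_neq0.
Qed.

End Triangular.

(** * Non-symmetric Macdonald polynomials *)

Lemma tofr_inj : injective tofr.
Proof. by move=> a b /eqP; rewrite /tofr tofrac_eq => /eqP. Qed.

Lemma qt_tofr a b : qq_ ^+ a * tt_ ^+ b = tofr (('X ^+ a)%:P * 'X^b).
Proof.
rewrite /qq_ /tt_ /tofr; rewrite -(rmorphXn (@FracField.tofrac _)) -(rmorphXn (@FracField.tofrac _)).
by rewrite -(rmorphM (@FracField.tofrac _)) polyC_exp.
Qed.

Lemma qt_inj a b a' b' : qq_ ^+ a * tt_ ^+ b = qq_ ^+ a' * tt_ ^+ b' -> a = a'.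
Proof.
rewrite !qt_tofr => /tofr_inj e.
have := congr1 (fun p : {poly {poly rat}} => p`_b) e.
rewrite !coefCM !coefXn eqxx mulr1; case: (b == b') => /=.
  rewrite mulr1 => /(congr1 (fun p : {poly rat} => p`_a)).
  rewrite !coefXn eqxx; case: eqP => // _ /eqP; by rewrite oner_eq0.
by rewrite mulr0 => /eqP; rewrite -size_poly_eq0 size_polyXn.
Qed.

Section Macdonald.
Variable N : nat.
Implicit Types (k l m nu : 'X_{1..N}) (f g E : {mpoly Fld[N]}).

Lemma eig_inj i k l : eig i k = eig i l -> mexp k i.-1 = mexp l i.-1.
Proof. exact: qt_inj. Qed.

Definition decide_em (P : Prop) : bool := if excluded_middle_informative P then true else false.

Lemma decide_emP P : reflect P (decide_em P).
Proof. by rewrite /decide_em; case: excluded_middle_informative => h; constructor. Qed.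

(** Compositions below [nu] have the same degree, so they are finitely many; the induction is on
    their number. *)
Lemma bru_lt_wf : well_founded (@bru_lt N).
Proof.
suff H d n nu : mdeg nu = d ->
    (#|[pred b : 'X_{1..N < d.+1} | decide_em (bru_lt b nu)]| < n)%N -> Acc (@bru_lt N) nu.
  by move=> nu; apply: (H _ _ nu erefl (ltnSn _)).
elim: n nu => [|n ih] nu hd hn; first by rewrite ltn0 in hn.
constructor=> k hk.
have hkd : mdeg k = d by rewrite (bru_lt_mdeg hk).
apply: ih => //; rewrite -ltnS; apply: leq_trans hn; rewrite ltnS; apply: proper_card.
apply/properP; split.
  by apply/subsetP => m; rewrite !inE => /decide_emP h; apply/decide_emP; apply: bru_lt_trans hk.
have hkb : (mdeg k < d.+1)%N by rewrite hkd.
exists (BMultinom hkb); rewrite !inE; first exact/decide_emP.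
by apply/decide_emP; exact: bru_lt_irr.
Qed.

(* E_nu is obtained by applying to x^nu a product of factors Y_i - c that kills every
   E_k with k < nu. The list [L] of pairs (i, c) is kept arbitrary: a list of size
   independent of N yields convergence of E_(mu*0^m). *)
Definition isE nu E := (forall i, (0 < i <= N)%N -> YN i E = eig i nu *: E) /\ tri 1 nu 1 E.

Definition proj (L : seq (nat * Fld)) f :=
  foldr (fun ic f => YN ic.1 f - ic.2 *: f) f L.

Definition projc (L : seq (nat * Fld)) nu := \prod_(ic <- L) (eig ic.1 nu - ic.2).

Definition validL (L : seq (nat * Fld)) := forall ic, ic \in L -> (0 < ic.1 <= N)%N.

Lemma validL_cons ic L : validL (ic :: L) -> (0 < ic.1 <= N)%N /\ validL L.
Proof.
move=> h; split; first by apply: h; rewrite mem_head.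
by move=> jd hj; apply: h; rewrite in_cons hj orbT.
Qed.

Lemma linop_proj L : linop (proj L).
Proof.
elim: L => [|ic L ih] c f g; first by [].
exact: (linop_sub (linop_comp (@linop_YN N ic.1) ih) (linop_scale ic.2 ih) c f g).
Qed.

Lemma YN_comm i j f : (0 < i <= N)%N -> (0 < j <= N)%N -> YN i (YN j f) = YN j (YN i f).
Proof.
move=> hi hj; rewrite /YN !(linopZ (@linop_YL _ _)) YL_comm //.
Qed.

Lemma proj_YN i L f : (0 < i <= N)%N -> validL L -> YN i (proj L f) = proj L (YN i f).
Proof.
move=> hi; elim: L => //= ic L ih /validL_cons[h1 h2].
by rewrite (linopB (@linop_YN N i)) (linopZ (@linop_YN N i)) YN_comm // ih.
Qed.

Lemma proj_isE L nu E : isE nu E -> validL L -> proj L E = projc L nu *: E.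
Proof.
move=> [hE _]; elim: L => [|ic L ih] hL; rewrite /projc ?big_nil ?scale1r //= big_cons.
have [h1 h2] := validL_cons hL.
by rewrite ih // -/(projc _ _) (linopZ (@linop_YN N _)) hE // !scalerA -scalerBl mulrBl (mulrC (projc L nu)).
Qed.

(** By induction along the order: E_k is killed by the factor whose constant is its eigenvalue, and
    E_k differs from x^k by monomials that are already killed. *)
Lemma proj_kill L nu : validL L ->
  (forall k, bru_lt k nu -> exists E, isE k E) ->
  (forall k, bru_lt k nu -> exists2 ic, ic \in L & eig ic.1 k = ic.2) ->
  forall f, low 1 nu f -> proj L f = 0.
Proof.
move=> hL hE hs.
have hX k : bru_lt k nu -> proj L 'X_[k] = 0.
  elim/(well_founded_ind bru_lt_wf): k => k ih hk.
  have [E eE] := hE k hk; have [_ [g hg e]] := eE.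
  have : proj L E = 0.
    rewrite (proj_isE eE) //; have [ic hic eic] := hs k hk.
    by rewrite /projc (big_rem ic) //= eic subrr mul0r scale0r.
  rewrite e scale1r pact1 (linopD (@linop_proj L)).
  rewrite [X in _ + X = _](_ : _ = 0) ?addr0 //.
  rewrite (mpolyE g) (linop_sum (@linop_proj L)) big_seq big1 // => l.
  rewrite mcoeff_msupp => /hg[k' hk' ->]; rewrite pact1 (linopZ (@linop_proj L)) ih ?scaler0 //.
  exact: bru_lt_trans hk.
move=> f hf; rewrite (mpolyE f) (linop_sum (@linop_proj L)) big_seq big1 // => l.
by rewrite mcoeff_msupp => /hf[k hk ->]; rewrite pact1 (linopZ (@linop_proj L)) hX ?scaler0.
Qed.

Lemma tri_YN i nu c f : (0 < i <= N)%N -> tri 1 nu c f -> tri 1 nu (c * eig i nu) (YN i f).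
Proof.
move=> hi; apply: (tri_linop (@linop_YN N i)) => k; rewrite pact1; exact: YN_tri.
Qed.

Lemma tri_proj L nu c f : validL L -> tri 1 nu c f -> tri 1 nu (projc L nu * c) (proj L f).
Proof.
elim: L => [|ic L ih] hL hf; first by rewrite /projc big_nil mul1r.
have [h1 h2] := validL_cons hL; rewrite /projc big_cons /=.
have [g hg eg] := ih h2 hf; have [g' hg' eg'] := tri_YN h1 (ih h2 hf).
exists (g' - ic.2 *: g); first by apply: lowD; [exact: hg' | apply: lowN; apply: lowZ; exact: hg].
rewrite eg' eg scalerDr scalerA opprD addrACA -scalerBl -/(projc _ _); congr (_ *: _ + _).
by rewrite -[RHS]mulrA [RHS]mulrBl (mulrC (_ * c)).
Qed.

Lemma tri_X nu : tri 1 nu 1 'X_[nu].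
Proof. by exists 0; [exact: low0 | rewrite pact1 scale1r addr0]. Qed.

(** The product commutes with Y_i, and Y_i x^nu - eig x^nu is a combination of lower monomials,
    which the product kills. *)
Lemma isE_proj L nu : validL L ->
  (forall k, bru_lt k nu -> exists E, isE k E) ->
  (forall k, bru_lt k nu -> exists2 ic, ic \in L & eig ic.1 k = ic.2) ->
  projc L nu != 0 -> isE nu ((projc L nu)^-1 *: proj L 'X_[nu]).
Proof.
move=> hL hE hs hc; split; last first.
  have [g hg e] := tri_proj hL (tri_X nu).
  exists ((projc L nu)^-1 *: g); first exact: lowZ.
  by rewrite e scalerDr scalerA mulr1 mulVf.
move=> i hi; rewrite (linopZ (@linop_YN N i)) proj_YN //.
have [g hg e] := tri_YN hi (tri_X nu).
rewrite e (linopD (@linop_proj L)) (proj_kill hL hE hs hg) addr0 (linopZ (@linop_proj L)) mul1r.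
by rewrite pact1 !scalerA mulrC.
Qed.

Lemma isE_uniq L nu E : validL L ->
  (forall k, bru_lt k nu -> exists E, isE k E) ->
  (forall k, bru_lt k nu -> exists2 ic, ic \in L & eig ic.1 k = ic.2) ->
  projc L nu != 0 -> isE nu E -> E = (projc L nu)^-1 *: proj L 'X_[nu].
Proof.
move=> hL hE hs hc h; have [_ [g hg e]] := h.
have := proj_isE h hL; rewrite {1}e (linopD (@linop_proj L)) (proj_kill hL hE hs hg).
by rewrite addr0 scale1r pact1 => ->; rewrite scalerA mulVf // scale1r.
Qed.

Lemma bru_lt_ne k nu : bru_lt k nu -> exists2 i, (0 < i <= N)%N & mexp k i.-1 <> mexp nu i.-1.
Proof.
move=> hk; case: (pickP (fun i => k i != nu i)) => [i /eqP hi|h].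
  by exists i.+1; [exact: ltn_ord | rewrite -!mexpE].
case: (@bru_lt_irr N nu); rewrite -{1}(_ : k = nu) //.
by apply/mnmP => i; apply/eqP; move: (h i) => /negbFE.
Qed.

(** A crude separating list, enough for existence with a fixed number of variables. It enumerates
    compositions with N entries, so it is of no use for the limit. *)
Definition genL nu : seq (nat * Fld) :=
  [seq ic <- [seq (i, eig i (bmnm b)) | i <- iota 1 N, b <- enum {: 'X_{1..N < (mdeg nu).+1}}]
  | eig ic.1 nu != ic.2].

Lemma projc_neq0 L nu : (forall ic, ic \in L -> eig ic.1 nu != ic.2) -> projc L nu != 0.
Proof.
move=> h; rewrite /projc prodf_seq_neq0; apply/allP => ic hic /=.
by rewrite subr_eq0 h.
Qed.

Lemma genL_valid nu : validL (genL nu).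
Proof.
move=> ic; rewrite mem_filter => /andP[_ /allpairsP[[i b] /= [hi _ ->]]] /=.
by move: hi; rewrite mem_iota; lia.
Qed.

Lemma genL_sep nu k : bru_lt k nu -> exists2 ic, ic \in genL nu & eig ic.1 k = ic.2.
Proof.
move=> hk; have [i hi hne] := bru_lt_ne hk.
have hd : (mdeg k < (mdeg nu).+1)%N by rewrite (bru_lt_mdeg hk).
exists (i, eig i k) => //; rewrite mem_filter; apply/andP; split.
  by apply/eqP => /eig_inj e; apply: hne.
apply/allpairsP; exists (i, BMultinom hd); split=> //=; last by rewrite mem_enum.
by rewrite mem_iota; lia.
Qed.

Lemma genL_neq0 nu : projc (genL nu) nu != 0.
Proof. by apply: projc_neq0 => ic; rewrite mem_filter => /andP[]. Qed.

Lemma isE_ex nu : exists E, isE nu E.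
Proof.
elim/(well_founded_ind bru_lt_wf): nu => nu ih; eexists.
by apply: (isE_proj (@genL_valid nu) ih (@genL_sep nu) (genL_neq0 nu)).
Qed.

Lemma tri_coeff nu c f : tri 1 nu c f -> f@_nu = c.
Proof.
move=> [g hg ->]; rewrite mcoeffD mcoeffZ mcoeffX pact1 eqxx mulr1.
have [->|n] := eqVneq (g@_nu) 0; first by rewrite addr0.
by have [k hk e] := hg _ n; case: (@bru_lt_irr N nu); rewrite {1}e pact1.
Qed.

Lemma is_EmacP nu E : is_Emac nu E <-> isE nu E.
Proof.
split=> [[hY [h1 hs]]|[hY ht]].
  have ht : tri 1 nu 1 E.
    exists (E - 'X_[nu]); last by rewrite pact1 scale1r addrC subrK.
    move=> l; rewrite mcoeffB mcoeffX; case: (nu =P l) => [<-|ne].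
      by rewrite h1 subrr eqxx.
    by rewrite subr0 => /hs[e|h]; [case: ne | exists l; rewrite ?pact1].
  (* [is_Emac] leaves the eigenvalue unspecified; the coefficient of x^nu identifies it. *)
  split=> // i hi; have [a] := hY i hi; rewrite YopE => e.
  have e' : YN i E = (tt_ ^+ N * a) *: E by rewrite /YN e scalerA.
  rewrite e'; congr (_ *: _).
  have := tri_coeff (tri_YN hi ht); rewrite e' mcoeffZ h1 mulr1 => ->.
  by rewrite mul1r.
split; [|split].
- move=> i hi; exists (tt_ ^- N * eig i nu); rewrite YopE -scalerA -hY // /YN scalerA mulVf ?scale1r //.
  by rewrite expf_neq0 // tt_neq0.
- exact: tri_coeff.
- move=> l; have [g hg ->] := ht; rewrite mcoeffD mcoeffZ mcoeffX pact1.
  case: (nu =P l) => [->|_]; first by left.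
  by rewrite mulr0 add0r => /hg[k hk ->]; right; rewrite pact1.
Qed.

Lemma Emac_isE nu : isE nu (Emac nu).
Proof.
apply/is_EmacP; have [E /is_EmacP hE] := isE_ex nu.
by apply: (choose_spec 0); exists E.
Qed.

Lemma Emac_proj L nu : validL L ->
  (forall k, bru_lt k nu -> exists2 ic, ic \in L & eig ic.1 k = ic.2) ->
  projc L nu != 0 -> Emac nu = (projc L nu)^-1 *: proj L 'X_[nu].
Proof.
by move=> h1 h2 h3; apply: isE_uniq => //; [move=> k _; exact: isE_ex | exact: Emac_isE].
Qed.

End Macdonald.

(** * The t-adic topology *)

Lemma ttn_neq0 n : tt_ ^+ n != 0.
Proof. by apply: expf_neq0; exact: tt_neq0. Qed.

Lemma qt_neq0 a b : qq_ ^+ a * tt_ ^+ b != 0.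
Proof. by apply: mulf_neq0; [apply: expf_neq0; exact: qq_neq0 | exact: ttn_neq0]. Qed.

Definition tofr_rm : {rmorphism {poly {poly rat}} -> Fld} := @FracField.tofrac {poly {poly rat}}.

Lemma tofrE x : tofr x = tofr_rm x. Proof. by []. Qed.

Lemma tofr_eq0 x : (tofr x == 0) = (x == 0).
Proof. exact: tofrac_eq0. Qed.

Lemma frac_repr (R : idomainType) (x : {fraction R}) :
  exists a b : R, b != 0 /\ x = FracField.tofrac a / FracField.tofrac b.
Proof.
elim/quotW: x => x; exists x.1, x.2; split; first exact: denom_ratioP.
have nb : FracField.tofrac x.2 != 0 by rewrite tofrac_eq0 denom_ratioP.
apply: (mulIf nb); rewrite divfK //; unlock FracField.tofrac; rewrite -[LHS]FracField.pi_mul.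
apply/eqmodP; rewrite /= FracField.equivfE /FracField.mulf /=.
by rewrite !numden_Ratio ?(oner_neq0, mulr1, mul1r, denom_ratioP) // mulrC.
Qed.

Lemma tofr_repr (x : Fld) : exists a b, b != 0 /\ x = tofr a / tofr b.
Proof. exact: frac_repr. Qed.

Lemma poly_Xfactor (p : {poly {poly rat}}) : p != 0 ->
  exists v (q : {poly {poly rat}}), q`_0 != 0 /\ p = q * 'X^v.
Proof.
move=> p0; have [v [q hq e]] := multiplicity_XsubC p 0.
exists v, q; rewrite e subr0; split=> //.
by move: hq; rewrite p0 /= /root horner_coef0.
Qed.

Lemma nz0 (b : {poly {poly rat}}) : b`_0 != 0 -> tofr b != 0.
Proof. by apply: contraNneq => /eqP; rewrite tofr_eq0 => /eqP ->; rewrite coef0. Qed.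

Lemma fracD (K : fieldType) (s a b a' b' : K) : b != 0 -> b' != 0 ->
  s * (a / b) + s * (a' / b') = s * ((a * b' + a' * b) / (b * b')).
Proof. by move=> h h'; field; rewrite h h'. Qed.

Lemma tsmall0 N : tsmall N 0.
Proof. by exists 0, 1; rewrite coefC oner_neq0 !tofrE rmorph0 mul0r mulr0. Qed.

Lemma tsmallD N x y : tsmall N x -> tsmall N y -> tsmall N (x + y).
Proof.
move=> [a [b [b0 ->]]] [a' [b' [b0' ->]]]; exists (a * b' + a' * b), (b * b'); split.
  by rewrite coef0M mulf_neq0.
by rewrite fracD ?nz0 // !tofrE rmorphD !rmorphM.
Qed.

Lemma tsmallM N M x y : tsmall N x -> tsmall M y -> tsmall (N + M) (x * y).
Proof.
move=> [a [b [b0 ->]]] [a' [b' [b0' ->]]]; exists (a * a'), (b * b'); split.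
  by rewrite coef0M mulf_neq0.
by rewrite !tofrE !rmorphM mulrACA -exprD mulf_div.
Qed.

Lemma tsmall_tofr a : tsmall 0 (tofr a).
Proof. by exists a, 1; rewrite coefC oner_neq0 expr0 mul1r !tofrE rmorph1 divr1. Qed.

Lemma tsmall_tn N : tsmall N (tt_ ^+ N).
Proof. by exists 1, 1; rewrite coefC oner_neq0 !tofrE rmorph1 divr1 mulr1. Qed.

Lemma tsmall_le N M x : (M <= N)%N -> tsmall N x -> tsmall M x.
Proof.
move=> h; rewrite -{1}(subnK h) => -[a [b [b0 ->]]].
have h1 : tsmall M (tt_ ^+ M * (tofr a / tofr b)) by exists a, b.
have := tsmallM (tsmall_tn (N - M)) h1; rewrite exprD mulrA.
move=> [a' [b' [b0' ->]]]; exists ('X^(N - M) * a'), b'; split => //.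
by rewrite !tofrE rmorphM rmorphXn exprD -!tofrE -/tt_; rewrite [_ ^+ (N - M) * _]mulrC -!mulrA.
Qed.

Lemma tsmallN N x : tsmall N x -> tsmall N (- x).
Proof.
by move=> h; rewrite -mulN1r -[N]add0n; apply: tsmallM h; rewrite -[1](rmorph1 tofr_rm) -rmorphN -tofrE; exact: tsmall_tofr.
Qed.

Lemma tsmallB N x y : tsmall N x -> tsmall N y -> tsmall N (x - y).
Proof. by move=> h1 h2; apply: tsmallD => //; apply: tsmallN. Qed.

Lemma tbounded x : exists M, tsmall 0 (tt_ ^+ M * x).
Proof.
have [a [b [b0 ->]]] := tofr_repr x; have [v [b' [b0' e]]] := poly_Xfactor b0.
exists v, a, b'; split => //; rewrite expr0 mul1r e !tofrE rmorphM rmorphXn -/tt_ invfM.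
by rewrite mulrC -mulrA; congr (_ * _); rewrite -mulrA mulVf ?mulr1 // expf_neq0 // tt_neq0.
Qed.

Lemma tsmall_mulc N x : exists M, forall y, tsmall M y -> tsmall N (x * y).
Proof.
have [M hM] := tbounded x; exists (M + N)%N => y [a [b [b0 ->]]].
have hN : tsmall N (tt_ ^+ N * (tofr a / tofr b)) by exists a, b.
have -> : x * (tt_ ^+ (M + N) * (tofr a / tofr b)) =
    tt_ ^+ M * x * (tt_ ^+ N * (tofr a / tofr b)).
  by rewrite exprD -(mulrA (tt_ ^+ M)) mulrCA mulrA.
exact: tsmallM hM hN.
Qed.

Lemma tsmall_eq0 x : (forall N, tsmall N x) -> x = 0.
Proof.
move=> h; have [a [b [b0 e]]] := tofr_repr x.
have [a0|a0] := eqVneq a 0; first by rewrite e a0 tofrE rmorph0 mul0r.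
have [v [a1 [a10 ea]]] := poly_Xfactor a0.
(* With v the order of t in the numerator, one more power of t gives a1 b' = t a' b, whose constant
   terms disagree. *)
have [a' [b' [b0' e']]] := h v.+1.
have : tofr (a1 * b') = tofr ('X * a' * b).
  have nb : tofr b != 0 by rewrite tofr_eq0.
  have nb' := nz0 b0'.
  have nt := ttn_neq0 v.
  apply: (mulfI nt).
  have : tofr a * tofr b' = tt_ ^+ v.+1 * tofr a' * tofr b.
    have := e'; rewrite e => /(congr1 (fun z => z * (tofr b * tofr b'))).
    rewrite mulrA divfK // => ->.
    by rewrite -!mulrA; congr (_ * (_ * _)); rewrite mulrC -mulrA mulfV // mulr1.
  rewrite ea exprS !tofrE !rmorphM rmorphXn -!tofrE -/tt_ => e2.
  by rewrite mulrA (mulrC _ (tofr a1)) e2 -!mulrA mulrCA.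
move=> /tofr_inj /(congr1 (fun p : {poly {poly rat}} => p`_0)).
rewrite !coef0M coefX /= !mul0r => /eqP; rewrite mulf_eq0 (negbTE a10) (negbTE b0') //.
Qed.

Lemma tconv_ext a b l : (exists K, forall k, (K <= k)%N -> a k = b k) -> tconv a l -> tconv b l.
Proof.
move=> [K h] ha N; have [K' hK'] := ha N; exists (maxn K K') => k hk.
by rewrite -h; [apply: hK'; lia | lia].
Qed.

Lemma tconv_const c : tconv (fun _ => c) c.
Proof. by move=> N; exists 0%N => k _; rewrite subrr; exact: tsmall0. Qed.

Lemma tconvD a b l m : tconv a l -> tconv b m -> tconv (fun k => a k + b k) (l + m).
Proof.
move=> ha hb N; have [K hK] := ha N; have [K' hK'] := hb N.
exists (maxn K K') => k hk; rewrite opprD addrACA; apply: tsmallD; [apply: hK|apply: hK']; lia.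
Qed.

Lemma tconvM a b l m : tconv a l -> tconv b m -> tconv (fun k => a k * b k) (l * m).
Proof.
move=> ha hb N.
have [M1 hM1] := tsmall_mulc N l; have [M2 hM2] := tsmall_mulc N m.
have [K hK] := ha (maxn N M2); have [K' hK'] := hb (maxn N M1).
exists (maxn K K') => k hk.
have h1 : tsmall (maxn N M2) (a k - l) by apply: hK; lia.
have h2 : tsmall (maxn N M1) (b k - m) by apply: hK'; lia.
have -> : a k * b k - l * m = (a k - l) * (b k - m) + (l * (b k - m) + m * (a k - l)) by ring.
apply: tsmallD; last first.
  by apply: tsmallD; [apply: hM1 | apply: hM2]; [apply: tsmall_le h2 | apply: tsmall_le h1]; lia.
by apply: (@tsmall_le (N + 0)); [lia | apply: tsmallM; [apply: tsmall_le h1 | apply: tsmall_le h2]; lia].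
Qed.

Lemma tconvN a l : tconv a l -> tconv (fun k => - a k) (- l).
Proof.
move=> h; have := tconvM (tconv_const (-1)) h; rewrite mulN1r; apply: tconv_ext.
by exists 0%N => k _; rewrite mulN1r.
Qed.

Lemma tconvB a b l m : tconv a l -> tconv b m -> tconv (fun k => a k - b k) (l - m).
Proof. by move=> ha hb; apply: tconvD => //; apply: tconvN. Qed.

Lemma tconv_uniq a l m : tconv a l -> tconv a m -> l = m.
Proof.
move=> ha hb; apply/eqP; rewrite -subr_eq0; apply/eqP/tsmall_eq0 => N.
have [K hK] := ha N; have [K' hK'] := hb N.
have -> : l - m = (a (maxn K K') - m) - (a (maxn K K') - l) by rewrite opprB [RHS]addrC addrA subrK.
by apply: tsmallB; [apply: hK' | apply: hK]; lia.
Qed.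

Lemma tconv_tn (e : nat -> nat) : (forall N, exists K, forall k, (K <= k)%N -> (N <= e k)%N) ->
  tconv (fun k => tt_ ^+ e k) 0.
Proof.
move=> h N; have [K hK] := h N; exists K => k /hK hk; rewrite subr0.
exact: tsmall_le hk (tsmall_tn _).
Qed.

Lemma tsmall_inv1 x : tsmall 1 x -> tsmall 0 (1 + x)^-1 /\ 1 + x != 0.
Proof.
move=> [a [b [b0 ->]]].
have h0 : (b + 'X * a)`_0 != 0 by rewrite coefD coef0M coefX mul0r addr0.
have e : 1 + tt_ ^+ 1 * (tofr a / tofr b) = tofr (b + 'X * a) / tofr b.
  have nb := nz0 b0.
  rewrite !tofrE rmorphD rmorphM -!tofrE -/tt_ mulrDl mulfV // expr1 mulrA //.
rewrite e; split; last by rewrite mulf_neq0 ?invr_eq0 ?nz0.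
by exists b, (b + 'X * a); split => //; rewrite expr0 mul1r invfM invrK mulrC.
Qed.

Lemma tconv0P a : tconv a 0 <-> forall N, exists K, forall k, (K <= k)%N -> tsmall N (a k).
Proof.
by split=> h N; have [K hK] := h N; exists K => k /hK; rewrite subr0.
Qed.

Lemma inv1_sub1 (K : fieldType) (x : K) : 1 + x != 0 -> (1 + x)^-1 - 1 = - (x * (1 + x)^-1).
Proof. by move=> h; field. Qed.

(** Dividing by the limit reduces the claim to sequences tending to 1, where 1 + x with x divisible
    by t is a unit of the valuation ring. *)
Lemma tconvV a l : l != 0 -> tconv a l -> tconv (fun k => (a k)^-1) l^-1.
Proof.
move=> l0 h.
have h1 : tconv (fun k => a k / l - 1) 0.
  have := tconvB (tconvM h (tconv_const l^-1)) (tconv_const 1).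
  by rewrite mulfV // subrr.
have h2 : tconv (fun k => (1 + (a k / l - 1))^-1 - 1) 0.
  apply: (proj2 (tconv0P _)) => N; have [K hK] := proj1 (tconv0P _) h1 (maxn N 1).
  exists K => k /hK; move: (a k / l - 1) => x hx.
  have [i1 i2] := tsmall_inv1 (tsmall_le (leq_maxr N 1) hx).
  rewrite inv1_sub1 //; apply: tsmallN; apply: (@tsmall_le (maxn N 1 + 0)); first by lia.
  exact: tsmallM.
have := tconvM (tconvD h2 (tconv_const 1)) (tconv_const l^-1).
have -> : (0 + 1) * l^-1 = l^-1 by rewrite add0r mul1r.
apply: tconv_ext; exists 0%N => k _ /=.
rewrite subrK addrC subrK invfM invrK -mulrA mulfV ?mulr1 //.
Qed.

(** * Stable families and Ion-Wu limits *)

Definition rs n k (f : {mpoly Fld[n]}) : {mpoly Fld[k]} := sv (fun j => xv k j) f.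
Arguments rs {n} k f.

Lemma restrE n k (f : {mpoly Fld[n]}) : restr k f = rs k f.
Proof. exact: substvE. Qed.

Lemma rs_rs n k l (f : {mpoly Fld[n]}) : (l <= k)%N -> rs l (rs k f) = rs l f.
Proof.
move=> h; rewrite /rs sv_comp; apply: eq_sv => j hj.
have [hk|hk] := boolP (0 < j <= k)%N; first by rewrite sv_xv.
by rewrite !xv0 ?sv0 //; lia.
Qed.

Lemma rs_id n (f : {mpoly Fld[n]}) : rs n f = f.
Proof. exact: sv_id. Qed.

Lemma linop_rs n k : linop (@rs n k).
Proof. exact: linop_sv. Qed.

Lemma rs_DL n k i (f : {mpoly Fld[n]}) : (i < k)%N -> (k <= n)%N -> rs k (DL i f) = DL i (rs k f).
Proof.
move=> ik kn; have [i0|i0] := posnP i; first by rewrite i0 !DL_out.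
apply: (@sv_DL _ _ _ _ _ 1); rewrite ?oner_neq0 ?scale1r //; try lia.
by move=> l hl n1 n2; rewrite sw_o //; lia.
Qed.

Lemma sw_DL N i j (f : {mpoly Fld[N]}) : (i.+1 < j)%N -> (j < N)%N ->
  sw j (DL i f) = DL i (sw j f).
Proof.
move=> hij hj; have [i0|i0] := posnP i; first by rewrite i0 !DL_out.
apply: (@sv_DL _ _ _ _ _ 1); rewrite ?oner_neq0 ?scale1r //; try lia.
- by rewrite /swapv; do 2 (case: eqP => [?|_]; first lia).
- by rewrite /swapv; do 2 (case: eqP => [?|_]; first lia).
- by move=> l hl n1 n2; rewrite /swapv; do 2?[case: eqP => ?]; rewrite sw_xv //; do ?[case: eqP => ?] => //; lia.
Qed.

(** * Degree bounds, required of elements of the graded inverse limit *)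

Lemma msizeM_bound N (p q : {mpoly Fld[N]}) a b :
  (msize p <= a.+1)%N -> (msize q <= b.+1)%N -> (msize (p * q) <= (a + b).+1)%N.
Proof.
move=> hp hq; have [->|p0] := eqVneq p 0; first by rewrite mul0r msize0.
have [->|q0] := eqVneq q 0; first by rewrite mulr0 msize0.
rewrite msizeM // -subn1; apply: leq_trans (leq_sub2r 1 (leq_add hp hq)) _; lia.
Qed.

Lemma msizeD_bound N (p q : {mpoly Fld[N]}) d :
  (msize p <= d)%N -> (msize q <= d)%N -> (msize (p + q) <= d)%N.
Proof. by move=> hp hq; apply: leq_trans (msizeD_le _ _) _; rewrite geq_max hp hq. Qed.

Lemma msizeN_bound N (p : {mpoly Fld[N]}) d : (msize p <= d)%N -> (msize (- p) <= d)%N.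
Proof. by rewrite msizeN. Qed.

Lemma msizeZ_bound N c (p : {mpoly Fld[N]}) d : (msize p <= d)%N -> (msize (c *: p) <= d)%N.
Proof. exact: leq_trans (msizeZ_le _ _). Qed.

Lemma msize_xv N j : (msize (xv N j) <= 2)%N.
Proof.
have [h|h] := boolP (0 < j <= N)%N; last by rewrite xv0 ?msize0 //; lia.
by case: j h => [|j] // h; rewrite (xv_ord (Ordinal h)) msizeX mdeg1.
Qed.

Lemma msize_sv n k (g : nat -> {mpoly Fld[k]}) (f : {mpoly Fld[n]}) :
  (forall j, (msize (g j) <= 2)%N) -> (msize (sv g f) <= msize f)%N.
Proof.
move=> hg; rewrite {1}(mpolyE f) (linop_sum (@linop_sv _ _ g)) big_seq.
apply: (big_ind (fun p => (msize p <= msize f)%N)).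
- by rewrite msize0.
- by move=> p q; exact: msizeD_bound.
move=> m /msize_mdeg_lt hm; rewrite svZ; apply: msizeZ_bound; apply: leq_trans hm.
rewrite sv_monom mdegE; apply: (big_ind2 (fun (p : {mpoly Fld[k]}) e => (msize p <= e.+1)%N)).
- by rewrite msize1.
- by move=> p a q b; exact: msizeM_bound.
move=> i _; elim: (m i) => [|e ih]; first by rewrite expr0 msize1.
by rewrite exprS; exact: (@msizeM_bound _ _ _ 1 e (hg _) ih).
Qed.

Lemma msize_rs n k (f : {mpoly Fld[n]}) : (msize (rs k f) <= msize f)%N.
Proof. by apply: msize_sv => j; exact: msize_xv. Qed.

Lemma msize_sw N i (f : {mpoly Fld[N]}) : (msize (sw i f) <= msize f)%N.
Proof. by apply: msize_sv => j; rewrite /swapv; do 2?case: ifP => _; exact: msize_xv. Qed.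

Lemma msize_omv N (f : {mpoly Fld[N]}) : (msize (omv f) <= msize f)%N.
Proof. by apply: msize_sv => j; case: ifP => _; [apply: msizeZ_bound|]; exact: msize_xv. Qed.

Lemma msize_xB N i : (0 < i < N)%N -> (1 < msize (xv N i - xv N i.+1))%N.
Proof.
case: i => [|i] // hi; have h1 : (i < N)%N by lia. have h2 : (i.+1 < N)%N by lia.
rewrite (xv_ord (Ordinal h1)) (xv_ord (Ordinal h2)).
rewrite -(mdeg1 (Ordinal h1)); apply: msize_mdeg_lt.
rewrite mcoeff_msupp mcoeffB !mcoeffXU eqxx.
have -> : (Ordinal h2 == Ordinal h1) = false by apply/eqP => -[]; lia.
by rewrite subr0 oner_neq0.
Qed.

Lemma msize_DL N i (f : {mpoly Fld[N]}) : (msize (DL i f) <= msize f)%N.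
Proof.
have [hi|hi] := boolP (0 < i < N)%N; last by rewrite DL_out.
have [->|n0] := eqVneq (DL i f) 0; first by rewrite msize0.
have [e|nf] := eqVneq f 0; first by rewrite e (linop0 (@linop_DL _ _)).
have := msizeM (xB_neq0 hi) n0; rewrite DL_char //.
have := msize_xB hi; case ef : (msize f) => [|d]; first by move/eqP: ef; rewrite msize_poly_eq0 (negbTE nf).
have hx j : (msize (xv N j) <= 2)%N by exact: msize_xv.
have ht : (msize ((tt_)%:MP : {mpoly Fld[N]}) <= 1)%N by rewrite msizeC; case: (_ != _).
have ht1 : (msize (1 - (tt_)%:MP : {mpoly Fld[N]}) <= 1)%N.
  by apply: msizeD_bound; [rewrite msize1 | exact: msizeN_bound].
have : (msize ((1 - (tt_)%:MP) * xv N i * f + ((tt_)%:MP * xv N i - xv N i.+1) * sw i f) <= (1 + d).+1)%N.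
  apply: msizeD_bound; apply: msizeM_bound; rewrite ?ef //.
  - exact: (@msizeM_bound _ _ _ 0 1).
  - by apply: msizeD_bound; [exact: (@msizeM_bound _ _ _ 0 1) | exact: msizeN_bound].
  - by rewrite -ef; exact: msize_sw.
move=> h3 h1 e; rewrite e -subn1 in h3.
by have := leq_trans (leq_sub2r 1 (leq_add h1 (leqnn (msize (DL i f))))) h3; rewrite addSn subn1.
Qed.

Lemma msize_DLi N i (f : {mpoly Fld[N]}) : (msize (DLi i f) <= msize f)%N.
Proof.
rewrite /DLi; case: ifP => // _; apply/msizeZ_bound/msizeD_bound; first exact: msize_DL.
exact/msizeN_bound/msizeZ_bound.
Qed.

Lemma msize_dch N l (f : {mpoly Fld[N]}) : (msize (Tinv_chain l f) <= msize f)%N.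
Proof.
elim: l f => // i l ih f; rewrite -[Tinv_chain _ _]/(Tinv_chain l (DLi i f)).
exact: leq_trans (ih _) (msize_DLi _ _).
Qed.

(** Symmetry is asked only for adjacent transpositions, the form in which it interacts with the T_i;
    [Pas_inPk] recovers all permutations. *)
Definition Pas (n : nat) (b : Pseq) :=
  [/\ forall k, rs k (b k.+1) = b k,
      exists d, forall k, (msize (b k) <= d)%N &
      forall k i, (n < i)%N -> (i < k)%N -> sw i (b k) = b k].

Definition isPas b := exists n, Pas n b.

Lemma Pas_le n n' b : (n <= n')%N -> Pas n b -> Pas n' b.
Proof. by move=> h [h1 h2 h3]; split=> // k i hi; apply: h3; lia. Qed.

Lemma Pas_rs n b k l : Pas n b -> (k <= l)%N -> rs k (b l) = b k.
Proof.
move=> [h _ _] /subnK <-; elim: (l - k)%N => [|m ih]; first exact: rs_id.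
by rewrite -[RHS]ih -(h (m + k)%N) rs_rs // leq_addl.
Qed.

Lemma isPas0 : isPas Pzero.
Proof.
exists 0%N; split.
- by move=> k; rewrite (linop0 (@linop_rs _ _)).
- by exists 0%N => k; rewrite msize0.
- by move=> k i _ _; exact: sv0.
Qed.

Lemma isPasD b c : isPas b -> isPas c -> isPas (fun k => b k + c k).
Proof.
move=> [n hb] [n' hc].
have [h1 [d h2] h3] := Pas_le (leq_maxl n n') hb.
have [h1' [d' h2'] h3'] := Pas_le (leq_maxr n n') hc.
exists (maxn n n'); split.
- by move=> k; rewrite (linopD (@linop_rs _ _)) h1 h1'.
- exists (maxn d d') => k; apply: msizeD_bound.
    by apply: leq_trans (h2 k) _; exact: leq_maxl.
  by apply: leq_trans (h2' k) _; exact: leq_maxr.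
- by move=> k i hi hk; rewrite /sw svD -!/(sw _ _) h3 // h3'.
Qed.

Lemma isPasZ a b : isPas b -> isPas (fun k => a *: b k).
Proof.
move=> [n [h1 [d h2] h3]]; exists n; split.
- by move=> k; rewrite (linopZ (@linop_rs _ _)) h1.
- by exists d => k; apply: msizeZ_bound.
- by move=> k i hi hk; rewrite /sw svZ -/(sw _ _) h3.
Qed.

(** Constructions from Y_1 are stable only from some K on; the earlier members are filled in by
    restricting the K-th one. *)
Lemma Pas_ext n K (F : forall k, {mpoly Fld[k]}) :
  (forall k, (K <= k)%N -> rs k (F k.+1) = F k) ->
  (exists d, forall k, (K <= k)%N -> (msize (F k) <= d)%N) ->
  (forall k i, (K <= k)%N -> (n < i)%N -> (i < k)%N -> sw i (F k) = F k) ->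
  exists2 b, Pas (maxn n K) b & forall k, (K <= k)%N -> b k = F k.
Proof.
move=> h1 [d h2] h3; exists (fun k => if (K <= k)%N then F k else rs k (F K)); last first.
  by move=> k ->.
split.
- move=> k; case: (leqP K k) => h; first by rewrite (leq_trans h (leqnSn k)) h1.
  case: (leqP K k.+1) => h'; last by rewrite rs_rs.
  by have <- : K = k.+1 by lia.
- exists d => k; case: (leqP K k) => h; first exact: h2.
  by apply: leq_trans (msize_rs _ _) (h2 _ _).
- by move=> k i hi hk; case: (leqP K k) => h; [apply: h3 => //|]; lia.
Qed.

Lemma pseq_ext (f g : Pseq) : (forall k, f k = g k) -> f = g.
Proof. exact: functional_extensionality_dep. Qed.

(** * From adjacent transpositions to all permutations of the later variables *)

Lemma msym_Xi k (s : 'S_k) (i : 'I_k) : msym s ('X_i : {mpoly Fld[k]}) = 'X_(s i).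
Proof.
rewrite msymX; congr 'X_[_]; apply/mnmP => l; rewrite mnmE !mnm1E.
by rewrite -(inj_eq (@perm_inj _ s)) permKV.
Qed.

Lemma sw_msym k (i j : 'I_k) (f : {mpoly Fld[k]}) : j = i.+1 :> nat ->
  sw j f = msym (perm.tperm i j) f.
Proof.
move=> hij; have hj : (0 < j < k)%N by rewrite ltn_ord hij.
elim/mpoly_ind: f => [c|l|f f' e e'|f f' e e'].
- by rewrite /sw svC -[c%:MP]mulr1 mul_mpolyC msymZ msym1.
- rewrite msym_Xi -xv_ord; case: perm.tpermP => [->|->|n1 n2].
  + by rewrite -hij sw_l // xv_ord.
  + by rewrite sw_r // hij xv_ord.
  + rewrite sw_o ?xv_ord // => e; [apply: n1|apply: n2]; apply: val_inj; move: e; rewrite /= ?hij.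
      by case.
    by rewrite -hij => -[].
- by rewrite /sw svD msymD -!/(sw _ _) e e'.
- by rewrite /sw svM msymM -!/(sw _ _) e e'.
Qed.

Lemma msym_tperm_fix k n (f : {mpoly Fld[k]}) :
  (forall i, (n < i)%N -> (i < k)%N -> sw i f = f) ->
  forall i j : 'I_k, (n <= i)%N -> (i < j)%N -> msym (perm.tperm i j) f = f.
Proof.
move=> h i j hi hij.
move ed : (j - i.+1)%N => d; elim: d j hij ed => [|d ih] j hij ed.
  rewrite -sw_msym ?h //; last by lia.
  by have := ltn_ord j; lia.
have hj' : (j.-1 < k)%N by have := ltn_ord j; lia.
pose j' := Ordinal hj'.
have ejj : j = j'.+1 :> nat by rewrite /=; lia.
(* Conjugating by the adjacent transposition of j - 1 and j brings the two points one step
   closer. *)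
have -> : perm.tperm i j = (perm.tperm j' j * perm.tperm i j' * perm.tperm j' j)%g.
  have nj : j' != j by apply/eqP => /(congr1 val) /= e; move: e ejj; rewrite /=; lia.
  have ni : i != j' by apply/eqP => /(congr1 val) /= e; move: e ed; lia.
  have nij : i != j by apply/eqP => e; rewrite e ltnn in hij.
  have := perm.tpermJ i j' (perm.tperm j' j); rewrite perm.tpermD 1?eq_sym // 1?eq_sym // perm.tpermL.
  by move=> <-; rewrite /conjg perm.tpermV mulgA.
rewrite !msymMm -!(sw_msym _ ejj) h; [|by rewrite ejj /=; lia|exact: ltn_ord].
rewrite ih /=; [|lia|lia].
by rewrite h //; lia.
Qed.

Lemma msym_fix k n (f : {mpoly Fld[k]}) :
  (forall i, (n < i)%N -> (i < k)%N -> sw i f = f) ->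
  forall s : 'S_k, (forall i : 'I_k, (i < n)%N -> s i = i) -> msym s f = f.
Proof.
move=> h s; move ed : #|[pred x | s x != x]| => d.
elim/ltn_ind: d s ed => d ih s ed hs.
case: (pickP (fun x => s x != x)) => [x hx|h0]; last first.
  rewrite (_ : s = 1%g) ?msym1m //; apply/permP => x; rewrite perm1.
  by apply/eqP; move: (h0 x) => /negbFE.
(* [s'] fixes x and every fixed point of [s], so it moves fewer points. *)
pose y := s x; pose s' := (s * perm.tperm x y)%g.
have es : s = (s' * perm.tperm x y)%g by rewrite /s' -mulgA perm.tperm2 mulg1.
have s'x : s' x = x by rewrite /s' permM -/y perm.tpermR.
have s'z z : s z = z -> s' z = z.
  move=> hz; have nx : x != z by apply/eqP => e; rewrite e hz eqxx in hx.
  have ny : y != z.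
    apply/eqP => e; case/negP: hx; apply/eqP; apply: (@perm_inj _ s).
    by rewrite -/y e hz.
  by rewrite /s' permM hz perm.tpermD.
have xn : (n <= x)%N by rewrite leqNgt; apply: contra hx => /hs ->.
have yn : (n <= y)%N.
  by rewrite leqNgt; apply: contra hx => /hs e; apply/eqP; apply: (@perm_inj _ s).
have e1 : msym s' f = f.
  apply: (ih #|[pred z | s' z != z]|) => //.
    rewrite -ed; apply: proper_card; apply/properP; split.
      by apply/subsetP => z; rewrite !inE; apply: contra => /eqP /s'z ->.
    by exists x; rewrite !inE // s'x eqxx.
  by move=> i /hs /s'z.
rewrite es msymMm e1; have [hxy|hxy|/val_inj e] := ltngtP x y.
- exact: (msym_tperm_fix h).
- by rewrite perm.tpermC; exact: (msym_tperm_fix h).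
- by case/negP: hx; apply/eqP; exact: (esym e).
Qed.

Lemma Pas_inPk n b : Pas n b -> inPk n b.
Proof.
move=> hb; have [h1 h2 h3] := hb; split.
  by split=> // k; rewrite restrE.
by move=> k s hs; apply: (@msym_fix k n) => // i hi hk; apply: h3.
Qed.

Lemma isPas_inPas b : isPas b -> inPas b.
Proof. by move=> [n /Pas_inPk h]; exists n. Qed.

(** * Coefficientwise convergence and uniqueness of Ion-Wu limits *)

Lemma tconv_sum N (a : nat -> nat -> Fld) l : (forall i, (i < N)%N -> tconv (a i) (l i)) ->
  tconv (fun k => \sum_(i < N) a i k) (\sum_(i < N) l i).
Proof.
elim: N => [|N ih] h.
  rewrite big_ord0; apply: tconv_ext (tconv_const 0).
  by exists 0%N => k _; rewrite big_ord0.
rewrite big_ord_recr /=.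
have h1 : forall i, (i < N)%N -> tconv (a i) (l i) by move=> i hi; apply: h; lia.
have := tconvD (ih h1) (h N (ltnSn N)).
by apply: tconv_ext; exists 0%N => k _; rewrite big_ord_recr.
Qed.

Lemma inv_conv_coeff hs h n m : inv_conv hs h ->
  tconv (fun k => (rs n (hs k))@_m) ((h n)@_m).
Proof.
move=> [_ H]; have [K hK] := H n; apply: tconv_ext (tconv_const _).
by exists K => k hk; rewrite -restrE hK.
Qed.

(** A sequence has many Ion-Wu decompositions, but the t-adic limit of each coefficient does not
    depend on them; this makes the limit unique. *)
Lemma IW_coeff fs f n m : IWconv fs f -> tconv (fun k => (rs n (fs k))@_m) ((f n)@_m).
Proof.
move=> [N [hs [h [a [gs [al [g [e [hh [hg ->]]]]]]]]]].
rewrite mcoeffD raddf_sum /=.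
under eq_bigr do rewrite mcoeffZ.
have h1 : tconv (fun k => \sum_(i < N) a i k * (rs n (gs i k))@_m) (\sum_(i < N) al i * (g i n)@_m).
  apply: (@tconv_sum N (fun i k => a i k * (rs n (gs i k))@_m) (fun i => al i * (g i n)@_m)).
  by move=> i hi; have [h2 _ h3] := hg i hi; apply: tconvM => //; apply: inv_conv_coeff.
have := tconvD (inv_conv_coeff m hh) h1; apply: tconv_ext; exists 0%N => k _.
rewrite e (linopD (@linop_rs _ _)) mcoeffD (linop_sum (@linop_rs _ _)) raddf_sum /=.
by congr (_ + _); apply: eq_bigr => i _; rewrite (linopZ (@linop_rs _ _)) mcoeffZ.
Qed.

Lemma IW_uniq fs f g : IWconv fs f -> IWconv fs g -> f = g.
Proof.
move=> hf hg; apply: pseq_ext => n; apply/mpolyP => m.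
exact: tconv_uniq (IW_coeff m hf) (IW_coeff m hg).
Qed.

Lemma IW_ext fs fs' f : (exists K, forall k, (K <= k)%N -> fs k = fs' k) ->
  IWconv fs f -> IWconv fs' f.
Proof.
move=> [K hK] [N [hs [h [a [gs [al [g [e [[hi hh] [hg ef]]]]]]]]]].
(* The eventually vanishing difference is absorbed into the part without scalars. *)
exists N, (fun k => hs k + (fs' k - fs k)), h, a, gs, al, g; split; [|split; [|split; [exact: hg | exact: ef]]].
- by move=> k; rewrite addrAC -e addrC subrK.
- split; [exact: hi | move=> n]; have [K' hK'] := hh n; exists (maxn K K') => k hk.
  by rewrite -hK; [rewrite subrr addr0; apply: hK'; lia | lia].
Qed.

Lemma IWlimE fs f : inPas f -> IWconv fs f -> IWlim fs = f.
Proof.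
move=> hf hc; have h : exists f, inPas f /\ IWconv fs f by exists f.
by have [_ h2] := choose_spec Pzero h; apply: IW_uniq h2 hc.
Qed.

(* Sequences that are eventually finite combinations of elements of P_as with
   t-adically convergent coefficients; the second argument is their limit. *)
Inductive Cseq : (forall k, {mpoly Fld[k]}) -> Pseq -> Prop :=
| Cseq0 fs : (exists K, forall k, (K <= k)%N -> fs k = 0) -> Cseq fs Pzero
| CseqS fs fs' f a al b : Cseq fs f -> tconv a al -> isPas b ->
    (exists K, forall k, (K <= k)%N -> fs' k = fs k + a k *: b k) ->
    Cseq fs' (fun k => f k + al *: b k).

Lemma Cseq_ext fs fs' f : (exists K, forall k, (K <= k)%N -> fs k = fs' k) ->
  Cseq fs f -> Cseq fs' f.
Proof.
move=> [K hK] hf; case: hf hK => [gs [K' h]|gs gs' g a al b h1 h2 h3 [K' h4]] hK.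
  by apply: Cseq0; exists (maxn K K') => k hk; rewrite -hK; [apply: h; lia | lia].
by apply: CseqS h1 h2 h3 _; exists (maxn K K') => k hk; rewrite -hK; [apply: h4; lia | lia].
Qed.

Lemma Cseq_isPas fs f : Cseq fs f -> isPas f.
Proof.
by elim=> [gs _|gs gs' g a al b _ ih _ hb _]; [exact: isPas0 | apply: isPasD ih (isPasZ al hb)].
Qed.

Lemma Cseq_b a al b : tconv a al -> isPas b -> Cseq (fun k => a k *: b k) (fun k => al *: b k).
Proof.
move=> ha hb; have h0 : Cseq (fun k => 0) Pzero by apply: Cseq0; exists 0%N.
have -> : (fun k => al *: b k) = (fun k => Pzero k + al *: b k).
  by apply: pseq_ext => k; rewrite add0r.
by apply: CseqS h0 ha hb _; exists 0%N => k _; rewrite add0r.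
Qed.

Lemma Cseq_Pas b : isPas b -> Cseq b b.
Proof.
move=> hb; have := Cseq_b (tconv_const 1) hb.
rewrite (_ : (fun k => 1 *: b k) = b) //.
by apply: pseq_ext => k; rewrite scale1r.
Qed.

Lemma CseqD fs gs f g : Cseq fs f -> Cseq gs g ->
  Cseq (fun k => fs k + gs k) (fun k => f k + g k).
Proof.
move=> hf; elim=> [{}gs [K h]|hs hs' h a al b _ ih ha hb [K e]].
  rewrite (_ : (fun k => f k + Pzero k) = f).
    by apply: Cseq_ext hf; exists K => k hk; rewrite h // addr0.
  by apply: pseq_ext => k; rewrite addr0.
rewrite (_ : (fun k => f k + (h k + al *: b k)) = (fun k => (f k + h k) + al *: b k)).
  by apply: CseqS ih ha hb _; exists K => k hk; rewrite e // addrA.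
by apply: pseq_ext => k; rewrite addrA.
Qed.

Lemma CseqZ c cl fs f : tconv c cl -> Cseq fs f ->
  Cseq (fun k => c k *: fs k) (fun k => cl *: f k).
Proof.
move=> hc; elim=> [{}fs [K h]|gs gs' g a al b _ ih ha hb [K e]].
  rewrite (_ : (fun k => cl *: Pzero k) = Pzero).
    by apply: Cseq0; exists K => k hk; rewrite h // scaler0.
  by apply: pseq_ext => k; rewrite scaler0.
rewrite (_ : (fun k => cl *: (g k + al *: b k)) = (fun k => cl *: g k + (cl * al) *: b k)).
  by apply: CseqS ih (tconvM hc ha) hb _; exists K => k hk; rewrite e // scalerDr scalerA.
by apply: pseq_ext => k; rewrite scalerDr scalerA.
Qed.

Lemma isPas_inPinf b : isPas b -> inPinf b.
Proof.
by move=> [n [h1 h2 h3]]; split=> // k; rewrite restrE.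
Qed.

Lemma inv_conv_Pas b : isPas b -> inv_conv b b.
Proof.
move=> hb; split; first exact: isPas_inPinf.
have [n hb'] := hb; move=> l; exists l => k hk.
by rewrite restrE (Pas_rs hb').
Qed.

Lemma Cseq_IW fs f : Cseq fs f -> IWconv fs f.
Proof.
elim=> [{}fs [K h]|gs gs' g a al b _ ih ha hb [K e]].
  apply: (@IW_ext Pzero); first by exists K => k hk; rewrite h.
  exists 0%N, Pzero, Pzero, (fun _ _ => 0), (fun _ => Pzero), (fun _ => 0), (fun _ => Pzero).
  split; [|split; [|split]].
  - by move=> k; rewrite big_ord0 addr0.
  - by apply: inv_conv_Pas; exact: isPas0.
  - by [].
  - by apply: pseq_ext => k; rewrite big_ord0 addr0.
have [N [hs [h [a' [gs0 [al' [g' [e' [hh [hg ef]]]]]]]]]] := ih.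
apply: (@IW_ext (fun k => gs k + a k *: b k)); first by exists K => k hk; rewrite e.
exists N.+1, hs, h, (fun i => if (i < N)%N then a' i else a),
  (fun i => if (i < N)%N then gs0 i else b), (fun i => if (i < N)%N then al' i else al),
  (fun i => if (i < N)%N then g' i else b); split; [|split; [exact: hh|split]].
- move=> k; rewrite big_ord_recr /= ltnn e' -addrA; congr (_ + (_ + _)).
  by apply: eq_bigr => i _; rewrite ltn_ord.
- move=> i hi; case: ifP => hN; first exact: hg.
  by split; [exact: inv_conv_Pas | exact: isPas_inPas | exact: ha].
- apply: pseq_ext => k; rewrite big_ord_recr /= ltnn ef -addrA; congr (_ + (_ + _)).
  by apply: eq_bigr => i _; rewrite ltn_ord.
Qed.

Lemma Cseq_lim fs f : Cseq fs f -> IWlim fs = f.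
Proof. by move=> h; apply: IWlimE (Cseq_IW h); apply/isPas_inPas/(Cseq_isPas h). Qed.

Lemma Cseq_uniq fs f g : Cseq fs f -> Cseq fs g -> f = g.
Proof. by move=> hf hg; apply: IW_uniq (Cseq_IW hf) (Cseq_IW hg). Qed.

(** * The limit Cherednik operators *)

Definition zero_at N i (f : {mpoly Fld[N]}) := sv (fun j => if j == i then 0 else xv N j) f.

Lemma x1zeroE N (f : {mpoly Fld[N]}) : x1zero f = zero_at 1 f.
Proof. exact: substvE. Qed.

Lemma linop_zr N i : linop (@zero_at N i).
Proof. exact: linop_sv. Qed.

(** If f vanishes at x_i = 0, then s_i f vanishes at x_(i+1) = 0. There [DL_char] reduces to T_i f =
    (1 - t) f, and that is the part subtracted in T_i^-1. *)
Lemma zero_at_DLi N i (f : {mpoly Fld[N]}) : (0 < i < N)%N -> zero_at i f = 0 -> zero_at i.+1 (DLi i f) = 0.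
Proof.
move=> hi h.
have hs : zero_at i.+1 (sw i f) = 0.
  have -> : zero_at i.+1 (sw i f) = sw i (zero_at i f); last by rewrite h /sw sv0.
  rewrite /zero_at /sw !sv_comp; apply: eq_sv => j hj; rewrite /swapv.
  have [e|n1] := eqVneq j i; first by rewrite sv0 sv_xv ?eqxx //; lia.
  have [e|n2] := eqVneq j i.+1.
    rewrite sv_xv; last by lia.
    rewrite sv_xv; last by lia.
    rewrite e; case: ifP => ?; [exfalso; lia|]; case: ifP => ?; [exfalso; lia|].
    by case: ifP => [_ //|?]; exfalso; lia.
  by rewrite !sv_xv // (negbTE n1) (negbTE n2).
have := sv_DL_eqn (fun j => if j == i.+1 then 0 else xv N j) (DL_char f hi).
rewrite -!/(zero_at _ _) hs mulr0 addr0.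
have -> : zero_at i.+1 (xv N i.+1) = 0 by rewrite /zero_at sv_xv ?eqxx //; lia.
have -> : zero_at i.+1 (xv N i) = xv N i.
  by rewrite /zero_at sv_xv; [case: eqP => // ?; lia | lia].
rewrite subr0 mulrAC mulrC => e.
have {}e : zero_at i.+1 (DL i f) = (1 - (tt_)%:MP) * zero_at i.+1 f.
  by apply: (mulIf (xv_neq0 (N := N) (i := i) _)); [lia | rewrite e].
rewrite /DLi hi (linopZ (@linop_zr _ _)) (linopB (@linop_zr _ _)) (linopZ (@linop_zr _ _)) e.
by rewrite -(mul_mpolyC (1 - tt_)) mpolyCB mpolyC1 subrr scaler0.
Qed.

Lemma zero_at_dch N n m (f : {mpoly Fld[N]}) : (0 < n)%N -> (n + m <= N)%N ->
  zero_at n f = 0 -> zero_at (n + m)%N (Tinv_chain (iota n m) f) = 0.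
Proof.
move=> n0; elim: m => [|m ih] hm h; first by rewrite addn0.
rewrite iota_rcons addnS /Tinv_chain foldl_rcons -/(Tinv_chain _ _).
by apply: zero_at_DLi; [lia | apply: ih => //; lia].
Qed.

(* [zero_shift] sets x_N = 0 and renames x_(N+1) to x_N; through [omv] it becomes the
   restriction x_(N+1) = 0. *)
Definition zero_shift N (f : {mpoly Fld[N.+1]}) : {mpoly Fld[N]} :=
  sv (fun j => if j == N then 0 else if j == N.+1 then xv N N else xv N j) f.

Lemma rs_omv N (f : {mpoly Fld[N.+1]}) : (0 < N)%N -> rs N (omv f) = omv (zero_shift f).
Proof.
move=> hN; rewrite /rs /omv /zero_shift !sv_comp; apply: eq_sv => j hj.
have [e|n1] := eqVneq j N.+1.
  rewrite (_ : (j == N) = false); last by lia.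
  by rewrite svZ !sv_xv ?eqxx //; lia.
have [e|n2] := eqVneq j N.
  by rewrite sv0 sv_xv; [rewrite xv0 //; lia | lia].
by rewrite !sv_xv ?(negbTE n2) //; lia.
Qed.

Lemma zero_shift_sw N (f : {mpoly Fld[N.+1]}) : (0 < N)%N -> zero_shift (sw N f) = rs N f.
Proof.
move=> hN; rewrite /zero_shift /rs /sw sv_comp; apply: eq_sv => j hj; rewrite /swapv.
have [e|n1] := eqVneq j N.
  rewrite sv_xv; last by lia.
  by rewrite eqxx e; case: ifP => // ?; exfalso; lia.
have [e|n2] := eqVneq j N.+1.
  rewrite sv_xv; last by lia.
  by rewrite eqxx [RHS]xv0 //; lia.
by rewrite sv_xv // (negbTE n1) (negbTE n2).
Qed.

(** Under this substitution f goes to 0 and s_N f to the restriction of f, so T_N f also goes to the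
    restriction. The factor t^-1 is the one in front of T_N - (1 - t) in the inverse. *)
Lemma zero_shift_DLi N (f : {mpoly Fld[N.+1]}) : (0 < N)%N -> zero_at N f = 0 ->
  zero_shift (DLi N f) = tt_^-1 *: rs N f.
Proof.
move=> hN h; have hi : (0 < N < N.+1)%N by rewrite hN ltnSn.
have k0 : zero_shift f = 0.
  have -> : zero_shift f = zero_shift (zero_at N f); last by rewrite h /zero_shift sv0.
  rewrite /zero_shift /zero_at sv_comp; apply: eq_sv => j hj.
  have [e|n1] := eqVneq j N; first by rewrite sv0.
  by rewrite sv_xv // (negbTE n1).
have ks := zero_shift_sw f hN.
have := sv_DL_eqn (fun j => if j == N then 0 else if j == N.+1 then xv N N else xv N j) (DL_char f hi).
rewrite -!/(zero_shift _) k0 mulr0 add0r ks.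
have -> : zero_shift (xv N.+1 N) = 0 by rewrite /zero_shift sv_xv ?eqxx //; lia.
have -> : zero_shift (xv N.+1 N.+1) = xv N N.
  rewrite /zero_shift sv_xv; last by lia.
  by rewrite eqxx; case: ifP => // ?; exfalso; lia.
rewrite mulr0 sub0r => e.
have xn : - xv N N != 0 by rewrite oppr_eq0; apply: xv_neq0; lia.
have {}e := mulfI xn e.
have lk : linop (@zero_shift N) by exact: linop_sv.
by rewrite /DLi hi (linopZ lk) (linopB lk) (linopZ lk) k0 scaler0 subr0 e.
Qed.

(* Sets x_p = 0 and closes the gap. *)
Definition del_var N p (f : {mpoly Fld[N.+1]}) : {mpoly Fld[N]} :=
  sv (fun j => if (j < p)%N then xv N j else if j == p then 0 else xv N j.-1) f.

Lemma sw_del N n i (f : {mpoly Fld[N.+1]}) : (0 < n <= i)%N -> (i < N)%N ->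
  sw i (del_var n f) = del_var n (sw i.+1 f).
Proof.
move=> hn hi; rewrite /sw /del_var !sv_comp; apply: eq_sv => j hj; rewrite {2}/swapv.
have [e|n1] := eqVneq j i.+1.
  rewrite ltnNge (_ : (n <= j)%N) /=; last by lia.
  rewrite (_ : (j == n) = false); last by lia.
  rewrite sv_xv; last by lia.
  rewrite sv_xv; last by lia.
  rewrite ltnNge (_ : (n <= i.+2)%N) /=; last by lia.
  rewrite (_ : (i.+2 == n) = false); last by lia.
  by rewrite /swapv e eqxx.
have [e|n2] := eqVneq j i.+2.
  rewrite ltnNge (_ : (n <= j)%N) /=; last by lia.
  rewrite (_ : (j == n) = false); last by lia.
  rewrite sv_xv; last by lia.
  rewrite sv_xv; last by lia.
  rewrite ltnNge (_ : (n <= i.+1)%N) /=; last by lia.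
  rewrite (_ : (i.+1 == n) = false); last by lia.
  by rewrite /swapv e /= eqxx; case: ifP => // ?; exfalso; lia.
rewrite sv_xv //; case: ltnP => h1.
  rewrite sv_xv; last by lia.
  rewrite /swapv; case: ifP => ?; [exfalso; lia|]; case: ifP => ?; [exfalso; lia|].
  by [].
case: eqP => h2; first by rewrite sv0.
rewrite sv_xv; last by lia.
rewrite /swapv; case: ifP => ?; [exfalso; lia|]; case: ifP => ?; [exfalso; lia|].
by [].
Qed.

Lemma del_var_sw N p (f : {mpoly Fld[N.+1]}) : (0 < p <= N)%N ->
  del_var p.+1 (sw p f) = del_var p f.
Proof.
move=> hp; rewrite /sw /del_var !sv_comp; apply: eq_sv => j hj; rewrite /swapv.
have [e|n1] := eqVneq j p.
  rewrite sv_xv; last by lia.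
  by rewrite e !ltnn eqxx.
have [e|n2] := eqVneq j p.+1.
  rewrite sv_xv; last by lia.
  rewrite e ltnSn; case: ifP => ?; [exfalso; lia|].
  by [].
rewrite sv_xv //; case: ltnP => h1; case: ltnP => h2; [by []|exfalso; lia|exfalso; lia|].
by case: ifP => // ?; exfalso; lia.
Qed.

Lemma del_var_last N (f : {mpoly Fld[N.+1]}) : del_var N.+1 f = rs N f.
Proof.
rewrite /del_var /rs; apply: eq_sv => j hj; case: ltnP => h //.
by rewrite (@xv0 N j); [case: ifP => // ?; exfalso; lia | lia].
Qed.

(** By symmetry the deleted variable can be moved step by step to the last place, where deleting it
    is restriction. *)
Lemma del_var_sym N n (f : {mpoly Fld[N.+1]}) :
  (forall i, (n < i)%N -> (i < N.+1)%N -> sw i f = f) -> (n <= N)%N -> del_var n.+1 f = rs N f.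
Proof.
move=> h hn; suff H m : (n + m <= N)%N -> del_var (n + m).+1 f = del_var n.+1 f.
  by rewrite -del_var_last -(H (N - n)%N) ?subnKC.
elim: m => [|m ih] hm; first by rewrite addn0.
rewrite -ih; last by lia.
by rewrite addnS -[in LHS](h (n + m).+1) ?del_var_sw //; lia.
Qed.

(* With h = T_(n-1)^-1 ... T_1^-1 b, write h = u + g where g is symmetric in all of
   x_n, x_(n+1), ... and u vanishes at x_n = 0. The remaining T_j^-1 fix g, while on u
   each of them is compatible with restriction up to a factor t^-1, which t^N absorbs.
   Hence t^N Y_1 b = S + t^N R with S and R stable and S divisible by x_1. *)
Section Y1Stable.
Variables (n : nat) (b : Pseq).
Hypotheses (n0 : (0 < n)%N) (hb : Pas n b).

Let h N := Tinv_chain (iota 1 n.-1) (b N).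

Let rs_dch N l (f : {mpoly Fld[N.+1]}) : (forall i, i \in l -> (i < N)%N) ->
  rs N (Tinv_chain l f) = Tinv_chain l (rs N f).
Proof.
move=> hl; apply: Tinv_chain_comm => i hi g; apply: DLi_comm => g'.
by apply: rs_DL => //; exact: hl.
Qed.

Let h_rs N : (n <= N)%N -> rs N (h N.+1) = h N.
Proof.
move=> hN; rewrite /h rs_dch; last by move=> i; rewrite mem_iota; lia.
by have [-> _ _] := hb.
Qed.

Let h_sw N i : (n < i)%N -> (i < N)%N -> sw i (h N) = h N.
Proof.
move=> hi hN; rewrite /h (Tinv_chain_comm (F := sw i)).
  by have [_ _ ->] := hb.
move=> j; rewrite mem_iota => hj g; apply: DLi_comm => g'.
by apply: sw_DL => //; lia.
Qed.

(** Setting x_n = 0 and closing the gap costs one variable, hence [N.+1]. The variables from x_n on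
    are then the old ones from x_(n+1) on, in which [h] is symmetric. *)
Let g N := del_var n (h N.+1).

Let g_rs N : (n <= N)%N -> rs N (g N.+1) = g N.
Proof.
move=> hN; rewrite /g -(@h_rs N.+1) /del_var /rs; last by lia.
rewrite !sv_comp; apply: eq_sv => j hj.
have [e|ne] := eqVneq j N.+2.
  rewrite xv0 ?sv0; last by lia.
  case: ifP => ?; [exfalso; lia|]; case: ifP => ?; [exfalso; lia|].
  by rewrite e sv_xv /=; [rewrite xv0 //; lia | lia].
rewrite (@sv_xv N.+1); last by lia.
case: ltnP => h1; first by rewrite sv_xv //; lia.
case: eqP => h2; first by rewrite sv0.
by rewrite sv_xv //; lia.
Qed.

Let g_sw N i : (n <= i)%N -> (i < N)%N -> sw i (g N) = g N.
Proof.
move=> hi hN; rewrite /g sw_del ?h_sw //; lia.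
Qed.

Let u N := h N - g N.

Let u_rs N : (n <= N)%N -> rs N (u N.+1) = u N.
Proof. by move=> hN; rewrite /u (linopB (@linop_rs _ _)) h_rs // g_rs. Qed.

(** At x_n = 0 both [g] and [h] come from [h N.+1] by setting x_n and x_(n+1) to 0: for [h],
    restriction may delete x_(n+1) instead of the last variable. *)
Let u_zr N : (n <= N)%N -> zero_at n (u N) = 0.
Proof.
move=> hN; rewrite /u (linopB (@linop_zr _ _)).
suff -> : zero_at n (g N) = zero_at n (h N) by rewrite subrr.
rewrite -(h_rs hN) -(del_var_sym (n := n)) //; last by move=> i; exact: h_sw.
rewrite /g /zero_at /del_var !sv_comp; apply: eq_sv => j hj.
have [h1|h1] := ltnP j n; first by case: ltnP => // ?; exfalso; lia.
have [e|h2] := eqVneq j n.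
  by rewrite sv0 e ltnSn sv_xv ?eqxx //; lia.
case: ltnP => h3; first by exfalso; lia.
have [e|h4] := eqVneq j n.+1.
  by rewrite sv0 e /= sv_xv ?eqxx //; lia.
by [].
Qed.

Let v N := Tinv_chain (iota n (N - n)) (u N).
Let S N := tt_ ^+ N *: omv (v N).
Let R N := omv (g N).

Let v_zr N : (n <= N)%N -> zero_at N (v N) = 0.
Proof.
move=> hN; have := zero_at_dch (N := N) (m := N - n) n0 _ (u_zr hN).
by rewrite subnKC //; apply.
Qed.

Let S_rs N : (n <= N)%N -> rs N (S N.+1) = S N.
Proof.
move=> hN; rewrite /S (linopZ (@linop_rs _ _)) rs_omv; last by lia.
have ev : v N.+1 = DLi N (Tinv_chain (iota n (N - n)) (u N.+1)).
  by rewrite /v subSn // iota_rcons /Tinv_chain foldl_rcons subnKC.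
have hz : zero_at N (Tinv_chain (iota n (N - n)) (u N.+1)) = 0.
  have := zero_at_dch (N := N.+1) (m := N - n) n0 _ (u_zr (N := N.+1) _).
  by rewrite subnKC //; apply; lia.
rewrite ev zero_shift_DLi //; last by lia.
rewrite (linopZ (@linop_omv _)) scalerA exprSr mulfK ?tt_neq0 //.
rewrite rs_dch ?u_rs // => i; rewrite mem_iota; lia.
Qed.

Let S_zr N : (n <= N)%N -> zero_at 1 (S N) = 0.
Proof.
move=> hN; rewrite /S (linopZ (@linop_zr _ _)).
have -> : zero_at 1 (omv (v N)) = omv (zero_at N (v N)).
  rewrite /zero_at /omv !sv_comp; apply: eq_sv => j hj.
  have [e|ne] := eqVneq j N; first by rewrite sv0 svZ sv_xv /= ?scaler0 //; lia.
  rewrite !sv_xv ?(negbTE ne) //; last by lia.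
  by case: ifP => // ?; exfalso; lia.
by rewrite v_zr // (linop0 (@linop_omv _)) scaler0.
Qed.

Let Y1_SR N : (n <= N)%N -> YN 1 (b N) = S N + tt_ ^+ N *: R N.
Proof.
move=> hN; rewrite /YN YL1 /S /R -scalerDr -(linopD (@linop_omv _)); congr (_ *: omv _).
have -> : iota 1 N.-1 = iota 1 n.-1 ++ iota n (N - n).
  by have := iotaD 1 n.-1 (N - n); rewrite add1n prednK // => <-; congr iota; lia.
rewrite Tinv_chain_cat -/(h N) /v /u (linopB (@linop_dch _ _)).
suff -> : Tinv_chain (iota n (N - n)) (g N) = g N by rewrite subrK.
have : forall i, i \in iota n (N - n) -> DLi i (g N) = g N.
  move=> i; rewrite mem_iota => hi; apply: DLi_fix; apply: (proj2 (DL_fixP _ _)); first by lia.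
  by apply: g_sw; lia.
elim: (iota _ _) => // i l ih hl; rewrite -[Tinv_chain _ _]/(Tinv_chain l (DLi i (g N))) hl ?mem_head // ih // => j hj.
by apply: hl; rewrite in_cons hj orbT.
Qed.

Let msize_g N : (msize (g N) <= msize (b N.+1))%N.
Proof.
apply: (@leq_trans (msize (h N.+1))); last exact: msize_dch.
by apply: msize_sv => j; do 2?case: ifP => _; rewrite ?msize0 ?msize_xv.
Qed.

Let R_sw N i : (n < i)%N -> (i < N)%N -> sw i (R N) = R N.
Proof.
move=> hi hN; apply: (proj1 (DL_fixP _ _)); first by lia.
case: i hi hN => // i hi hN; rewrite /R -omv_DL ?(proj2 (DL_fixP _ _)) //; try lia.
by apply: g_sw; lia.
Qed.

(** T_i commutes with Y_1 for i > 1, so Y_1 b inherits the symmetry of b, and S is what remains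
    after subtracting the symmetric t^N R. *)
Let S_sw N i : (n < i)%N -> (i < N)%N -> sw i (S N) = S N.
Proof.
move=> hi hN; have -> : S N = YN 1 (b N) - tt_ ^+ N *: R N by rewrite Y1_SR ?addrK //; lia.
rewrite /sw svB (svZ _ _ (R N)) -!/(sw _ _) R_sw //; congr (_ - _).
apply: (proj1 (DL_fixP _ _)); first by lia.
rewrite /YN (linopZ (@linop_DL _ _)) DL_YL1; last by lia.
by rewrite (proj2 (DL_fixP _ _)) //; [lia | have [_ _ ->] := hb].
Qed.

Let R_rs N : (n <= N)%N -> rs N (R N.+1) = R N.
Proof.
move=> hN; rewrite /R rs_omv; last by lia.
(* Symmetry of [g] under s_N exchanges the variable set to 0 with the last one, so [zero_shift] acts
   as restriction. *)
by rewrite -[g N.+1](@g_sw _ N) ?zero_shift_sw ?g_rs //; lia.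
Qed.

Lemma Y1_stable_at : exists S R, [/\ isPas S, isPas R & exists K, forall k, (K <= k)%N ->
  YN 1 (b k) = S k + tt_ ^+ k *: R k /\ zero_at 1 (S k) = 0].
Proof.
have [_ [d hd] _] := hb.
have dR k : (msize (R k) <= d)%N by apply: leq_trans (msize_omv _) (leq_trans (msize_g _) (hd _)).
have dS k : (msize (S k) <= d)%N.
  apply: msizeZ_bound; apply: leq_trans (msize_omv _) _; apply: leq_trans (msize_dch _ _) _.
  apply: msizeD_bound; first by apply: leq_trans (msize_dch _ _) (hd _).
  by apply: msizeN_bound; apply: leq_trans (msize_g _) (hd _).
have [S' hS eS] := @Pas_ext n n S S_rs (ex_intro _ d (fun k _ => dS k)) (fun k i _ => @S_sw k i).
have [R' hR eR] := @Pas_ext n n R R_rs (ex_intro _ d (fun k _ => dR k)) (fun k i _ => @R_sw k i).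
exists S', R'; split; [by eexists; exact: hS | by eexists; exact: hR |].
by exists n => k hk; rewrite eS // eR // Y1_SR // S_zr.
Qed.

End Y1Stable.

Lemma Y1_stable b : isPas b -> exists S R, [/\ isPas S, isPas R & exists K, forall k, (K <= k)%N ->
  YN 1 (b k) = S k + tt_ ^+ k *: R k /\ zero_at 1 (S k) = 0].
Proof.
by move=> [n hb]; apply: (@Y1_stable_at n.+1) => //; apply: Pas_le hb.
Qed.

Lemma isPas_zr i b : (0 < i)%N -> isPas b -> isPas (fun k => zero_at i (b k)).
Proof.
move=> i0 [n hb]; have [h1 [d h2] h3] := Pas_le (leq_maxl n i) hb.
exists (maxn n i); split.
- move=> k; rewrite -[in RHS](h1 k) /rs /zero_at !sv_comp; apply: eq_sv => j hj.
  have [e|ne] := eqVneq j i.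
    rewrite sv0; have [hk|hk] := boolP (j <= k)%N; first by rewrite sv_xv ?e ?eqxx //; lia.
    by rewrite xv0 ?sv0 //; lia.
  have [hk|hk] := boolP (j <= k)%N; last by rewrite !(xv0 (N := k)) ?sv0 ?sv_xv ?(xv0 (N := k)) //; lia.
  by rewrite !sv_xv ?(negbTE ne) //; lia.
- exists d => k; apply: leq_trans (h2 k); apply: msize_sv => j.
  by case: ifP => _; rewrite ?msize0 ?msize_xv.
- move=> k j hj hk; rewrite -[in RHS](h3 k j) //.
  rewrite /sw /zero_at !sv_comp; apply: eq_sv => l hl.
  have [e|ne] := eqVneq l i.
    rewrite sv0 /swapv; case: ifP => ?; [exfalso; lia|]; case: ifP => ?; [exfalso; lia|].
    by rewrite sv_xv // e eqxx.
  rewrite sv_xv // /swapv; case: ifP => ?; last case: ifP => ?.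
  - by rewrite sv_xv; [case: ifP => // ?; exfalso; lia | lia].
  - by rewrite sv_xv; [case: ifP => // ?; exfalso; lia | lia].
  - by rewrite sv_xv // (negbTE ne).
Qed.

(** The projection rho leaves S alone and changes only R, which carries t^N. So the sequences with
    and without rho have the same limit S, and [Ycal1] can be computed without rho. *)
Lemma Ycal1_spec b : isPas b -> isPas (Ycal1 b) /\ Cseq (fun k => YN 1 (b k)) (Ycal1 b).
Proof.
move=> hb; have [S [R [hS hR [K hK]]]] := Y1_stable hb.
have t0 : tconv (fun k => tt_ ^+ k) 0 by apply: tconv_tn => N; exists N.
have lim c : isPas c -> Cseq (fun k => S k + tt_ ^+ k *: c k) S.
  move=> hc; have := CseqD (Cseq_Pas hS) (CseqZ t0 (Cseq_Pas hc)).
  have -> : (fun k => S k + 0 *: c k) = S; last exact.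
  by apply: pseq_ext => k; rewrite scale0r addr0.
have hR' : isPas (fun k => R k - zero_at 1 (R k)).
  have := isPasD hR (isPasZ (-1) (isPas_zr (ltn0Sn 0) hR)).
  rewrite (_ : (fun k => R k + _) = (fun k => R k - zero_at 1 (R k))) //.
  by apply: pseq_ext => k; rewrite scaleN1r.
have e : Ycal1 b = S.
  apply: Cseq_lim; apply: Cseq_ext (lim _ hR'); exists K => k /hK[e1 e2].
  have -> : tt_ ^+ k *: (Yop 1 (b k) - x1zero (Yop 1 (b k))) = YN 1 (b k) - zero_at 1 (YN 1 (b k)).
    by rewrite YopE x1zeroE scalerBr -(linopZ (@linop_zr _ _)).
  rewrite e1 (linopD (@linop_zr _ _)) e2 add0r (linopZ (@linop_zr _ _)) -addrA.
  by rewrite (scalerBr _ (R k)).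
rewrite e; split; first exact: hS.
apply: Cseq_ext (lim _ hR); exists K => k /hK[e1 _].
by rewrite e1.
Qed.

Lemma Ycal1D b c al : isPas b -> isPas c ->
  Ycal1 (fun k => b k + al *: c k) = (fun k => Ycal1 b k + al *: Ycal1 c k).
Proof.
move=> hb hc; have hbc := isPasD hb (isPasZ al hc).
have [_ h1] := Ycal1_spec hbc; have [_ h2] := Ycal1_spec hb; have [_ h3] := Ycal1_spec hc.
apply: Cseq_uniq h1 _; apply: Cseq_ext (CseqD h2 (CseqZ (tconv_const al) h3)).
by exists 0%N => k _; rewrite (linopD (@linop_YN _ _)) (linopZ (@linop_YN _ _)).
Qed.

Lemma Ycal10 : Ycal1 Pzero = Pzero.
Proof.
have [_ h] := Ycal1_spec isPas0; apply: Cseq_uniq h _; apply: Cseq0.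
by exists 0%N => k _; rewrite (linop0 (@linop_YN _ _)).
Qed.

Lemma Cseq_Y1 fs f : Cseq fs f -> Cseq (fun k => YN 1 (fs k)) (Ycal1 f).
Proof.
elim=> [{}fs [K h]|gs gs' g a al b hg ih ha hb [K e]].
  by rewrite Ycal10; apply: Cseq0; exists K => k hk; rewrite h // (linop0 (@linop_YN _ _)).
rewrite Ycal1D //; last exact: Cseq_isPas hg.
have [_ hb'] := Ycal1_spec hb.
apply: Cseq_ext (CseqD ih (CseqZ ha hb')); exists K => k hk.
by rewrite e // (linopD (@linop_YN _ _)) (linopZ (@linop_YN _ _)).
Qed.

Lemma Tinf_big i b k : (i < k)%N -> Tinf i b k = DL i (b k).
Proof.
move=> h; rewrite /Tinf; have e : maxn k i.+1 = k by lia.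
by rewrite e restrE rs_id TopE.
Qed.

Lemma Tinf_small i b k : (k <= i.+1)%N -> Tinf i b k = rs k (DL i (b i.+1)).
Proof.
move=> h; rewrite /Tinf; have e : maxn k i.+1 = i.+1 by lia.
by rewrite e restrE TopE.
Qed.

Lemma isPas_T i b : isPas b -> isPas (Tinf i b).
Proof.
move=> [n hb]; have [h1 [d h2] h3] := Pas_le (leq_maxl n i.+1) hb.
exists (maxn n i.+1); split.
- move=> k; have [hk|hk] := leqP k i.
    by rewrite !Tinf_small ?rs_rs //; lia.
  by rewrite !Tinf_big ?rs_DL ?h1 //; lia.
- exists d => k; rewrite /Tinf restrE TopE.
  exact: leq_trans (msize_rs _ _) (leq_trans (msize_DL _ _) (h2 _)).
- move=> k j hj hk; rewrite Tinf_big; last by lia.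
  by rewrite sw_DL ?h3 //; lia.
Qed.

Lemma Tinf_lin i b c al :
  Tinf i (fun k => b k + al *: c k) = (fun k => Tinf i b k + al *: Tinf i c k).
Proof.
apply: pseq_ext => k; rewrite /Tinf !restrE !TopE.
by rewrite (linopD (@linop_DL _ _)) (linopZ (@linop_DL _ _)) (linopD (@linop_rs _ _)) (linopZ (@linop_rs _ _)).
Qed.

Lemma Cseq_T i fs f : Cseq fs f -> Cseq (fun k => DL i (fs k)) (Tinf i f).
Proof.
elim=> [{}fs [K h]|gs gs' g a al b hg ih ha hb [K e]].
  rewrite (_ : Tinf i Pzero = Pzero).
    by apply: Cseq0; exists K => k hk; rewrite h // (linop0 (@linop_DL _ _)).
  apply: pseq_ext => k; rewrite /Tinf restrE TopE.
  by rewrite (linop0 (@linop_DL _ _)) (linop0 (@linop_rs _ _)).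
rewrite Tinf_lin; apply: (CseqS ih ha (isPas_T i hb)); exists (maxn K i.+1) => k hk.
by rewrite e ?(linopD (@linop_DL _ _)) ?(linopZ (@linop_DL _ _)) ?Tinf_big //; lia.
Qed.

Lemma Cseq_Y r fs f : (0 < r)%N -> Cseq fs f -> Cseq (fun k => YN r (fs k)) (Ycal r f).
Proof.
elim: r fs f => // -[|r] ih fs f _ hf; first exact: Cseq_Y1.
have h := CseqZ (tconv_const tt_^-1) (Cseq_T r.+1 (ih _ _ (ltn0Sn r) (Cseq_T r.+1 hf))).
apply: Cseq_ext h; exists 0%N => k _.
by rewrite /YN (@YLS _ r.+1) // (linopZ (@linop_DL _ _)) !scalerA mulrC.
Qed.

(** * Convergence of the Macdonald polynomials *)

Definition mwid n k (m : 'X_{1..n}) : 'X_{1..k} := [multinom mexp m i | i < k].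
Arguments mwid {n} k m.

Lemma mexp_out n (m : 'X_{1..n}) j : (n <= j)%N -> mexp m j = 0%N.
Proof. by move=> h; rewrite /mexp nth_default // size_tuple. Qed.

Lemma mexp_multinom n (f : nat -> nat) j : (j < n)%N -> mexp [multinom f i | i < n] j = f j.
Proof. by move=> h; rewrite -(mexpE _ (Ordinal h)) mnmE. Qed.

Lemma big_widen0 (R : comNzRingType) n k (x : nat -> R) (e : nat -> nat) : (n <= k)%N ->
  (forall j, (n <= j < k)%N -> x j ^+ e j = 1) ->
  \prod_(i < k) x i ^+ e i = \prod_(i < n) x i ^+ e i.
Proof.
move=> hk h; rewrite -(big_mkord xpredT (fun i => x i ^+ e i)) -[RHS](big_mkord xpredT (fun i => x i ^+ e i)).
rewrite (big_cat_nat _ hk) //= [X in _ * X]big_nat [X in _ * X]big1 ?mulr1 //.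
Qed.

Lemma rs_coeff n k (f : {mpoly Fld[k]}) (m : 'X_{1..n}) : (n <= k)%N ->
  (rs n f)@_m = f@_(mwid k m).
Proof.
move=> hk; rewrite {1}(mpolyE f) [in RHS](mpolyE f) (linop_sum (@linop_rs _ _)) !raddf_sum /=.
apply: eq_bigr => l _; rewrite (linopZ (@linop_rs _ _)) !mcoeffZ; congr (_ * _).
rewrite mcoeffX /rs sv_monom.
have ex : \prod_(i < k) xv n i.+1 ^+ l i = \prod_(i < k) xv n i.+1 ^+ mexp l i.
  by apply: eq_bigr => i _; rewrite mexpE.
have [/existsP[i /andP[hi li]]|hno] := boolP [exists i : 'I_k, (n <= i)%N && (0 < l i)%N].
  rewrite (bigD1 i) //= xv0 ?expr0n; last by lia.
  rewrite (_ : (l i == 0)%N = false) ?mul0r ?mcoeff0; last by lia.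
  have -> : (l == mwid k m) = false; last by rewrite /= mulr0n.
  by apply/eqP => e; move: li; rewrite e mnmE mexp_out.
rewrite ex (@big_widen0 _ n k (fun i => xv n i.+1) (mexp l) hk); last first.
  move=> j /andP[hj hjk]; have := hno; rewrite negb_exists => /forallP /(_ (Ordinal hjk)).
  by rewrite hj /= mexpE /= -eqn0Ngt => /eqP ->; rewrite expr0.
pose l' : 'X_{1..n} := [multinom mexp l i | i < n].
have -> : \prod_(i < n) xv n i.+1 ^+ mexp l i = 'X_[l'].
  by rewrite mpolyXE_id; apply: eq_bigr => i _; rewrite xv_ord mnmE.
rewrite mcoeffX; congr (_%:R); congr nat_of_bool; apply/eqP/eqP => [<-|e].
  apply/mnmP => i; rewrite mnmE mexpE; have [hi|hi] := ltnP i n; first by rewrite mexp_multinom.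
  rewrite (mexp_out l' hi); have := hno; rewrite negb_exists => /forallP /(_ i).
  by rewrite hi /= mexpE -eqn0Ngt => /eqP.
by apply/mnmP => i; rewrite mnmE e mexp_multinom ?mexpE //; have := ltn_ord i; lia.
Qed.

Lemma mdeg_nuN k (m : 'X_{1..k}) : mdeg m = (\sum_(0 <= j < k) mexp m j)%N.
Proof. by rewrite mdegE big_mkord; apply: eq_bigr => i _; rewrite mexpE. Qed.

(** Every counted position carries a positive entry, and the summand 1 is charged to the entry
    itself. The bound is independent of k, so finitely many labels suffice. *)
Lemma sexp_pos k i (l : 'X_{1..k}) : (0 < i <= k)%N -> (0 < mexp l i.-1)%N ->
  (sexp i l <= mdeg l)%N.
Proof.
move=> hi hl; rewrite mdeg_nuN (@big_cat_nat _ _ _ i) //=; [|lia].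
have -> : (\sum_(0 <= j < i) mexp l j = \sum_(0 <= j < i.-1) mexp l j + mexp l i.-1)%N.
  by case: i hi hl => // i _ _; rewrite big_nat_recr.
have h1 : (\sum_(i <= j < k) (mexp l i.-1 <= mexp l j) <= \sum_(i <= j < k) mexp l j)%N.
  by apply: leq_sum => j _; case: leqP => //; lia.
have h2 : (\sum_(0 <= j < i.-1) (mexp l i.-1 < mexp l j) <= \sum_(0 <= j < i.-1) mexp l j)%N.
  by apply: leq_sum => j _; case: ltnP => //; lia.
by rewrite /sexp; lia.
Qed.

(** A zero entry counts all later positions and the positive earlier ones; what is missing from k is
    the number of earlier zeros. *)
Lemma sexp_zero k i (l : 'X_{1..k}) : (0 < i <= k)%N -> mexp l i.-1 = 0%N ->
  sexp i l = (k - (i.-1 - \sum_(0 <= j < i.-1) (0 < mexp l j)))%N.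
Proof.
move=> hi hl; rewrite /sexp hl.
have -> : (\sum_(i <= j < k) (0 <= mexp l j)%N = k - i)%N.
  by rewrite (eq_bigr (fun=> 1%N)) // sum_nat_const_nat muln1.
have : (\sum_(0 <= j < i.-1) (0 < mexp l j) <= \sum_(0 <= j < i.-1) 1)%N.
  by apply: leq_sum => j _; case: (_ < _)%N.
by rewrite sum_nat_const_nat muln1; lia.
Qed.

(* The labels of candidate eigenvalues: [inl (a, s)] stands for q^a t^s and
   [inr r] for t^(N - r), the eigenvalue attached to a zero entry. *)
Definition cval (x : nat * nat + nat) (k : nat) : Fld :=
  match x with inl p => qq_ ^+ p.1 * tt_ ^+ p.2 | inr r => tt_ ^+ (k - r) end.

Definition clim (x : nat * nat + nat) : Fld :=
  match x with inl p => qq_ ^+ p.1 * tt_ ^+ p.2 | inr r => 0 end.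

Lemma cval_lim x : tconv (cval x) (clim x).
Proof.
case: x => [p|r]; first exact: tconv_const.
by apply: tconv_tn => N; exists (N + r)%N => k hk; lia.
Qed.

Section Limit.
Variable mu : seq nat.
Let n := size mu.
Let d := sumn mu.
Let mn j := nth 0%N mu j.

(** Agrees with [mu0 mu m] for k = n + m; indexing by k turns the padded compositions into one
    family. *)
Definition padmu k : 'X_{1..k} := [multinom nth 0%N mu i | i < k].

Lemma mexp_padmu k j : (j < k)%N -> mexp (padmu k) j = mn j.
Proof. by move=> h; rewrite mexp_multinom. Qed.

Lemma mn_out j : (n <= j)%N -> mn j = 0%N.
Proof. by move=> h; rewrite /mn nth_default. Qed.

Lemma sumn_mn : d = (\sum_(0 <= j < n) mn j)%N.
Proof. by rewrite /d sumnE (big_nth 0%N). Qed.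

Lemma mdeg_padmu k : (n <= k)%N -> mdeg (padmu k) = d.
Proof.
move=> hk; rewrite mdeg_nuN sumn_mn (big_cat_nat _ hk) //= [X in (_ + X)%N]big_nat_cond.
rewrite [X in (_ + X)%N]big1 ?addn0; last first.
  by move=> j /andP[/andP[h1 h2] _]; rewrite mexp_padmu // mn_out.
by rewrite big_nat [RHS]big_nat; apply: eq_bigr => j hj; rewrite mexp_padmu //; lia.
Qed.

(** The stable family of x^mu. Below n variables it differs from the monomial of [padmu k], which
    truncates mu instead of setting variables to 0. *)
Definition mon0 (k : nat) : {mpoly Fld[k]} := \prod_(j < n) xv k j.+1 ^+ mn j.

Lemma sv_prod N k (g : nat -> {mpoly Fld[k]}) (I : Type) (r : seq I) (F : I -> {mpoly Fld[N]}) :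
  sv g (\prod_(i <- r) F i) = \prod_(i <- r) sv g (F i).
Proof. by apply: (big_morph (sv g) (svM g) (sv1 _ g)). Qed.

Lemma isPas_mon0 : isPas mon0.
Proof.
exists n; split.
- move=> k; rewrite /rs /mon0 sv_prod; apply: eq_bigr => j _; rewrite svX; congr (_ ^+ _).
  have [h|h] := boolP (j.+1 <= k.+1)%N; first by rewrite sv_xv //; lia.
  by rewrite !xv0 ?sv0 //; lia.
- exists d.+1 => k; rewrite sumn_mn big_mkord /mon0.
  apply: (big_ind2 (fun (p : {mpoly Fld[k]}) e => (msize p <= e.+1)%N)).
  + by rewrite msize1.
  + by move=> p a q b; exact: msizeM_bound.
  move=> i _; elim: (mn i) => [|e ih]; first by rewrite expr0 msize1.
  by rewrite exprS; exact: (@msizeM_bound _ _ _ 1 e (msize_xv _ _) ih).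
- move=> k i hi hk; rewrite /sw /mon0 sv_prod; apply: eq_bigr => j _.
  by rewrite svX -/(sw _ _) sw_o //; have := ltn_ord j; lia.
Qed.

Lemma mon0E k : (n <= k)%N -> mon0 k = 'X_[padmu k].
Proof.
move=> hk; rewrite mpolyXE_id /mon0 -(big_widen0 (x := fun j => xv k j.+1) hk).
  by apply: eq_bigr => i _; rewrite xv_ord mnmE.
by move=> j /andP[hj _]; rewrite mn_out // expr0.
Qed.

(* This list does not depend on N, yet it separates mu*0^m from every composition
   below it: two distinct ones of the same degree differ in one of the first n entries. *)
Definition sepl : seq (nat * (nat * nat + nat)) :=
  [seq (i, inl (p : nat * nat)) | i <- iota 1 n,
     p <- [seq p <- [seq (a, s) | a <- iota 1 d, s <- iota 0 d.+1] | p.1 != mn i.-1]]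
  ++ [seq (i, inr r) | i <- [seq i <- iota 1 n | (0 < mn i.-1)%N], r <- iota 0 n].

Lemma sepl_inl i a s : (i, inl (a, s)) \in sepl ->
  (0 < i <= n)%N /\ a != mn i.-1 /\ (0 < a)%N.
Proof.
rewrite mem_cat => /orP[/allpairsPdep[i' [p [hi hp [-> e]]]]|/allpairsPdep[i' [r [_ _ //]]]].
move: hp; rewrite -e mem_filter => /andP[h1 /allpairsPdep[a' [s' [ha hs [ea es]]]]].
by rewrite mem_iota in hi; rewrite mem_iota in ha; split; [lia | split=> //; lia].
Qed.

Lemma sepl_inr i r : (i, inr r) \in sepl -> (0 < i <= n)%N /\ (0 < mn i.-1)%N.
Proof.
rewrite mem_cat => /orP[/allpairsPdep[i' [p [_ _ //]]]|/allpairsPdep[i' [r' [hi hr [-> e]]]]].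
by move: hi; rewrite mem_filter mem_iota; lia.
Qed.

Lemma sepl_idx i x : (i, x) \in sepl -> (0 < i <= n)%N.
Proof. by case: x => [[a s] /sepl_inl[]|r /sepl_inr[]]. Qed.

Definition seplk k : seq (nat * Fld) := [seq (x.1, cval x.2 k) | x <- sepl].

Lemma seplk_valid k : (n <= k)%N -> validL k (seplk k).
Proof.
by move=> hk ic /mapP[[i x] /sepl_idx hi ->] /=; lia.
Qed.

Lemma seplk_neq0 k : (n <= k)%N -> projc (seplk k) (padmu k) != 0.
Proof.
move=> hk; apply: projc_neq0 => ic /mapP[[i x] hx ->] /=.
have hi := sepl_idx hx; apply/eqP; rewrite /eig mexp_padmu; last by lia.
case: x hx => [[a s] /sepl_inl[_ [h _]]|r /sepl_inr[_ h]] /=.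
  by move=> /qt_inj e; rewrite e eqxx in h.
rewrite -[X in _ = X]mul1r -(expr0 qq_) => /qt_inj e.
by rewrite e in h.
Qed.

Lemma seplk_sep k (l : 'X_{1..k}) : (n <= k)%N -> bru_lt l (padmu k) ->
  exists2 ic, ic \in seplk k & eig ic.1 l = ic.2.
Proof.
move=> hk hl.
have dl : mdeg l = d by rewrite (bru_lt_mdeg hl) mdeg_padmu.
have [i hi hne] : exists2 i, (0 < i <= n)%N & mexp l i.-1 != mn i.-1.
  have [/hasP[i]|/hasPn hno] := boolP (has (fun i => mexp l i.-1 != mn i.-1) (iota 1 n)).
    by rewrite mem_iota => hi hne; exists i => //; lia.
  case: (@bru_lt_irr k (padmu k)); rewrite -{1}(_ : l = padmu k) //.
  have e j : (j < n)%N -> mexp l j = mn j.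
    by move=> hj; have := hno j.+1; rewrite mem_iota negbK => /(_ _)/eqP; apply; lia.
  have s0 : (\sum_(n <= j < k) mexp l j = 0)%N.
    move: dl; rewrite mdeg_nuN sumn_mn (big_cat_nat _ hk) //=.
    rewrite big_nat (eq_bigr mn) -?big_nat; first by lia.
    by move=> j hj; apply: e; lia.
  apply/mnmP => j; rewrite mnmE mexpE; have [hj|hj] := ltnP j n; first exact: e.
  rewrite -/(mn j) mn_out //; apply/eqP; move/eqP: s0.
  rewrite sum_nat_seq_eq0 => /allP /(_ (nat_of_ord j)); rewrite mem_index_iota hj ltn_ord.
  by apply.
(* A zero entry of l where it differs from mu means that mu is positive there, the only case in
   which [sepl] offers labels [inr]. *)
have [z|p] := posnP (mexp l i.-1).
  pose r := (i.-1 - \sum_(0 <= j < i.-1) (0 < mexp l j))%N.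
  exists (i, cval (inr r) k); last by rewrite /eig z mul1r (sexp_zero _ z) //; lia.
  apply/mapP; exists (i, inr r) => //; rewrite mem_cat; apply/orP; right.
  apply/allpairsPdep; exists i, r; split=> //; last by rewrite mem_iota /r; lia.
  by rewrite mem_filter mem_iota; rewrite z in hne; lia.
have hs := @sexp_pos k i l; pose p0 := (mexp l i.-1, sexp i l).
exists (i, cval (inl p0) k) => //.
apply/mapP; exists (i, inl p0) => //; rewrite mem_cat; apply/orP; left.
apply/allpairsPdep; exists i, p0; split=> //; first by rewrite mem_iota; lia.
rewrite mem_filter; apply/andP; split; first exact: hne.
apply/allpairsPdep; exists (mexp l i.-1), (sexp i l); split=> //.
  have : (mexp l i.-1 <= mdeg l)%N.
    have hik : (i.-1 < k)%N by lia.
    by rewrite mdegE (bigD1 (Ordinal hik)) //= mexpE leq_addr.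
  by rewrite mem_iota; lia.
by rewrite mem_iota; rewrite dl in hs; have := hs _ p; lia.
Qed.
End Limit.

(** * The limiting eigenvalues and the weight equation *)

Section Weight.
Variable mu : seq nat.
Let n := size mu.
Let mn j := nth 0%N mu j.
Local Notation pad := (padmu mu).

Definition alim i : Fld :=
  if (0 < mn i.-1)%N then
    qq_ ^+ mn i.-1 * tt_ ^+ (1 + \sum_(i <= j < n) (mn i.-1 <= mn j)
      + \sum_(0 <= j < i.-1) (mn i.-1 < mn j))
  else 0.

Lemma mn_idx i : (0 < i)%N -> (0 < mn i.-1)%N -> (i <= n)%N.
Proof.
move=> i0; have [// | h] := leqP i n.
by rewrite /mn nth_default //; rewrite -/n; lia.
Qed.

Lemma eig_lim i : (0 < i)%N -> tconv (fun k => eig i (pad k)) (alim i).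
Proof.
move=> i0; rewrite /alim; case: ifP => hp.
  have hin := mn_idx i0 hp.
  apply: tconv_ext (tconv_const _); exists n => k hk.
  rewrite /eig /sexp mexp_padmu; last by lia.
  congr (_ * _ ^+ (_ + _ + _)).
    rewrite (big_cat_nat _ hk) //= [X in _ = (_ + X)%N]big_nat [X in _ = (_ + X)%N]big1 ?addn0.
      rewrite !(big_nat _ _ i n); apply: eq_bigr => j hj.
      by rewrite mexp_padmu //; lia.
    move=> j hj; rewrite mexp_padmu; last by lia.
    have -> : nth 0%N mu j = 0%N by rewrite nth_default // -/n; lia.
    by rewrite leqNgt (hp : (0 < nth 0%N mu i.-1)%N).
  rewrite big_nat [RHS]big_nat; apply: eq_bigr => j hj.
  by rewrite mexp_padmu //; lia.
have h := @tconv_tn (fun k => sexp i (pad k)).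
apply: tconv_ext (h _).
  exists i => k hk; rewrite /eig mexp_padmu; last by lia.
  by rewrite -/(mn _) (_ : mn i.-1 = 0%N) ?mul1r //; lia.
move=> N; exists (i + N)%N => k hk.
have z : mexp (pad k) i.-1 = 0%N by rewrite mexp_padmu; [rewrite -/(mn _); lia | lia].
have hik : (0 < i <= k)%N by lia.
by rewrite (sexp_zero hik z); lia.
Qed.

(** If mu_i = 0 only labels [inl] occur, and their limits are nonzero. If mu_i > 0, then [inr] has
    limit 0 and [inl] a different power of q. So the normalising denominators have a nonzero
    limit. *)
Lemma clim_neq i x : (i, x) \in sepl mu -> alim i != clim x.
Proof.
case: x => [[a s] /sepl_inl[hi [ha a0]]|r /sepl_inr[hi h0]]; rewrite /alim /=.
  case: ifP => hp.
    by apply/eqP => /qt_inj e; rewrite -e /mn eqxx in ha.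
  by rewrite eq_sym; exact: qt_neq0.
by rewrite /mn h0; exact: qt_neq0.
Qed.

Lemma tconv_prod (I : eqType) (r : seq I) (a : I -> nat -> Fld) (l : I -> Fld) :
  (forall i, i \in r -> tconv (a i) (l i)) ->
  tconv (fun k => \prod_(i <- r) a i k) (\prod_(i <- r) l i).
Proof.
elim: r => [|i r ih] h.
  rewrite big_nil; apply: tconv_ext (tconv_const 1).
  by exists 0%N => k _; rewrite big_nil.
rewrite big_cons.
have h1 : tconv (a i) (l i) by apply: h; rewrite mem_head.
have h2 : forall j, j \in r -> tconv (a j) (l j) by move=> j hj; apply: h; rewrite in_cons hj orbT.
have := tconvM h1 (ih h2); apply: tconv_ext; exists 0%N => k _.
by rewrite big_cons.
Qed.

Lemma projc_lim : tconv (fun k => projc (seplk mu k) (pad k))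
  (\prod_(x <- sepl mu) (alim x.1 - clim x.2)).
Proof.
have h : tconv (fun k => \prod_(x <- sepl mu) (eig x.1 (pad k) - cval x.2 k))
    (\prod_(x <- sepl mu) (alim x.1 - clim x.2)).
  apply: (tconv_prod (a := fun x k => eig x.1 (pad k) - cval x.2 k)
    (l := fun x => alim x.1 - clim x.2)) => -[i x] hx.
  have hi := sepl_idx hx.
  by apply: tconvB; [apply: eig_lim; case/andP: hi | exact: cval_lim].
by apply: tconv_ext h; exists 0%N => k _; rewrite /projc /seplk big_map.
Qed.

Lemma projc_lim_neq0 : \prod_(x <- sepl mu) (alim x.1 - clim x.2) != 0.
Proof.
rewrite prodf_seq_neq0; apply/allP => -[i x] hx /=.
by rewrite subr_eq0 clim_neq.
Qed.

Lemma Cseq_proj (L : seq (nat * (nat * nat + nat))) fs f :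
  (forall x, x \in L -> (0 < x.1)%N) -> Cseq fs f ->
  exists g, Cseq (fun k => proj [seq (x.1, cval x.2 k) | x <- L] (fs k)) g.
Proof.
move=> hL hf; elim: L hL => [|[i x] L ih] hL; first by exists f.
have [y hy|g hg] := ih; first by apply: hL; rewrite in_cons hy orbT.
have i0 : (0 < i)%N by exact: (hL (i, x) (mem_head _ _)).
have h := CseqD (Cseq_Y i0 hg) (CseqZ (tconvN (cval_lim x)) hg).
eexists; apply: Cseq_ext h; exists 0%N => k _.
by rewrite scaleNr.
Qed.

Lemma Cseq_Emac : exists E, Cseq (fun k => Emac (pad k)) E.
Proof.
have [g hg] : exists g, Cseq (fun k => proj (seplk mu k) (mon0 mu k)) g.
  apply: (@Cseq_proj (sepl mu) (mon0 mu)); last by apply: Cseq_Pas; exact: isPas_mon0.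
  by move=> [i x] /sepl_idx /andP[].
have h := CseqZ (tconvV projc_lim_neq0 projc_lim) hg.
eexists; apply: Cseq_ext h; exists n => k hk.
rewrite mon0E // -Emac_proj //.
- exact: seplk_valid.
- by move=> l; exact: seplk_sep.
- exact: seplk_neq0.
Qed.

Lemma restr_Emac k M : M = k -> restr k (Emac (pad M)) = Emac (pad k).
Proof. by move=> ->; rewrite restrE rs_id. Qed.

Lemma Etilde_Cseq : Cseq (fun k => Emac (pad k)) (Etilde mu).
Proof.
have [E hE] := Cseq_Emac; suff -> : Etilde mu = E by [].
apply: Cseq_lim; apply: Cseq_ext hE; exists n => k hk.
by rewrite (@restr_Emac k (size mu + (k - size mu))) // subnKC.
Qed.

Lemma Emac_coeff k : (Emac (pad k))@_(pad k) = 1.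
Proof. by have [_ h] := Emac_isE (pad k); exact: tri_coeff h. Qed.

(** The chosen eigenvalue is pinned down by the coefficient of x^(mu*0^m), which is 1 in the
    Macdonald polynomial. *)
Lemma alpha_mE m i : (0 < i <= n + m)%N ->
  tt_ ^+ (n + m) * alpha_m mu m i = eig i (pad (n + m)).
Proof.
move=> hi; have [hY _] := Emac_isE (pad (n + m)).
have h : exists a, Yop i (Emac (mu0 mu m)) = a *: Emac (mu0 mu m).
  exists (tt_ ^- (n + m) * eig i (pad (n + m))).
  by rewrite YopE -[mu0 mu m]/(pad (n + m)) -scalerA -hY // /YN scalerA mulVf ?scale1r ?ttn_neq0.
have := choose_spec 0 h; rewrite -/(alpha_m mu m i) -[mu0 mu m]/(pad (n + m)) YopE => e.
have := hY i hi; rewrite /YN e scalerA.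
move=> /(congr1 (fun p : {mpoly Fld[n + m]} => p@_(pad (n + m)))).
by rewrite !mcoeffZ Emac_coeff !mulr1.
Qed.

Lemma alpha_tildeE i : (0 < i)%N -> alpha_tilde mu i = alim i.
Proof.
move=> i0.
have h : tconv (fun m => tt_ ^+ (n + m) * alpha_m mu m i) (alim i).
  move=> N; have [K hK] := eig_lim i0 N; exists (K + i)%N => m hm.
  by rewrite alpha_mE; [apply: hK; lia | lia].
by apply: tconv_uniq (choose_spec 0 (ex_intro _ _ h)) h.
Qed.

(** The coefficient of x^mu equals 1 from n variables on, hence also in the limit. *)
Lemma Etilde_neq0 : Etilde mu <> Pzero.
Proof.
move=> e; have := IW_coeff (pad n) (Cseq_IW Etilde_Cseq); rewrite e mcoeff0 => h0.
have h1 : tconv (fun k => (rs n (Emac (pad k)))@_(pad n)) 1.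
  apply: tconv_ext (tconv_const 1); exists n => k hk.
  rewrite rs_coeff // (_ : mwid k (pad n) = pad k) ?Emac_coeff //.
  apply/mnmP => i; rewrite !mnmE; have [hi|hi] := ltnP i n; first by rewrite mexp_padmu.
  by rewrite mexp_out // nth_default.
by have /eqP := tconv_uniq h1 h0; rewrite oner_eq0.
Qed.

Lemma Ycal_Etilde i : (0 < i)%N -> Ycal i (Etilde mu) = Pscale (alim i) (Etilde mu).
Proof.
move=> i0; apply: Cseq_uniq (Cseq_Y i0 Etilde_Cseq) _.
apply: Cseq_ext (CseqZ (eig_lim i0) Etilde_Cseq); exists i => k hk.
by have [-> //] := Emac_isE (pad k); lia.
Qed.

End Weight.


Theorem theorem5 (mu : seq nat) : Yweight_vector (Etilde mu) (alpha_tilde mu).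
Proof.
split; first exact: Etilde_neq0.
by move=> i i0; rewrite alpha_tildeE //; exact: Ycal_Etilde.
Qed.
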